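(* Let $D$ be an oriented knotted surface diagram in $\mathbb{R}^3$. Let $(X,[\ ])$ be a KTQ, let $p,k\ge 0$ be integers, and let $\mathcal{C}^{(p,k)}$ be a layered coloring of $D$ using elements of $(X,[\ ])$. Then \[ c(\mathcal{C}^{(p,k)}):=\sum_{tr}\tau(tr)\,cp(tr,\mathcal{C}^{(p,k)}), \] with the summation taken over all triple points $tr$ of $D$ and $\tau(tr)=\pm1$ denoting the sign of the triple point, is a cycle in the truncated chain complex defining $H_n^{(p,k)}(X,[\ ])$, where $n=p+k+2$; that is, $\partial_n^{(p,k)}c(\mathcal{C}^{(p,k)})=0$ in $C_{n-1}^{(p,k)}(X,[\ ])$.
   Context: ''Knotted surface'' means surface-knot or surface-link in $\mathbb{R}^4$; a diagram is a (broken) diagram of its generic projection to $\mathbb{R}^3$, with double point edges, triple points and branch points. A ternary quasigroup is a set $X$ with an operation $[\ ]\colon X^3\to X$ such that in any relation $[x_1x_2x_3]=x_4$ specification of any three of $x_1,x_2,x_3,x_4$ determines the remaining one uniquely. A KTQ (knot-theoretic ternary quasigroup) is a ternary quasigroup such that for all $a,b,c,d\in X$: (LN) $[ab[bcd]]=[a[abc][[abc]cd]]$ and (RN) $[[abc]cd]=[[ab[bcd]][bcd]d]$. Regions of $D$: the connected components of the complement in $\mathbb{R}^3$ of the underlying (unbroken) projection; their set is $Reg(D)$. Each sheet of $D$ is co-oriented by the normal $\nu$ such that (orientation of the sheet, $\nu$) is the orientation of $\mathbb{R}^3$. For a double point edge or a triple point, its source region is the local region from which all nearby co-orientation arrows point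 away; its target region is the local region into which all nearby co-orientation arrows point. The sign $\tau(tr)$ of a triple point is $+1$ if the co-orientation normals of the top, middle and bottom sheets, in this order, form a positively oriented frame of $\mathbb{R}^3$, and $-1$ otherwise. KTQ coloring: a map $\mathcal{C}\colon Reg(D)\to X$ such that at every double point edge, with $r_0$ the source region, $r_1$ the region separated from $r_0$ by an under-sheet, $r_2$ the target region, and $r_3$ the remaining region, $\mathcal{C}(r_3)=[\mathcal{C}(r_0)\mathcal{C}(r_1)\mathcal{C}(r_2)]$. Left coloring of a KTQ coloring $\mathcal{C}$: a map $\mathcal{C}_L\colon Reg(D)\to X$ such that whenever a co-orientation arrow points from region $r$ to adjacent region $r'$ across a sheet, $\mathcal{C}_L(r')=[\mathcal{C}_L(r)\,\mathcal{C}(r)\,\mathcal{C}(r')]$. Right coloring of $\mathcal{C}$: a map $\mathcal{C}_R\colon Reg(D)\to X$ such that whenever a co-orientation arrow points from $r$ to adjacent $r'$, $\mathcal{C}_R(r)=[\mathcal{C}(r)\,\mathcal{C}(r')\,\mathcal{C}_R(r')]$. Left and right colorings of a KTQ coloring are themselves KTQ colorings. Layered coloring $\mathcal{C}^{(p,k)}=(\mathcal{C}_0,\ldots,\mathcal{C}_{p+k})$: $\mathcal{C}_p$ is a KTQ coloring of $D$, $\mathcal{C}_{i-1}$ is a left coloring of $\mathcal{C}_i$ for $1\le i\le p$, and $\mathcal{C}_{i+1}$ is a right coloring of $\mathcal{C}_i$ for $p\le i\le p+k-1$. Colored path of a triple point $tr$: let $r_0$ be its source region, $r_1$ the region separated from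 $r_0$ by the bottom sheet, $r_2$ the region separated from $r_1$ by the middle sheet, and $r_3$ the target region. Then $cp(tr,\mathcal{C}^{(p,k)})$ is the $(p+k+4)$-tuple \[ (\mathcal{C}_0(r_0),\ldots,\mathcal{C}_{p-1}(r_0),\mathcal{C}_p(r_0),\mathcal{C}_p(r_1),\mathcal{C}_p(r_2),\mathcal{C}_p(r_3),\mathcal{C}_{p+1}(r_3),\ldots,\mathcal{C}_{p+k}(r_3)). \] Homology. Let $R$ be a commutative unital ring and $C_n(X)=R\langle X^{n+2}\rangle$ the free $R$-module on $(n+2)$-tuples $(x_0,\ldots,x_{n+1})$. For $n\ge 0$ and $0\le i\le n$ define $R$-linear maps $C_n(X)\to C_{n-1}(X)$ (superscripts for ''left'' and ''right'') inductively by \[ d_0^{n,L}(x_0,\ldots,x_{n+1})=(x_1,\ldots,x_{n+1}), \] \[ d_i^{n,L}(x_0,\ldots,x_{n+1})=d_{i-1}^{n,L}(x_0,\ldots,x_{i-1},[x_{i-1}x_ix_{i+1}],x_{i+1},\ldots,x_{n+1})\quad (1\le i\le n), \] \[ d_n^{n,R}(x_0,\ldots,x_{n+1})=(x_0,\ldots,x_n), \] \[ d_{i-1}^{n,R}(x_0,\ldots,x_{n+1})=d_i^{n,R}(x_0,\ldots,x_{i-1},[x_{i-1}x_ix_{i+1}],x_{i+1},\ldots,x_{n+1})\quad (1\le i\le n). \] Put $d_i^n=d_i^{n,L}-d_i^{n,R}$ and $\partial_n^{(p,k)}=\sum_{i=p}^{n-k}(-1)^i d_i^n$ (empty sums are zero);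 this is a differential on $C_*(X)$. For $n-p-k\ge1$ let $C_n^{(p,k),D}(X,[\ ])$ be the submodule generated by tuples for which there is an index $i$ with $p\le i$, $i+2\le n+1-k$, $x_{i+1}=[x_ix_{i+1}x_{i+2}]$; for $n-p-k<1$ it is $0$. These form a subcomplex. Truncated homology $H_n^{(p,k)}(X,[\ ])$ is the homology of the quotient complex $C_n^{(p,k)}(X,[\ ])=C_n(X)/C_n^{(p,k),D}(X,[\ ])$ with the induced differential $\partial_n^{(p,k)}$. *)

(* Defs.v *)
From mathcomp Require Import all_boot all_order all_algebra.
From mathcomp Require Import finmap.
From mathcomp Require Import all_classical all_reals all_analysis.
(* Importing the notations of monalg here is a syntax error. *)
From mathcomp.multinomials Require Import(coercions,canonicals) monalg.

Set Implicit Arguments.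
Unset Strict Implicit.
Unset Printing Implicit Defensive.

Import Order.TTheory GRing.Theory Num.Theory.
Import numFieldNormedType.Exports.
Local Open Scope classical_set_scope.
Local Open Scope ring_scope.

(** * Smooth maps and diffeomorphisms between open sets *)

(* For an open subset U of a finite-dimensional space V, this is the class C^n:
   all iterated directional derivatives up to order n exist and are
   continuous. *)
Fixpoint Cn_on (R : realType) (V W : normedModType R) (n : nat)
    (U : set V) (f : V -> W) : Prop :=
  (forall x, U x -> {for x, continuous f}) /\
  (if n is n'.+1 then
     forall v, (forall x, U x -> derivable f x v) /\
               Cn_on n' U (fun x => 'D_v f x)
   else True).

Definition smooth_on (R : realType) (V W : normedModType R)
    (U : set V) (f : V -> W) : Prop :=
  forall n, Cn_on n U f.

Definition diffeo (R : realType) (V : normedModType R) (U W : set V)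
    (f g : V -> V) : Prop :=
  [/\ open U, open W, smooth_on U f /\ smooth_on W g,
      (forall x, U x -> W (f x) /\ g (f x) = x) &
      (forall y, W y -> U (g y) /\ f (g y) = y)].

(** * Oriented surface-links in R^4 *)

Section Surfaces.
Variable R : realType.
Local Notation R3 := ('rV[R]_3).
Local Notation R4 := ('rV[R]_4).
Implicit Types (F : set R4) (w : R4 -> 'M[R]_4).

(* Smooth 2-dimensional submanifold: F is locally straightened to the plane
   where the last two coordinates vanish. *)
Definition smooth_surface F : Prop :=
  forall p, F p -> exists U W f g,
    [/\ diffeo U W f g, U p &
        forall q, U q ->
          F q <-> f q 0 (inord 2) = 0 /\ f q 0 (inord 3) = 0].

Definition surface_link F : Prop := compact F /\ smooth_surface F.

Definition tangent F (p v : R4) : Prop :=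
  exists c : R^o -> R4,
    [/\ c 0 = p, \forall t \near 0, F (c t) & is_derive (0 : R^o) 1 c v].

(* The bivector a /\ b, as an antisymmetric matrix. *)
Definition wedge (a b : R4) : 'M[R]_4 := a^T *m b - b^T *m a.

(* An orientation of F is given by a continuous nowhere zero field of tangent
   bivectors: a basis (a, b) of the tangent plane at p is positive when
   wedge a b is a positive multiple of w p. *)
Definition orientation F w : Prop :=
  {within F, continuous w} /\
  (forall p, F p -> w p <> 0 /\
     exists a b, [/\ tangent F p a, tangent F p b & w p = wedge a b]).

(** * Generic projections to R^3 *)

Definition proj (p : R4) : R3 := \row_(i < 3) p 0 (widen_ord (leqnSn 3) i).

Definition height (p : R4) : R := p 0 ord_max.

(* In local coordinates phi centred at y, the part of F above a neighbourhood
   of y consists of m sheets: the i-th one is the graph of the height function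
   h i over the coordinate plane phi_i = 0.  For m = 0, 1, 2, 3, the point y is
   outside the projection, on a single embedded sheet, a transverse double
   point, a transverse triple point. *)
Definition sheets_at F (m : nat) (y : R3) : Prop :=
  exists (U W : set R3) (phi psi : R3 -> R3) (h : nat -> R3 -> R^o),
  [/\ diffeo U W phi psi, U y /\ phi y = 0,
      (forall i, (i < m)%N -> smooth_on U (h i)),
      (forall i j x, (i < m)%N -> (j < m)%N -> i <> j -> U x ->
         phi x 0 (inord i) = 0 -> phi x 0 (inord j) = 0 -> h i x <> h j x) &
      forall p, U (proj p) ->
        F p <-> exists2 i, (i < m)%N &
                  phi (proj p) 0 (inord i) = 0 /\ height p = h i (proj p)].

(* The Whitney umbrella (s, t) |-> (s, t^2, s t). *)
Definition whitney (u : 'rV[R]_2) : R3 :=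
  \row_(i < 3) [:: u 0 0; u 0 1 ^+ 2; u 0 0 * u 0 1]`_i.

(* In local coordinates phi centred at y, the part of F above a neighbourhood
   of y is embedded by (s, t) |-> (whitney (s, t), h (s, t)); the condition on
   'D_(delta_mx 0 1) h is immersivity at the origin. *)
Definition branch_at F (y : R3) : Prop :=
  exists (U W : set R3) (phi psi : R3 -> R3) (h : 'rV[R]_2 -> R^o),
  [/\ diffeo U W phi psi, U y /\ phi y = 0,
      smooth_on (whitney @^-1` W) h /\ 'D_(delta_mx 0 1) h 0 <> 0,
      (forall u u', W (whitney u) -> whitney u = whitney u' ->
         h u = h u' -> u = u') &
      forall p, U (proj p) ->
        F p <-> exists u, phi (proj p) = whitney u /\ height p = h u].

Definition generic_projection F : Prop :=
  forall y, (exists2 m, (m <= 3)%N & sheets_at F m y) \/ branch_at F y.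

(* An oriented knotted surface in general position with respect to proj; the
   broken surface diagram is the projection with the crossing information given
   by height. *)
Record diagram := Diagram {
  surf : set R4;
  orient : R4 -> 'M[R]_4;
  surfP : surface_link surf;
  orientP : orientation surf orient;
  genericP : generic_projection surf }.

End Surfaces.

(** * Regions, co-orientations, double and triple points *)

Section Diagrams.
Variables (R : realType) (D : diagram R).
Local Notation R3 := ('rV[R]_3).
Local Notation R4 := ('rV[R]_4).

Definition complement : set R3 := ~` (@proj R @` surf D).

Definition region (r : set R3) : Prop :=
  exists2 x, complement x & r = connected_component complement x.

Definition fibre (x : R3) : set R4 := surf D `&` (@proj R @^-1` [set x]).

(* For an orientation bivector wedge a b, this is the cross product of the
   projections a', b' of a, b to R^3, hence (a', b', normal p) is positive.  It
   vanishes exactly where the projection is not an immersion. *)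
Definition normal (p : R4) : R3 :=
  let w := orient D p in
  \row_(i < 3) [:: w (inord 1) (inord 2); w (inord 2) (inord 0);
                   w (inord 0) (inord 1)]`_i.

(* Points of the surface (p), ordered pairs (over, under), resp. ordered triples
   (top, middle, bottom), lying over the points of the sheets, resp. over the
   double points, resp. over the triple points of the diagram. *)
Definition sheet_points : set R4 :=
  [set p | fibre (proj p) = [set p] /\ normal p <> 0].

Definition double_points : set (R4 * R4) :=
  [set q | fibre (proj q.1) = [set q.1; q.2] /\ height q.2 < height q.1].

Definition triple_points : set (R4 * R4 * R4) :=
  [set q | fibre (proj q.1.1) = [set q.1.1; q.1.2; q.2] /\
           height q.2 < height q.1.2 < height q.1.1].

Definition dot (u v : R3) : R := (u *m v^T) 0 0.

(* The region that lies, near x, on the positive side of every sheet through x,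
   where N lists normals of these sheets.  Using nu, resp. - nu, in N selects
   the side into which the co-orientation nu points, resp. the other one. *)
Definition local_region (x : R3) (N : seq R3) : set R3 :=
  xget set0 [set r | region r /\
    forall v, all (fun nu => 0 < dot v nu) N ->
      \forall t \near 0^'+, r (x + t *: v)].

Definition triple_sign (A : pzRingType) (q : R4 * R4 * R4) : A :=
  if 0 < \det (\matrix_(i < 3)
                 [:: normal q.1.1; normal q.1.2; normal q.2]`_i)
  then 1 else -1.

End Diagrams.

(** * Knot-theoretic ternary quasigroups and colorings *)

Definition ternary_quasigroup (X : Type) (br : X -> X -> X -> X) : Prop :=
  [/\ (forall b c d, exists! a, br a b c = d),
      (forall a c d, exists! b, br a b c = d) &
      (forall a b d, exists! c, br a b c = d)].

Definition KTQ (X : Type) (br : X -> X -> X -> X) : Prop :=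
  [/\ ternary_quasigroup br,
      (forall a b c d,
         br a b (br b c d) = br a (br a b c) (br (br a b c) c d)) &
      (forall a b c d,
         br (br a b c) c d = br (br a b (br b c d)) (br b c d) d)].

Section Colorings.
Variables (R : realType) (D : diagram R) (X : Type) (br : X -> X -> X -> X).
Local Notation R3 := ('rV[R]_3).
Local Notation R4 := ('rV[R]_4).

(* A map from the set of regions to X; its values on the sets that are not
   regions are irrelevant. *)
Definition coloring : Type := set R3 -> X.
Implicit Types C : coloring.

Definition ktq_coloring C : Prop :=
  forall o u, double_points D (o, u) ->
    let reg so su :=
      local_region D (proj o) [:: so *: normal D o; su *: normal D u] in
    let r0 := reg (-1) (-1) in
    let r1 := reg (-1) 1 in
    let r2 := reg 1 1 in
    let r3 := reg 1 (-1) in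
    C r3 = br (C r0) (C r1) (C r2).

(* The co-orientation arrow at some point of a sheet goes from r to r'. *)
Definition arrow (r r' : set R3) : Prop :=
  exists2 p, sheet_points D p &
    r = local_region D (proj p) [:: - normal D p] /\
    r' = local_region D (proj p) [:: normal D p].

Definition left_coloring C CL : Prop :=
  forall r r', arrow r r' -> CL r' = br (CL r) (C r) (C r').

Definition right_coloring C CR : Prop :=
  forall r r', arrow r r' -> CR r = br (C r) (C r') (CR r').

(* Only C 0, ..., C (p + k) are relevant. *)
Definition layered_coloring (p k : nat) (C : nat -> coloring) : Prop :=
  [/\ ktq_coloring (C p),
      (forall i, (1 <= i <= p)%N -> left_coloring (C i) (C i.-1)) &
      (forall i, (p <= i < p + k)%N -> right_coloring (C i) (C i.+1))].

Definition colored_path (p k : nat) (C : nat -> coloring)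
    (q : R4 * R4 * R4) : (p + k).+4.-tuple X :=
  let reg st sm sb :=
    local_region D (proj q.1.1)
      [:: st *: normal D q.1.1; sm *: normal D q.1.2; sb *: normal D q.2] in
  let r0 := reg (-1) (-1) (-1) in
  let r1 := reg (-1) (-1) 1 in
  let r2 := reg (-1) 1 1 in
  let r3 := reg 1 1 1 in
  [tuple if (j <= p)%N then C j r0
         else if j == p.+1 :> nat then C p r1
         else if j == p.+2 :> nat then C p r2
         else C (j - 3)%N r3 | j < (p + k).+4].

End Colorings.

(** * The truncated chain complexes *)

Local Notation "{ 'malg' G [ K ] }" := (@monalg.malg K G) : type_scope.
Local Notation "<< z *g k >>" := (monalg.mkmalgU k z) : ring_scope.
Local Notation "g @_ k" := (monalg.mcoeff k g)
  (at level 3, k at level 2) : ring_scope.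
Local Notation msupp := monalg.msupp.

(* The free A-module on m-tuples; C_n(X) is chain A X n.+2, also for n = -1. *)
Notation chain A X m := {malg A[m.-tuple X]} (only parsing).

Section Homology.
Variables (A : comPzRingType) (X : choiceType) (br : X -> X -> X -> X).

(* Replaces x_i by [x_(i-1) x_i x_(i+1)], for 1 <= i <= n. *)
Definition upd n (i : nat) (x : n.+2.-tuple X) : n.+2.-tuple X :=
  [tuple if j == i :> nat
         then br (tnth x (inord i.-1)) (tnth x (inord i)) (tnth x (inord i.+1))
         else tnth x j | j < n.+2].

Fixpoint dL n (i : nat) (x : n.+2.-tuple X) : n.+1.-tuple X :=
  if i is i'.+1 then dL i' (upd i x) else [tuple of behead x].

(* dR_from_top m is d_(n-m)^(n,R): the recursion goes up to the index n. *)
Fixpoint dR_from_top n (m : nat) (x : n.+2.-tuple X) : n.+1.-tuple X :=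
  if m is m'.+1 then dR_from_top m' (upd (n - m') x)
  else [tuple tnth x (widen_ord (leqnSn n.+1) j) | j < n.+1].

Definition dR n (i : nat) (x : n.+2.-tuple X) : n.+1.-tuple X :=
  dR_from_top (n - i) x.

Definition lin (m m' : nat) (f : m.-tuple X -> m'.-tuple X)
    (c : chain A X m) : chain A X m' :=
  \sum_(x <- msupp c) << c@_x *g f x >>.

Definition boundary (p k n : nat) (c : chain A X n.+2) : chain A X n.+1 :=
  \sum_(p <= i < n.+1 - k) (lin (@dL n i) c - lin (@dR n i) c) *~ (-1) ^+ i.

Definition degenerate (p k n : nat) (x : n.+2.-tuple X) : Prop :=
  exists i, [/\ (p <= i)%N, (i + 2 + k <= n + 1)%N &
    tnth x (inord i.+1) =
      br (tnth x (inord i)) (tnth x (inord i.+1)) (tnth x (inord i.+2))].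

(* The submodule C_n^{(p,k),D}(X): A-linear combinations of degenerate tuples,
   or 0 when n - p - k < 1.  A chain is zero in the truncated complex exactly
   when it belongs to this submodule. *)
Definition degenerate_chain (p k n : nat) (c : chain A X n.+2) : Prop :=
  if (p + k < n)%N then
    exists2 s : seq (A * n.+2.-tuple X),
      (forall y, y \in s -> degenerate p k y.2) &
      c = \sum_(y <- s) << y.1 *g y.2 >>
  else c = 0.

End Homology.

Definition layered_chain (R : realType) (D : diagram R) (A : comPzRingType)
    (X : choiceType) (p k : nat) (C : nat -> coloring R X) :
    chain A X (p + k).+4 :=
  \sum_(q \in triple_points D)
     << triple_sign D A q *g colored_path D p k C q >>.

(* Main.v *)
(** Fix a nondegenerate tuple y.  To a double point, an ordered pair of points
   of the surface F, attach the path of colors that runs from its source region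
   through the region beyond the under-sheet to its target region.  On the curve
   M of double points in F x F this label is locally constant except where a
   third sheet crosses, which happens at three points of M for each triple point.
   By the relations of the three colorings, the labels on the two sides of these
   three points are the left and the right faces p, p + 1 and p + 2 of the colored
   path of the triple point, and the faces match the signs once M is oriented by
   the co-orientations of the two sheets.  The curve M is closed except at the
   branch points, and near them the two lateral regions of a double point
   coincide, which makes its label degenerate.  Hence the function on M that
   tests whether the label is y vanishes near the ends of M, so that its oriented
   jumps add up to 0; up to sign, this sum is the coefficient of y in the boundary
   of the chain. *)

Require Import Defs.
From mathcomp Require Import all_boot all_order all_algebra.
From HB Require Import structures.
From mathcomp Require Import finmap.
From mathcomp Require Import all_classical all_reals all_analysis.
From mathcomp Require Import ring lra zify.
From mathcomp.multinomials Require Import(coercions,canonicals) monalg.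
(* all_analysis has its own [proj]. *)
Import Defs.

Set Implicit Arguments.
Unset Strict Implicit.
Unset Printing Implicit Defensive.

Import Order.TTheory GRing.Theory Num.Theory.
Import numFieldNormedType.Exports.
Local Open Scope classical_set_scope.
Local Open Scope ring_scope.

(** * Jumps of a function along an oriented curve *)

(** No classification of 1-manifolds enters: the total jump vanishes for any function on [M] that
    has one-sided values and vanishes near the missing ends, by cutting it along finitely many arcs.
    [M] is oriented without tangent vectors: [side q q'] pairs the displacement from [q] to [q']
    with the cross product of the two normals at [q]. The obstacle is that [M] need not be closed in
    F x F. Off the diagonal it is, since equal projections and equal heights mean equal points; so
    it can only accumulate at (P, P) with P over a branch point. There the normal in R^3 vanishes
    and does not tell how the co-orientations of the two sheets of the umbrella fit together. This
    information comes from R^4: the surface is immersed there, so its orientation bivector is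
    nonzero and continuous at the branch point, which fixes the relative sign of the normals at the
    two preimages t and -t of a double point. With this sign, both lateral regions are the region
    outside of the umbrella, which reaches around the end of the double line. *)

Lemma finite_isolated (T : ptopologicalType) (K S : set T) :
  compact K -> S `<=` K ->
  (forall z, K z -> \forall m \near z, S m -> m = z) -> finite_set S.
Proof.
rewrite compact_cover => cK SK iso.
have [||D' _ cov] := cK T K (fun z => interior (fun m => S m -> m = z)).
- by move=> z _; exact: open_interior.
- by move=> z Kz; exists z => //; apply: iso.
apply: sub_finite_set (finite_fset D').
move=> m Sm; have [z zD /= /interior_subset /(_ Sm) ->//] := cov m (SK m Sm).
Qed.

(** At the supremum of the points where [P] holds, the local hypothesis carries [P] from a point
    just below it to a point just above it, unless the supremum is [be]. *)
Lemma segment_ind (R : realType) (al be : R) (P : R -> Prop) :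
  al <= be ->
  (forall t, al <= t <= be -> exists2 e : R, 0 < e &
     forall s s', al <= s <= be -> al <= s' <= be ->
       `|s - t| < e -> `|s' - t| < e -> P s -> P s') ->
  P al -> P be.
Proof.
move=> ab loc Pa; pose E := [set s | al <= s <= be /\ P s].
have Ea : E al by split => //; rewrite lexx.
have hE : has_sup E.
  split; first by exists al.
  by exists be => s [/andP[]].
have t1 : al <= sup E by apply: ub_le_sup => //; case: hE.
have t2 : sup E <= be by apply: ge_sup; [exists al | move=> s [/andP[]]].
have [e e0 He] := loc (sup E) ltac:(by rewrite t1 t2).
have [s Es sE] := sup_adherent e0 hE.
have sle : s <= sup E by apply: ub_le_sup => //; case: hE.
have [[sab Ps] ds] : E s /\ `|s - sup E| < e.
  by split => //; rewrite ler0_norm ?subr_le0// opprB ltrBlDr addrC -ltrBlDr.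
pose s' := Num.min be (sup E + e / 2).
have e2 : 0 < e / 2 by rewrite divr_gt0.
have s'1 : sup E <= s' by rewrite le_min t2 lerDl ltW.
have s'2 : s' <= sup E + e / 2 by rewrite ge_min lexx orbT.
have ds' : `|s' - sup E| < e.
  rewrite ger0_norm ?subr_ge0// ltrBlDl (le_lt_trans s'2)// ltrD2l ltr_pdivrMr//.
  by rewrite ltr_pMr// ltr1n.
have s'ab : al <= s' <= be by rewrite (le_trans t1)//= ge_min lexx.
have Ps' : P s' by exact: He ds ds' Ps.
have : s' <= sup E by apply: ub_le_sup => //; case: hE.
rewrite /s' ge_min => /orP[bE|]; last by rewrite gerDl leNgt e2.
have -> // : be = s'; rewrite /s'; apply/esym/min_idPl.
by rewrite (le_trans bE)// lerDl ltW.
Qed.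

Lemma near_gt (R : realType) (s : R) (P : R -> Prop) :
  (\forall s' \near s, P s') -> exists s', s < s' /\ P s'.
Proof.
move=> Ps; have [] := filter_ex (filterI (nbhs_right_gt s) (cvg_within _ Ps)).
by move=> s' [? ?]; exists s'.
Qed.

Lemma near_lt (R : realType) (s : R) (P : R -> Prop) :
  (\forall s' \near s, P s') -> exists s', s' < s /\ P s'.
Proof.
move=> Ps; have [] := filter_ex (filterI (nbhs_left_lt s) (cvg_within _ Ps)).
by move=> s' [? ?]; exists s'.
Qed.

Lemma near_norm (R : realType) (t : R) (P : R -> Prop) :
  (\forall s \near t, P s) ->
  exists2 e : R, 0 < e & forall s, `|s - t| < e -> P s.
Proof.
by move=> /nbhs_ballP[e /= e0 H]; exists e => // s st; apply: H; rewrite /ball/= distrC.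
Qed.

(** * Jumps on a segment of the real line *)

Section OneDim.
Variables (R : realType) (A : zmodType) (al be : R) (g a b : R -> A).
Hypothesis ab : al <= be.
Hypothesis glim : forall t, al <= t <= be ->
  (\forall s \near t, t < s -> g s = a t) /\
  (\forall s \near t, s < t -> g s = b t).

(** Immediately to the right of [t] the function is constantly [a t], so both of its one-sided
    values at the points there are [a t]; likewise on the left. In particular jumps are isolated. *)
Lemma onesided_near t : al <= t <= be -> exists2 e : R, 0 < e &
  forall s, al <= s <= be -> `|s - t| < e ->
    (t < s -> a s = a t /\ b s = a t) /\ (s < t -> a s = b t /\ b s = b t).
Proof.
move=> tab; have [/nbhs_ballP[e1 /= e10 H1] /nbhs_ballP[e2 /= e20 H2]] := glim tab.
exists (Num.min e1 e2); first by rewrite lt_min e10.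
move=> s sab; rewrite lt_min => /andP[d1 d2].
have [ga gb] := glim sab.
have key (x : A) : (\forall s' \near s, g s' = x) -> a s = x /\ b s = x.
  move=> gx; split.
    by have [s' [ss' [/(_ ss') <-]]] := near_gt (filterI ga gx).
  by have [s' [ss' [/(_ ss') <-]]] := near_lt (filterI gb gx).
split=> ts; apply: key.
  near=> s'; apply: H1; last by near: s'; exact: lt_nbhsr.
  by near: s'; apply: open_nbhs_nbhs; split; [exact: ball_open|rewrite /ball/= distrC].
near=> s'; apply: H2; last by near: s'; exact: lt_nbhsl.
by near: s'; apply: open_nbhs_nbhs; split; [exact: ball_open|rewrite /ball/= distrC].
Unshelve. all: by end_near. Qed.

Lemma finite_jumps1 : finite_set [set t | al <= t <= be /\ a t - b t != 0].
Proof.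
apply: (@finite_isolated _ `[al, be]%classic).
- exact: segment_compact.
- by move=> t [tab _]; rewrite /= in_itv.
move=> z; rewrite /= in_itv /= => zab; have [e e0 He] := onesided_near zab.
apply/nbhs_ballP; exists e => //= s; rewrite /ball/= distrC => sz [sab].
have [H1 H2] := He s sab sz.
by case: (ltgtP s z) => // [/H2|/H1] [-> ->]; rewrite subrr eqxx.
Qed.

(** Between two nearby points around [t] the only jump is the one at [t], and it is also the change
    of [a]; hence the sum up to [s] minus [a s] is locally constant. As [a] is the right-hand value,
    the interval is open at [al] and closed at [be]. *)
Lemma sum_jumps1 : \sum_(t \in `]al, be]) (a t - b t) = a be - a al.
Proof.
have fin (s : R) : s <= be ->
    finite_set (`]al, s] `&` [set t | a t - b t != 0]).
  move=> sb; apply: sub_finite_set finite_jumps1 => t [/=]; rewrite in_itv /=.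
  by move=> /andP[/ltW -> ts] ?; rewrite (le_trans ts).
pose S s := \sum_(t \in `]al, s]) (a t - b t).
suff : S be - a be = - a al by rewrite /S => /eqP; rewrite subr_eq addrC => /eqP.
have S_split s s' : al <= s -> s <= s' -> s' <= be ->
    S s' = S s + \sum_(t \in `]s, s']) (a t - b t).
  move=> als ss' s'b; rewrite /S fsbig_supp [in RHS]fsbig_supp.
  rewrite [X in _ + X]fsbig_supp.
  rewrite (_ : `]al, s'] `&` _ = (`]al, s] `&` (fun t => a t - b t) @^-1` [set~ 0])
     `|` (`]s, s'] `&` (fun t => a t - b t) @^-1` [set~ 0])).
    rewrite fsbigU0//.
    - by apply: sub_finite_set (fin s _) => [t [? /= /eqP]//|]; exact: le_trans s'b.
    - apply: sub_finite_set (fin s' _) => // t [/=]; rewrite !in_itv /= => /andP[st ->].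
      by move/eqP; split => //; rewrite (le_lt_trans als st).
    - by move=> t [[/=]]; rewrite !in_itv /= => /andP[_ ts] _ [/andP[/lt_geF]]; rewrite ts.
  rewrite -setIUl; congr (_ `&` _); apply/seteqP; split => t /=; rewrite !in_itv /=.
    by move=> /andP[-> ->] /=; rewrite andbT; case: (leP t s) => _; [left|right].
  case=> /andP[h1 h2]; first by rewrite h1 (le_trans h2).
  by rewrite h2 (le_lt_trans als).
apply: (segment_ind (P := fun s => S s - a s = - a al) ab) => [t tab|]; last first.
  by rewrite /S set_itv_ge ?bnd_simp ?ltxx// fsbig_set0 sub0r.
have [e e0 He] := onesided_near tab; exists e => // s s' sab s'ab dst ds't.
have key u v : al <= u <= be -> al <= v <= be -> u <= v ->
   `|u - t| < e -> `|v - t| < e -> S v - a v = S u - a u.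
  move=> uab vab uv du dv.
  have [/andP[u1 u2] /andP[v1 v2]] := (uab, vab).
  rewrite (S_split u v)// -addrA; congr (_ + _).
  have [U1 U2] := He u uab du; have [V1 V2] := He v vab dv.
  have zero w : u < w <= v -> w != t -> a w - b w = 0.
    move=> /andP[uw wv] wt.
    have wab : al <= w <= be by rewrite (le_trans u1 (ltW uw)) (le_trans wv).
    have dw : `|w - t| < e.
      move: du dv; rewrite !ltr_norml => /andP[du _] /andP[_ dv].
      by rewrite (lt_le_trans du) ?lerD2r 1?ltW//= (le_lt_trans _ dv)// lerD2r.
    have [W1 W2] := He w wab dw.
    by case: (ltgtP w t) wt => // [/W2|/W1] [-> ->]; rewrite subrr.
  case: (boolP (u < t <= v)) => [/andP[ut tv]|nt].
    rewrite (_ : \sum_(_ \in _) _ = a t - b t); last first.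
      rewrite -(@fsbig_set1 _ 0 +%R _ t (fun t => a t - b t)).
      apply/esym/fsbig_widen => [w /= ->|w [/=]]; rewrite in_itv /= ?ut//.
      by move=> uwv /eqP; exact: zero.
    have [-> _] := U2 ut; have -> : a v = a t.
      by move: tv; rewrite le_eqVlt => /orP[/eqP ->//|/V1[]].
    by rewrite addrAC subrr sub0r.
  rewrite fsbig1 => [|w /=]; last first.
    rewrite in_itv /= => uwv; apply: zero => //.
    by apply: contraNneq nt => <-.
  rewrite add0r; congr (- _).
  move: nt; rewrite negb_and -leNgt -ltNge => /orP[tu|vt].
    have -> : a v = a t.
      by move: (le_trans tu uv); rewrite le_eqVlt => /orP[/eqP ->//|/V1[]].
    by move: tu; rewrite le_eqVlt => /orP[/eqP ->//|/U1[]].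
  by have [-> _] := V2 vt; have [-> _] := U2 (le_lt_trans uv vt).
by case/orP: (le_total s s') => ss' <-; [exact: key|apply/esym/key].
Qed.

End OneDim.

(** * Jumps along a curve that is covered by arcs *)

Section Jumps.
Variables (R : realType) (T : ptopologicalType) (M : set T).
Variable side : T -> T -> R.
Hypotheses (hT : hausdorff_space T) (side0 : forall m, side m m = 0).

(* c is a local parametrization of M with inverse k; it runs into the positive
   side of each of its points. *)
Definition arc (c : R -> T) (k : T -> R) (d : R) : Prop :=
  0 < d /\ forall t, `|t| < d ->
    [/\ M (c t), k (c t) = t, {for t, continuous c},
        (forall e : R, 0 < e ->
           \forall m \near c t, M m -> `|k m - t| < e /\ c (k m) = m) &
        \forall s \near t, (t < s -> 0 < side (c t) (c s)) /\
                           (s < t -> side (c t) (c s) < 0)].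

Hypothesis arcM : forall m, M m -> exists c k d, arc c k d /\ c 0 = m.

(** Along [M], [f] is locally constant on either side of each point; its value at the point itself
    does not enter. *)
Definition onesided (A : Type) (f a b : T -> A) : Prop := forall m, M m ->
  (\forall m' \near m, M m' -> 0 < side m m' -> f m' = a m) /\
  (\forall m' \near m, M m' -> side m m' < 0 -> f m' = b m).

(** The arc through [m] runs into both sides, so neither one-sided condition is vacuous and the
    one-sided values are determined by [f]. *)
Lemma near_side m (P : T -> Prop) : M m -> (\forall m' \near m, P m') ->
  (exists m', [/\ M m', 0 < side m m' & P m']) /\
  (exists m', [/\ M m', side m m' < 0 & P m']).
Proof.
move=> Mm Pm; have [c [k [d [[d0 H] cm]]]] := arcM Mm.
have z0 : `|0 : R| < d by rewrite normr0.
have [_ _ cc _ sd] := H 0 z0; rewrite cm in sd.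
have near0 : \forall s \near (0 : R), [/\ P (c s), M (c s) &
    (0 < s -> 0 < side m (c s)) /\ (s < 0 -> side m (c s) < 0)].
  near=> s; split; last by near: s; exact: sd.
    by near: s; apply: cc; rewrite cm.
  have /H[]// : `|s| < d; near: s.
  by apply/nbhs_ballP; exists d => //= s; rewrite /ball/= sub0r normrN.
have [s [s0 [Ps Ms [/(_ s0) ? _]]]] := near_gt near0.
have [s' [s'0 [Ps' Ms' [_ /(_ s'0) ?]]]] := near_lt near0.
by split; [exists (c s)|exists (c s')].
Unshelve. all: by end_near. Qed.

Lemma onesided_const (A : Type) (f a b : T -> A) m x : M m -> onesided f a b ->
  (\forall m' \near m, M m' -> f m' = x) -> a m = x /\ b m = x.
Proof.
move=> Mm lim fx; have [la lb] := lim m Mm.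
have [[m' [Mm' sm' [h1 h2]]] _] := near_side Mm (filterI la fx).
have [_ [m2 [Mm2 sm2 [h3 h4]]]] := near_side Mm (filterI lb fx).
by rewrite -h1// -h3// h2// h4.
Qed.

Section Arc.
Variables (c : R -> T) (k : T -> R) (d : R).
Hypothesis ckd : arc c k d.

(** Half of the parameter range: the body is compact, and the arc continues beyond both of its
    ends. *)
Definition arc_body := [set c t | t in `[- (d / 2), d / 2]].

Lemma arc_half : 0 < d / 2 /\ d / 2 < d.
Proof.
have [d0 _] := ckd; split; first by rewrite divr_gt0.
by rewrite ltr_pdivrMr// ltr_pMr// ltr1n.
Qed.

Lemma arc_bodyE m : arc_body m -> [/\ `|k m| <= d / 2, c (k m) = m & M m].
Proof.
move=> [t /=]; rewrite in_itv /= -ler_norml => td <-.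
have [d1 d2] := arc_half; have [_ H] := ckd.
by have [M_ ck _ _ _] := H t (le_lt_trans td d2); rewrite ck.
Qed.

Lemma arc_body_norm t : `|t| <= d / 2 -> arc_body (c t).
Proof. by move=> td; exists t => //=; rewrite in_itv /= -ler_norml. Qed.

Lemma arc_body_closed : closed arc_body.
Proof.
apply: compact_closed => //; apply: continuous_compact; last exact: segment_compact.
apply: continuous_in_subspaceT => t; rewrite inE /= in_itv /= -ler_norml => td.
have [d1 d2] := arc_half; have [_ H] := ckd.
by have [] := H t (le_lt_trans td d2).
Qed.

Lemma arc_near t e : `|t| < d -> 0 < e -> \forall m \near c t, M m ->
  exists s, [/\ m = c s, k m = s, `|s - t| < e, (0 < side (c t) m -> t < s) &
                (side (c t) m < 0 -> s < t)].
Proof.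
move=> td ep; have [_ H] := ckd.
have [Mt kt ct nt /nbhs_ballP[e1 /= e10 st]] := H t td.
have e'0 : 0 < Num.min e e1 by rewrite lt_min e10 ep.
apply: filterS (nt _ e'0) => m Hm /Hm []; rewrite lt_min => /andP[he hd] cm.
have [h1 h2] := st (k m) ltac:(by rewrite /ball/= distrC).
exists (k m); split => //.
- rewrite -{1}cm; case: (ltgtP t (k m)) => [//|/h2 /lt_geF|<-].
    by move=> E /ltW; rewrite E.
  by rewrite side0 ltxx.
- rewrite -{1}cm; case: (ltgtP t (k m)) => [/h1 /lt_geF|//|<-].
    by move=> E /ltW; rewrite E.
  by rewrite side0 ltxx.
Qed.

(** The indicator of the body jumps only at the two end parameters, where the arc leaves the body on
    one side; off the body it vanishes nearby, since the body is closed. *)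
Lemma arc_body_onesided : exists a b : T -> bool,
  onesided (fun m => m \in arc_body) a b.
Proof.
suff H m : exists u : bool * bool, M m ->
  (\forall m' \near m, M m' -> 0 < side m m' -> (m' \in arc_body) = u.1) /\
  (\forall m' \near m, M m' -> side m m' < 0 -> (m' \in arc_body) = u.2).
  by have [u Hu] := choice H; exists (fun m => (u m).1), (fun m => (u m).2) => m /Hu.
have [d1 d2] := arc_half; have [_ Hc] := ckd.
case: (pselect (arc_body m)) => [Bm|nB]; last first.
  have op := open_nbhs_nbhs (conj (closed_openC arc_body_closed) nB).
  exists (false, false) => _ /=.
  by split; apply: filterS op => m' /= nm' _ _; apply/negbTE; rewrite notin_setE.
have [km ckm Mm] := arc_bodyE Bm; set t := k m in km ckm.
have td : `|t| < d by exact: le_lt_trans d2.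
have nin s : `|s| < d -> d / 2 < `|s| -> (c s \in arc_body) = false.
  move=> sd1 sd2; apply/negP; rewrite inE => /arc_bodyE[+ _ _].
  by have [_ -> _ _ _] := Hc s sd1; rewrite leNgt sd2.
have dt (s : R) : `|s - t| < d - `|t| -> `|s| < d.
  move=> st; rewrite -(subrK t s) (le_lt_trans (ler_normD _ _))//.
  by rewrite -ltrBrDr.
have dt0 : 0 < d - `|t| by rewrite subr_gt0.
have [u1 H1] : exists u, \forall m' \near m, M m' -> 0 < side m m' ->
    (m' \in arc_body) = u.
  case: (eqVneq t (d / 2)) => [te|tn].
    exists false; have := arc_near td dt0; rewrite ckm.
    apply: filterS => m' H /H [s [-> _ /dt sd ts _]] /ts {}ts.
    by rewrite nin// -te (lt_le_trans ts)// ler_norm.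
  have tlt : t < d / 2.
    by rewrite lt_neqAle tn; move: km; rewrite ler_norml => /andP[].
  have e0 : 0 < d / 2 - t by rewrite subr_gt0.
  exists true; have := arc_near td e0; rewrite ckm.
  apply: filterS => m' H /H [s [-> _ sd ts _]] /ts {}ts.
  apply/mem_set/arc_body_norm; rewrite ler_norml; apply/andP; split.
    by move: km; rewrite ler_norml => /andP[km _]; rewrite (le_trans km)// ltW.
  by move: sd; rewrite gtr0_norm ?subr_gt0// ltrD2r => /ltW.
have [u2 H2] : exists u, \forall m' \near m, M m' -> side m m' < 0 ->
    (m' \in arc_body) = u.
  case: (eqVneq t (- (d / 2))) => [te|tn].
    exists false; have := arc_near td dt0; rewrite ckm.
    apply: filterS => m' H /H [s [-> _ /dt sd _ ts]] /ts {}ts.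
    have de : d / 2 = - t by rewrite te opprK.
    rewrite nin// de -normrN.
    by rewrite (lt_le_trans _ (ler_norm _))// ltrN2.
  have tlt : - (d / 2) < t.
    by rewrite lt_neqAle eq_sym tn; move: km; rewrite ler_norml => /andP[].
  have e0 : 0 < t + d / 2 by rewrite -[d / 2]opprK subr_gt0.
  exists true; have := arc_near td e0; rewrite ckm.
  apply: filterS => m' H /H [s [-> _ sd _ ts]] /ts {}ts.
  apply/mem_set/arc_body_norm; rewrite ler_norml; apply/andP; split.
    move: sd; rewrite distrC gtr0_norm ?subr_gt0// ltrD2l => /ltW.
    by rewrite lerNl.
  by move: km; rewrite ler_norml => /andP[_ km]; rewrite (le_trans _ km)// ltW.
by exists (u1, u2).
Qed.

(* Along the arc the jumps telescope, and f vanishes at both of its ends. *)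
Lemma arc_jump_sum (A : zmodType) (f a b : T -> A) : onesided f a b ->
  (forall m, M m -> ~ arc_body m -> f m = 0) ->
  \sum_(m \in M) (a m - b m) = 0.
Proof.
move=> lim f0; have [d1 d2] := arc_half; have [d0 Hc] := ckd.
have out m : M m -> ~ arc_body m -> a m = 0 /\ b m = 0.
  move=> Mm nB; apply: (onesided_const Mm lim).
  have := open_nbhs_nbhs (conj (closed_openC arc_body_closed) nB).
  by apply: filterS => m' /= nm' Mm'; exact: f0.
have out_arc (s : R) : d / 2 < `|s| -> `|s| < d -> a (c s) = 0 /\ b (c s) = 0.
  move=> s1 s2; have [Ms ks _ _ _] := Hc s s2; apply: out => //.
  by move=> /arc_bodyE[+ _ _]; rewrite ks leNgt s1.
(* Any parameter strictly between [d / 2] and [d] does: the arc is defined up to it, and beyond the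
   body the one-sided values are 0. *)
pose be := (d / 2 + d) / 2.
have be1 : d / 2 < be by rewrite /be; lra.
have be2 : be < d by rewrite /be; lra.
have be0 : 0 < be by exact: lt_trans be1.
have ald t : - be <= t <= be -> `|t| < d.
  by rewrite -ler_norml => /le_lt_trans; exact.
have /sum_jumps1 H : - be <= be by rewrite ge0_cp// ltW.
have {}H := H A (f \o c) (a \o c) (b \o c) _.
have abe : a (c be) = 0 by case: (out_arc be); rewrite ?gtr0_norm.
have aal : a (c (- be)) = 0 by case: (out_arc (- be)); rewrite ?normrN ?gtr0_norm.
rewrite /= abe aal subrr in H; rewrite -[RHS]H.
  rewrite -(@fsbig_image _ 0 +%R _ _ `]- be, be]%classic c (fun m => a m - b m)).
    apply/esym/fsbig_widen => [m [t /=]|m [/= Mm nt]].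
      rewrite in_itv /= => /andP[/ltW t1 t2] <-.
      by have [] := Hc t (ald t _); rewrite // t1.
    case: (pselect (arc_body m)) => [Bm|nB].
      exfalso; apply: nt; have [km cm _] := arc_bodyE Bm.
      exists (k m) => //=; rewrite in_itv /=.
      move: km; rewrite ler_norml => /andP[k1 k2].
      by rewrite (lt_le_trans _ k1) ?ltrN2//= (le_trans k2)// ltW.
    by have [-> ->] := out m Mm nB; rewrite subrr.
  move=> t t'; rewrite !inE /= !in_itv /= => /andP[/ltW t1 t2] /andP[/ltW t3 t4] ctt.
  have [_ <- _ _ _] := Hc t (ald t ltac:(by rewrite t1)).
  by have [_ <- _ _ _] := Hc t' (ald t' ltac:(by rewrite t3)); rewrite ctt.
move=> t /ald td; have [Mt _ ct _ st] := Hc t td.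
have [la lb] := lim _ Mt.
have Mn : \forall s \near t, M (c s).
  apply/nbhs_ballP; exists (d - `|t|); first by rewrite /= subr_gt0.
  move=> s; rewrite /ball/= distrC => sd.
  have /Hc[] // : `|s| < d.
  rewrite -(subrK t s) (le_lt_trans (ler_normD _ _))//.
  by rewrite -ltrBrDr.
split.
  have fa : \forall s \near t, M (c s) -> 0 < side (c t) (c s) -> f (c s) = a (c t).
    exact: ct la.
  by apply: filterS3 fa Mn st => s /= H1 Ms [H2 _] /H2; exact: H1.
have fb : \forall s \near t, M (c s) -> side (c t) (c s) < 0 -> f (c s) = b (c t).
  exact: ct lb.
by apply: filterS3 fb Mn st => s /= H1 Ms [_ H2] /H2; exact: H1.
Qed.

End Arc.

Variables (A : zmodType) (K : set T).
Hypotheses (cK : compact K) (MK : M `<=` K).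

(** Near a point of [M] the arc shows that both sides are free of further jumps; near a point of [K]
    outside [M] the vanishing of [f] makes up for [M] not being closed. *)
Lemma finite_jumps (f a b : T -> A) : onesided f a b ->
  (forall z, K z -> ~ M z -> \forall m \near z, M m -> f m = 0) ->
  finite_set [set m | M m /\ a m - b m != 0].
Proof.
move=> lim f0; apply: (finite_isolated cK) => [m [/MK]//|z Kz].
case: (pselect (M z)) => [Mz|nM]; last first.
  have nf := f0 z Kz nM; apply: filterS (nbhs_interior nf) => m im [Mm].
  have [-> ->] := onesided_const Mm lim im; first by rewrite subrr eqxx.
have [c [k [d [ckd cz]]]] := arcM Mz.
have [la lb] := lim z Mz; have [d0 H] := ckd.
have z0 : `|0 : R| < d by rewrite normr0.
have [_ _ c0 _ s0] := H 0 z0; rewrite cz in s0.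
have [e e0 He] : exists2 e : R, 0 < e & forall s : R, `|s| < e -> `|s| < d /\
    (0 < s -> f (c s) = a z) /\ (s < 0 -> f (c s) = b z).
  rewrite -{1}cz in la; rewrite -{1}cz in lb.
  have fa : \forall s \near (0 : R), M (c s) -> 0 < side z (c s) -> f (c s) = a z.
    exact: c0 la.
  have fb : \forall s \near (0 : R), M (c s) -> side z (c s) < 0 -> f (c s) = b z.
    exact: c0 lb.
  have [e e0 He] := near_norm (filterI (filterI fa fb) s0).
  exists (Num.min e d); first by rewrite lt_min e0.
  move=> s; rewrite lt_min => /andP[se sd]; split => //.
  have [[/= h1 h2] [h3 h4]] := He s ltac:(by rewrite subr0).
  have [Ms _ _ _ _] := H s sd.
  by split => [/[dup]/h3|/[dup]/h4] ? ?; [apply: h1|apply: h2].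
have := arc_near ckd z0 e0; rewrite cz.
apply: filterS => m nm [Mm]; have [s [ms _ + _ _]] := nm Mm.
rewrite subr0 => se; have [sd [fp fn]] := He s se.
have ct : {for s, continuous c} by have [] := H s sd.
have [_ _ _ ns _] := H s sd.
case: (ltgtP s 0) => [sn|sp|s0']; last by rewrite ms s0' cz.
  have e1 : 0 < Num.min (- s) (e - `|s|) by rewrite lt_min oppr_gt0 sn subr_gt0.
  have := arc_near ckd sd e1; rewrite -ms => nm1.
  suff [-> ->] : a m = b z /\ b m = b z by rewrite subrr eqxx.
  apply: (onesided_const Mm lim); apply: filterS nm1 => m' H' Mm'.
  have [s' [-> _ + _ _]] := H' Mm'; rewrite lt_min => /andP[h1 h2].
  have [_ [_ ->//]] : _ := He s' ltac:(rewrite -(subrK s s') (le_lt_trans (ler_normD _ _))// -ltrBrDr//).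
  by move: h1; rewrite ltr_norml => /andP[_]; rewrite ltrBlDr addNr.
have e1 : 0 < Num.min s (e - `|s|) by rewrite lt_min sp subr_gt0.
have := arc_near ckd sd e1; rewrite -ms => nm1.
suff [-> ->] : a m = a z /\ b m = a z by rewrite subrr eqxx.
apply: (onesided_const Mm lim); apply: filterS nm1 => m' H' Mm'.
have [s' [-> _ + _ _]] := H' Mm'; rewrite lt_min => /andP[h1 h2].
have [_ [-> //]] : _ := He s' ltac:(rewrite -(subrK s s') (le_lt_trans (ler_normD _ _))// -ltrBrDr//).
by move: h1; rewrite ltr_norml => /andP[+ _]; rewrite ltrBrDr addNr.
Qed.

(** Induction on the arcs: [f] splits into its restrictions to the first body and to the complement.
    Each may acquire jumps at the ends of this body, but they cancel in the sum; the first part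
    telescopes along the arc, the second is supported on the remaining bodies. *)
Lemma jump_sum_cover (l : seq (set T)) (f a b : T -> A) :
  (forall B, B \in l -> exists c k d, arc c k d /\ B = arc_body c d) ->
  onesided f a b ->
  (forall z, K z -> ~ M z -> \forall m \near z, M m -> f m = 0) ->
  (forall m, M m -> f m != 0 -> exists2 B, B \in l & B m) ->
  \sum_(m \in M) (a m - b m) = 0.
Proof.
elim: l f a b => [|B l IH] f a b Hl lim f0 fl.
  rewrite fsbig1// => m Mm.
  have [|-> ->] := onesided_const (x := 0) Mm lim; last by rewrite subrr.
  by apply: nearW => m' Mm'; apply/eqP/negPn/negP => /(fl _ Mm')[].
have [c [k [d [ckd EB]]]] := Hl B (mem_head _ _).
have [u [v uv]] := arc_body_onesided ckd; rewrite -EB in uv.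
(* One-sided values are cut by the one-sided values [u], [v] of the indicator, not by the indicator
   itself. *)
pose cut (p : bool) (g : T -> A) (w : T -> bool) m := if w m == p then g m else 0.
have cut_lim p : onesided (cut p f (fun m => m \in B)) (cut p a u) (cut p b v).
  move=> m Mm; have [la lb] := lim m Mm; have [lu lv] := uv m Mm; rewrite /cut; split.
    by move: la lu; apply: filterS2 => m' h1 h2 Mm' s; rewrite h1// h2.
  by move: lb lv; apply: filterS2 => m' h1 h2 Mm' s; rewrite h1// h2.
have cut_f0 p z : K z -> ~ M z ->
    \forall m \near z, M m -> cut p f (fun m => m \in B) m = 0.
  by move=> Kz nM; apply: filterS (f0 z Kz nM) => m h Mm; rewrite /cut h// if_same.
have eqab m : a m - b m =
    (cut true a u m - cut true b v m) + (cut false a u m - cut false b v m).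
  by rewrite /cut; case: (u m); case: (v m); rewrite /= ?subr0 ?sub0r ?add0r ?addr0// addrC.
have fin p := finite_jumps (cut_lim p) (cut_f0 p).
have s1 : \sum_(m \in M) (cut true a u m - cut true b v m) = 0.
  apply: (arc_jump_sum ckd (cut_lim true)) => m Mm; rewrite -EB => nB.
  by rewrite /cut memNset.
have s2 : \sum_(m \in M) (cut false a u m - cut false b v m) = 0.
  apply: (IH _ _ _ _ (cut_lim false) (cut_f0 false)) => [B' B'l|m Mm].
    by apply: Hl; rewrite in_cons B'l orbT.
  rewrite /cut; case: (boolP (m \in B)) => [|mB]; first by rewrite eqxx.
  move=> /= /(fl m Mm)[B']; rewrite in_cons => /orP[/eqP ->|]; last by exists B'.
  by move=> /mem_set; rewrite (negbTE mB).
(* A sum over [M] counts as 0 when its support is infinite, so additivity is applied over a finite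
   set that contains both jump sets. *)
pose S := [set m | M m /\ cut true a u m - cut true b v m != 0] `|`
          [set m | M m /\ cut false a u m - cut false b v m != 0].
have finS : finite_set S by rewrite finite_setU; split; exact: fin.
have toS (h : T -> A) : (forall m, M m -> ~ S m -> h m = 0) ->
    \sum_(m \in M) h m = \sum_(m \in S) h m.
  move=> h0; apply/esym/fsbig_widen; first by move=> m [] [].
  by move=> m [Mm nS]; exact: h0.
have Snn p m : M m -> ~ S m -> cut p a u m - cut p b v m = 0.
  by move=> Mm nS; apply/eqP/negPn/negP => h; apply: nS; case: p h; [left|right].
rewrite toS => [|m Mm nS]; last by rewrite eqab !Snn// addr0.
under eq_fsbigr do rewrite eqab.
by rewrite fsbig_split//= -!toS ?s1 ?s2 ?addr0// => m; exact: Snn.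
Qed.

(** Each point of [K] has a neighbourhood in which [M] lies in one arc body or [f] vanishes on [M];
    finitely many of them cover [K], and their arc bodies carry the support of [f]. *)
Theorem jump_sum (f a b : T -> A) : onesided f a b ->
  (forall z, K z -> ~ M z -> \forall m \near z, M m -> f m = 0) ->
  \sum_(m \in M) (a m - b m) = 0.
Proof.
move=> lim f0.
pose isarc B := exists c k d, arc c k d /\ B = arc_body c d.
have /choice[N HN] : forall z, exists NB : set T * set T, K z -> nbhs z NB.1 /\
    ((forall m, NB.1 m -> M m -> f m = 0) \/
     isarc NB.2 /\ NB.1 `&` M `<=` NB.2).
  move=> z; case: (pselect (K z)) => [Kz|?]; last by exists (setT, setT).
  case: (pselect (M z)) => [Mz|nM]; last first.
    by exists (fun m => M m -> f m = 0, setT) => _; split; [exact: f0|left].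
  have [c [k [d [ckd cz]]]] := arcM Mz.
  have [d1 d2] := arc_half ckd.
  exists (fun m => M m -> arc_body c d m, arc_body c d) => _; split; last first.
    by right; split; [exists c, k, d|move=> m [h /h]].
  have [d0 _] := ckd; have z0 : `|0 : R| < d by rewrite normr0.
  have := arc_near ckd z0 d1; rewrite cz /=.
  apply: filterS => m H /H [s [-> _ + _ _]].
  by rewrite subr0 => /ltW; exact: arc_body_norm.
move: cK; rewrite compact_cover => cK'.
have [||D' D'K cov] := cK' T K (fun z => interior (N z).1).
- by move=> z _; exact: open_interior.
- by move=> z Kz; exists z => //; have [] := HN z Kz.
apply: (@jump_sum_cover
  [seq (N z).2 | z <- finmap.enum_fset D' & `[< isarc (N z).2 >]] f a b _ lim f0).
  by move=> B /mapP[z]; rewrite mem_filter => /andP[/asboolP iz _] ->.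
move=> m Mm fm; have [z zD /= /interior_subset Nm] := cov m (MK Mm).
have Kz : K z by have := D'K z zD; rewrite inE.
have [_ [/(_ m Nm Mm) fm0|[iz Nz]]] := HN z Kz; first by rewrite fm0 eqxx in fm.
exists (N z).2; last exact: Nz.
by apply/mapP; exists z => //; rewrite mem_filter zD andbT; apply/asboolP.
Qed.
End Jumps.

(** * Faces of a colored path and the boundary *)

Section Faces.
Variables (X : choiceType) (br : X -> X -> X -> X).

Lemma updE n i (F : nat -> X) : (0 < i <= n)%N ->
  upd br i [tuple F j | j < n.+2] =
  [tuple if j == i :> nat then br (F i.-1) (F i) (F i.+1) else F j | j < n.+2].
Proof.
move=> /andP[i0 i_n]; apply: eq_from_tnth => j; rewrite !tnth_mktuple.
rewrite !inordK// ?ltnS//; first exact: leqW.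
by rewrite (leq_trans (leq_pred _))// leqW.
Qed.

(* y i is the value at position i - 1 after the face map has erased x_0. *)
Lemma dLE n i (F y : nat -> X) : (i <= n)%N -> y i.+1 = F i.+1 ->
  (forall j, (0 < j <= i)%N -> y j = br (F j.-1) (F j) (y j.+1)) ->
  dL br i [tuple F j | j < n.+2] =
  [tuple if (j <= i)%N then y j.+1 else F j.+1 | j < n.+1].
Proof.
elim: i F => [|i IH] F i_n yi Hy.
  apply: eq_from_tnth => j; rewrite tnth_mktuple leqn0 (tnth_nth (F 0%N)) /=.
  rewrite nth_behead -[X in nth _ X](_ : tval [tuple F j | j < n.+2] = _)//.
  rewrite (_ : nth _ _ _ = tnth [tuple F j | j < n.+2] (lift ord0 j)); last first.
    by rewrite (tnth_nth (F 0%N)).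
  by rewrite tnth_mktuple lift0; case: eqP => // ->.
rewrite /= updE// (IH (fun j => if j == i.+1 then _ else F j)) ?eqxx//; last 3 first.
- exact: ltnW.
- by rewrite Hy ?leqnn// yi.
- move=> j /andP[j0 ji]; rewrite Hy ?j0 ?(leqW ji)//.
  by have [-> ->] : (j.-1 == i.+1) = false /\ (j == i.+1) = false by split; lia.
apply: eq_from_tnth => j; rewrite !tnth_mktuple eqSS.
case: (ltngtP j i) => ji; last by rewrite ji leqnSn.
  by rewrite leqW // ltnW.
by case: leqP => // ji1; have -> : nat_of_ord j = i.+1 by lia.
Qed.

(** Mirror image of [dLE]: the replacements run from left to right, each using the entry just
    replaced on its left, and since the last entry is the one dropped, positions do not shift. *)
Lemma dRE n i (F y : nat -> X) : (i <= n)%N -> y i = F i ->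
  (forall j, (i < j <= n)%N -> y j = br (y j.-1) (F j) (F j.+1)) ->
  dR br i [tuple F j | j < n.+2] =
  [tuple if (i <= j)%N then y j else F j | j < n.+1].
Proof.
rewrite /dR => i_n; have [m Em] : exists m, m = (n - i)%N by exists (n - i)%N.
rewrite -Em; elim: m i F i_n Em => [|m IH] i F i_n Em yi Hy.
  have {}i_n : i = n by apply/eqP; rewrite eqn_leq i_n /= -subn_eq0 -Em.
  apply: eq_from_tnth => j; rewrite !tnth_mktuple /=.
  by have := ltn_ord j; rewrite ltnS i_n; case: ltngtP => // ->; rewrite -i_n yi.
have lin : (i < n)%N by rewrite -subn_gt0 -Em.
have nm : (n - m = i.+1)%N.
  by move: Em lin; clear; move=> h l; have := subnSK l; rewrite -h => -[<-]; rewrite subKn.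
rewrite /= nm updE// (IH i.+1 (fun j => if j == i.+1 then _ else F j)) ?eqxx//; last 3 first.
- by rewrite subnS -Em.
- by rewrite Hy ?leqnn ?lin//= yi.
- move=> j /andP[ij jn]; rewrite Hy ?(ltnW ij)//.
  by have [-> ->] : (j == i.+1) = false /\ (j.+1 == i.+1) = false by split; lia.
apply: eq_from_tnth => j; rewrite !tnth_mktuple.
case: (ltngtP i j) => [//|ij|<-]; last by rewrite yi ltn_eqF.
by have -> : (nat_of_ord j == i.+1) = false by lia.
Qed.
End Faces.

(** * Faces of a colored path as labels of double edges *)

Section Paths.
Variables (X : choiceType) (br : X -> X -> X -> X) (S : Type) (p k : nat).
Variable C : nat -> S -> X.

Definition edge_path (r0 r1 r2 : S) : (p + k).+3.-tuple X :=
  [tuple if (j <= p)%N then C j r0 else if j == p.+1 :> nat then C p r1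
         else C (j - 2)%N r2 | j < (p + k).+3].

Definition triple_color (r0 r1 r2 r3 : S) (j : nat) : X :=
  if (j <= p)%N then C j r0
  else if j == p.+1 :> nat then C p r1
  else if j == p.+2 :> nat then C p r2
  else C (j - 3)%N r3.

Lemma triple_colorE r0 r1 r2 r3 :
  [/\ forall j, (j <= p)%N -> triple_color r0 r1 r2 r3 j = C j r0,
      triple_color r0 r1 r2 r3 p.+1 = C p r1,
      triple_color r0 r1 r2 r3 p.+2 = C p r2 &
      forall j, (p <= j)%N -> triple_color r0 r1 r2 r3 j.+3 = C j r3].
Proof.
rewrite /triple_color; split.
- by move=> j ->.
- by rewrite ltnn eqxx.
- by rewrite ltnNge leqnSn /= gtn_eqF// eqxx.
- by move=> j pj; rewrite !ifF ?subSS ?subn0//; lia.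
Qed.

(** The eight regions at a triple point: the three Booleans tell whether the region lies on the
    positive side of the top, the middle and the bottom sheet. *)
Variable reg : bool -> bool -> bool -> S.
Local Notation r0 := (reg false false false).
Local Notation r3 := (reg true true true).
Hypothesis top_middle : forall b,
  C p (reg true false b) =
    br (C p (reg false false b)) (C p (reg false true b)) (C p (reg true true b)).
Hypothesis top_bottom : forall m,
  C p (reg true m false) =
    br (C p (reg false m false)) (C p (reg false m true)) (C p (reg true m true)).
Hypothesis middle_bottom : forall t,
  C p (reg t true false) =
    br (C p (reg t false false)) (C p (reg t false true)) (C p (reg t true true)).
Hypothesis left : forall i (t m b : bool), (0 < i <= p)%N -> (t + m + b = 1)%N ->
  C i.-1 (reg t m b) = br (C i.-1 r0) (C i r0) (C i (reg t m b)).
Hypothesis right : forall i (t m b : bool), (p <= i < p + k)%N -> (t + m + b = 2)%N ->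
  C i.+1 (reg t m b) = br (C i (reg t m b)) (C i r3) (C i.+1 r3).

Definition triple_path : (p + k).+4.-tuple X :=
  [tuple triple_color r0 (reg false false true) (reg false true true) r3 j
  | j < (p + k).+4].

Lemma eq_edge_path (x : (p + k).+3.-tuple X) s0 s1 s2 :
  (forall j (jn : (j < (p + k).+3)%N), (j <= p)%N ->
     tnth x (Ordinal jn) = C j s0) ->
  (forall jn : (p.+1 < (p + k).+3)%N, tnth x (Ordinal jn) = C p s1) ->
  (forall j (jn : (j.+2 < (p + k).+3)%N), (p <= j)%N ->
     tnth x (Ordinal jn) = C j s2) ->
  x = edge_path s0 s1 s2.
Proof.
move=> x0 x1 x2; apply: eq_from_tnth => -[j jn]; rewrite !tnth_mktuple /=.
case: leqP => [/x0//|pj]; case: eqP => [jp|/eqP jp].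
  by move: jn; rewrite jp => jn; exact: x1.
have [i Ei] : exists i, j = i.+2 by exists (j - 2)%N; lia.
by move: jn pj jp; rewrite Ei => jn pj jp; rewrite x2 ?subSS ?subn0//; lia.
Qed.

(** The left faces are the labels of the double edges on the positive side of the bottom, the middle
    and the top sheet. The coloring relations at the double edges move the inner regions one by one
    across that sheet, and the left colorings carry the move of the source region through the colors
    of index below [p]. *)
Lemma dL_triple :
  [/\ dL br p triple_path =
        edge_path (reg false false true) (reg false true true) r3,
      dL br p.+1 triple_path =
        edge_path (reg false true false) (reg false true true) r3 &
      dL br p.+2 triple_path =
        edge_path (reg true false false) (reg true false true) r3].
Proof.
have [c0 c1 c2 c3] := triple_colorE r0 (reg false false true) (reg false true true) r3.
have leftE (t m b : bool) j : (t + m + b = 1)%N -> (0 < j <= p)%N ->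
  C j.-1 (reg t m b) = br
      (triple_color r0 (reg false false true) (reg false true true) r3 j.-1)
      (triple_color r0 (reg false false true) (reg false true true) r3 j)
      (C j (reg t m b)).
  by move=> tmb jp; rewrite left//; congr br; rewrite c0//; lia.
split.
- rewrite (@dLE _ _ (p + k).+2 p _ (fun j => C j.-1 (reg false false true)))//; last 2 first.
  + by lia.
  + by move=> j jp; exact: leftE.
  apply: eq_edge_path => [j jn jp|jn|j jn pj]; rewrite tnth_mktuple /=.
  + by rewrite jp.
  + by rewrite ltnn c2.
  + by rewrite c3// ifF//; lia.
- rewrite (@dLE _ _ (p + k).+2 p.+1 _ (fun j => if j == p.+2 then C p (reg false true true) else C j.-1 (reg false true false))); last 3 first.
  + by lia.
  + by rewrite eqxx.
  + move=> j /andP[j0]; rewrite leq_eqVlt => /orP[/eqP ->|jp].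
      by rewrite /= c0// c1 middle_bottom eqxx ltn_eqF.
    by rewrite !ifF; [apply: leftE|lia..]; rewrite ?j0.
  apply: eq_edge_path => [j jn jp|jn|j jn pj]; rewrite tnth_mktuple /=.
  + by rewrite leqW// ltn_eqF.
  + by rewrite leqnn eqxx.
  + by rewrite c3// ifF//; apply/negbTE; lia.
- rewrite (@dLE _ _ (p + k).+2 p.+2 _ (fun j => if j == p.+3 then C p r3
      else if j == p.+2 then C p (reg true false true) else C j.-1 (reg true false false))); last 3 first.
  + by lia.
  + by rewrite eqxx c3.
  + move=> j /andP[j0]; rewrite leq_eqVlt => /orP[/eqP ->|jp].
      by rewrite c1 c2 !eqxx ltn_eqF//= top_middle.
    have -> : (j == p.+3) = false by lia.
    have -> : (j == p.+2) = false by lia.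
    have -> : (j.+1 == p.+3) = false by lia.
    move: jp; rewrite ltnS leq_eqVlt => /orP[/eqP ->|jp].
      by rewrite /= eqxx c0// c1 top_bottom.
    by rewrite ltn_eqF//; apply: leftE; rewrite ?j0.
  apply: eq_edge_path => [j jn jp|jn|j jn pj]; rewrite tnth_mktuple /=.
  + have -> : (j <= p.+2)%N by lia.
    have -> : (j.+1 == p.+3) = false by lia.
    by rewrite ltn_eqF.
  + by rewrite leqnSn eqxx ltn_eqF.
  + rewrite c3// !ltnS; case: (leqP j p) => // jp; have -> : j = p by lia.
    by rewrite eqxx.
Qed.

(** The right faces are the labels on the negative side of the same three sheets; here the right
    colorings carry the move of the target region through the colors of index above [p]. *)
Lemma dR_triple :
  [/\ dR br p triple_path =
        edge_path r0 (reg false true false) (reg true true false),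
      dR br p.+1 triple_path =
        edge_path r0 (reg false false true) (reg true false true) &
      dR br p.+2 triple_path =
        edge_path r0 (reg false false true) (reg false true true)].
Proof.
have [c0 c1 c2 c3] := triple_colorE r0 (reg false false true) (reg false true true) r3.
have rightE (t m b : bool) j : (t + m + b = 2)%N -> (p.+2 < j <= (p + k).+2)%N ->
  C (j - 2)%N (reg t m b) = br (C (j.-1 - 2)%N (reg t m b))
      (triple_color r0 (reg false false true) (reg false true true) r3 j)
      (triple_color r0 (reg false false true) (reg false true true) r3 j.+1).
  move=> tmb jp; have [i Ei] : exists i, j = i.+3 by exists (j - 3)%N; lia.
  rewrite Ei in jp *; rewrite !c3; [|lia..].
  by rewrite !subSS !subn0 right//; lia.
split.
- rewrite (@dRE _ _ (p + k).+2 p _ (fun j => if j == p then C p r0 else if j == p.+1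
      then C p (reg false true false) else C (j - 2)%N (reg true true false))); last 3 first.
  + by lia.
  + by rewrite eqxx c0.
  + move=> j jp; have -> : (j == p) = false by lia.
    case: eqP => [->|/eqP jp1]; first by rewrite /= eqxx c1 c2 middle_bottom.
    have -> : (j.-1 == p) = false by lia.
    case: (eqVneq j p.+2) => [->|jp2].
      by rewrite /= eqxx !subSS subn0 c2 c3// top_bottom.
    have -> : (j.-1 == p.+1) = false by lia.
    by apply: rightE => //; lia.
  apply: eq_edge_path => [j jn jp|jn|j jn pj]; rewrite tnth_mktuple /=.
  + by case: ltngtP jp => // [jp _|-> //]; rewrite c0// ltnW.
  + by rewrite leqnSn eqxx gtn_eqF.
  + rewrite ifT; last by lia.
    by rewrite !ifF ?subSS ?subn0//; lia.
- rewrite (@dRE _ _ (p + k).+2 p.+1 _ (fun j => if j == p.+1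
      then C p (reg false false true) else C (j - 2)%N (reg true false true))); last 3 first.
  + by lia.
  + by rewrite eqxx c1.
  + move=> j jp; have -> : (j == p.+1) = false by lia.
    case: (eqVneq j p.+2) => [->|jp2].
      by rewrite /= eqxx !subSS subn0 c2 c3// top_middle.
    have -> : (j.-1 == p.+1) = false by lia.
    by apply: rightE => //; lia.
  apply: eq_edge_path => [j jn jp|jn|j jn pj]; rewrite tnth_mktuple /=.
  + by rewrite ltnNge jp /= c0.
  + by rewrite leqnn eqxx.
  + by rewrite !ltnS leqW// ifF ?subSS ?subn0//; lia.
- rewrite (@dRE _ _ (p + k).+2 p.+2 _ (fun j => C (j - 2)%N (reg false true true))); last 3 first.
  + by lia.
  + by rewrite !subSS subn0 c2.
  + by move=> j jp; apply: rightE.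
  apply: eq_edge_path => [j jn jp|jn|j jn pj]; rewrite tnth_mktuple /=.
  + by rewrite ifF ?c0//; lia.
  + by rewrite ltnn c1.
  + by rewrite !ltnS pj !subSS subn0.
Qed.
End Paths.

(** * Coefficients of the boundary of a chain *)

Section Boundary.
Variables (A : comPzRingType) (X : choiceType).
Local Notation chain m := (@monalg.malg (m.-tuple X) A).

Lemma lin_supp m m' (f : m.-tuple X -> m'.-tuple X) (c : chain m)
    (d : {fset m.-tuple X}) :
  (forall x, x \in monalg.msupp c -> x \in d) ->
  lin f c = \sum_(x <- d) monalg.mkmalgU (f x) (monalg.mcoeff x c).
Proof.
move=> sub; rewrite /lin; apply: big_fset_incl.
  by apply/fsubsetP.
by move=> x _ xc; rewrite (monalg.mcoeff_outdom xc) raddf0.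
Qed.

Lemma linD m m' (f : m.-tuple X -> m'.-tuple X) (c c' : chain m) :
  lin f (c + c') = lin f c + lin f c'.
Proof.
rewrite (@lin_supp _ _ f (c + c') (monalg.msupp c `|` monalg.msupp c')%fset).
  rewrite (@lin_supp _ _ f c (monalg.msupp c `|` monalg.msupp c')%fset).
    rewrite (@lin_supp _ _ f c' (monalg.msupp c `|` monalg.msupp c')%fset).
      by rewrite -big_split; apply: eq_bigr => x _; rewrite /= monalg.mcoeffD raddfD.
    by move=> x xc; rewrite in_fsetU xc orbT.
  by move=> x xc; rewrite in_fsetU xc.
by move=> x; apply/fsubsetP/monalg.msuppD_le.
Qed.

Lemma lin0 m m' (f : m.-tuple X -> m'.-tuple X) : lin f (0 : chain m) = 0.
Proof. by rewrite /lin monalg.msupp0 big_seq_fset0. Qed.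

Lemma linU m m' (f : m.-tuple X -> m'.-tuple X) a x :
  lin f (monalg.mkmalgU x a : chain m) = monalg.mkmalgU (f x) a.
Proof.
rewrite (@lin_supp _ _ f _ [fset x]%fset).
  by rewrite big_seq_fset1 monalg.mcoeffUU.
by apply/fsubsetP/monalg.msuppU_le.
Qed.

Lemma lin_sum m m' (f : m.-tuple X -> m'.-tuple X) (I : Type) (s : seq I)
    (a : I -> A) (x : I -> m.-tuple X) :
  lin f (\sum_(q <- s) monalg.mkmalgU (x q) (a q) : chain m) =
  \sum_(q <- s) monalg.mkmalgU (f (x q)) (a q).
Proof.
elim: s => [|q s IH]; first by rewrite !big_nil lin0.
by rewrite !big_cons linD IH linU.
Qed.
End Boundary.

Section Coefficients.
Variables (A : comPzRingType) (X : choiceType) (br : X -> X -> X -> X).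
Variables (p k : nat).
Local Notation chain m := (@monalg.malg (m.-tuple X) A).

Definition face_coef (y : (p + k).+3.-tuple X) i (x : (p + k).+4.-tuple X) : A :=
  (dL br i x == y)%:R - (dR br i x == y)%:R.

(** For n = p + k + 2 the truncation leaves exactly the indices [p], [p + 1] and [p + 2], so (-1)^p
    factors out of an alternating sum of three faces. *)
Lemma boundary_coef (I : Type) (s : seq I) (a : I -> A)
    (x : I -> (p + k).+4.-tuple X) y :
  monalg.mcoeff y (boundary br p k
    (\sum_(q <- s) monalg.mkmalgU (x q) (a q) : chain (p + k).+4)) =
  (-1) ^+ p * \sum_(q <- s) a q *
    (face_coef y p (x q) - face_coef y p.+1 (x q) + face_coef y p.+2 (x q)).
Proof.
have faceE i : monalg.mcoeff y (lin (@dL _ br (p + k).+2 i)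
    (\sum_(q <- s) monalg.mkmalgU (x q) (a q) : chain (p + k).+4) -
   lin (@dR _ br (p + k).+2 i)
    (\sum_(q <- s) monalg.mkmalgU (x q) (a q) : chain (p + k).+4)) =
   \sum_(q <- s) a q * face_coef y i (x q).
  rewrite !lin_sum monalg.mcoeffB.
  rewrite !(raddf_sum (monalg.mcoeff y)) /=. rewrite -sumrB; apply: eq_bigr => q _ /=.
  by rewrite !monalg.mcoeffU /face_coef mulrBr !mulr_natr.
have alt (D : nat -> chain (p + k).+3) (v : nat -> A) :
    (forall i, monalg.mcoeff y (D i) = v i) ->
    monalg.mcoeff y (\sum_(p <= i < p.+3) D i *~ (-1) ^+ i) = (-1) ^+ p * (v p - v p.+1 + v p.+2).
  move=> Dv; rewrite big_ltn ?ltnS ?leqW// big_ltn// big_nat1.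
  have sgnE (c : chain (p + k).+3) i :
      monalg.mcoeff y (c *~ (-1) ^+ i) = (-1) ^+ i * monalg.mcoeff y c.
    by rewrite raddfMz -mulrzr rmorphXn /= rmorphN1 mulrC.
  by rewrite !monalg.mcoeffD !sgnE !Dv !exprS; ring.
rewrite /boundary (_ : ((p + k).+3 - k)%N = p.+3); last by lia.
rewrite (alt _ _ faceE) -sumrB -big_split; congr (_ * _); apply: eq_bigr => q _.
by rewrite /= -mulrBr -mulrDr.
Qed.

(** The expansion of the chain over its support is the required combination, so nondegenerate tuples
    can be tested one at a time. *)
Lemma degenerate_chainP n (c : chain n.+2) : (p + k < n)%N ->
  (forall y, ~ degenerate br p k y -> monalg.mcoeff y c = 0) ->
  degenerate_chain br p k c.
Proof.
move=> pkn Hc; rewrite /degenerate_chain pkn.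
exists [seq (monalg.mcoeff y c, y) | y <- monalg.msupp c] => [z /mapP[y yc ->]|].
  apply: contrapT => /Hc /eqP; rewrite /= monalg.mcoeff_eq0.
  by rewrite yc.
by rewrite big_map -monalg.monalgE.
Qed.

(** In this degree the truncation admits the single index [p], the position of the color of [r0]. *)
Lemma edge_path_degenerate (S : Type) (C : nat -> S -> X) r0 r1 r2 :
  C p r1 = br (C p r0) (C p r1) (C p r2) ->
  degenerate br p k (edge_path p k C r0 r1 r2).
Proof.
move=> H; exists p; split => //; first by lia.
rewrite !tnth_mktuple !inordK; [|lia..].
by rewrite leqnn ltnn eqxx ltnNge leqnSn /= gtn_eqF// !subSS subn0.
Qed.
End Coefficients.

(** * Directional derivatives *)

Section Calculus.
Variable R : realType.

Lemma is_derive_ray (V W : normedModType R) (f : V -> W) x v t :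
  derivable f (x + t *: v) v ->
  is_derive (t : R^o) 1 (fun s : R^o => f (x + s *: v)) ('D_v f (x + t *: v)).
Proof.
have E : (fun h : R => h^-1 *: (((fun s : R^o => f (x + s *: v)) \o shift (t : R^o))
      (h *: (1 : R^o)) - f (x + t *: v))) =
    (fun h : R => h^-1 *: ((f \o shift (x + t *: v)) (h *: v) - f (x + t *: v))).
  apply/funext => h /=; congr (_ *: (f _ - _)).
  by rewrite [h *: 1]mulr1 scalerDl addrCA addrA.
by move=> df; split; rewrite /derivable /derive E.
Qed.

Lemma MVT_dir (V : normedModType R) (f : V -> R^o) x v s :
  (forall t, `|t| <= `|s| -> derivable f (x + t *: v) v) ->
  exists2 t, `|t| <= `|s| & f (x + s *: v) - f x = s * 'D_v f (x + t *: v).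
Proof.
move=> df; pose g t := f (x + t *: v).
have dg t : `|t| <= `|s| -> is_derive (t : R^o) 1 (g : R^o -> R^o) ('D_v f (x + t *: v)).
  by move=> /df; exact: is_derive_ray.
have cont a b : - `|s| <= a -> b <= `|s| -> {within `[a, b], continuous (g : R -> R)}.
  move=> sa bs; apply: derivable_within_continuous => t; rewrite in_itv /= => /andP[h1 h2].
  by have [] := dg t; rewrite ?ler_norml ?(le_trans sa) ?(le_trans h2).
have gs : g s = f (x + s *: v) by [].
have g0 : g 0 = f x by rewrite /g scale0r addr0.
rewrite -gs -g0; case: (leP 0 s) => s0.
  have c0 : {within `[0, s], continuous (g : R -> R)}.
    by apply: cont; rewrite ?oppr_le0 ?ger0_norm.
  have [|t] := @MVT_segment R g (fun t => 'D_v f (x + t *: v)) 0 s s0 _ c0.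
    move=> t; rewrite in_itv /= => /andP[h1 h2]; apply: dg.
    by rewrite !ger0_norm// ltW.
  rewrite in_itv /= subr0 mulrC => /andP[t0 ts] ->; exists t => //.
  by rewrite !ger0_norm.
have c0 : {within `[s, 0], continuous (g : R -> R)}.
  by apply: cont; rewrite ?normr_ge0 ?ltr0_norm ?opprK.
have [|t] := @MVT_segment R g (fun t => 'D_v f (x + t *: v)) s 0 (ltW s0) _ c0.
  move=> t; rewrite in_itv /= => /andP[h1 h2]; apply: dg.
  by rewrite !ltr0_norm// lerN2 ltW.
rewrite in_itv /= sub0r => /andP[ts t0] H; exists t.
  by rewrite !ler0_norm ?lerN2// ltW.
by rewrite -opprB H mulrN opprK mulrC.
Qed.

Definition C1_on (V W : normedModType R) (U : set V) (f : V -> W) : Prop :=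
  [/\ forall x, U x -> {for x, continuous f},
      forall x v, U x -> derivable f x v &
      forall x v, U x -> {for x, continuous ('D_v f)}].

Lemma smooth_C1 (V W : normedModType R) (U : set V) (f : V -> W) :
  smooth_on U f -> C1_on U f.
Proof.
move=> /(_ 1%N) [cf df]; split=> // [x v Ux|x v Ux].
  by have [H _] := df v; exact: H.
by have [_ [H _]] := df v; exact: H.
Qed.

Lemma derive_coord (V : normedModType R) n (f : V -> 'rV[R]_n) j x v :
  derivable f x v ->
  derivable (fun x => f x 0 j : R^o) x v /\
  'D_v (fun x => f x 0 j : R^o) x = 'D_v f x 0 j.
Proof.
move=> df; split; last by rewrite derive_mx// mxE.
by have /derivable_mxP dm := df; exact: (dm 0 j).
Qed.

Lemma C1_coord (V : normedModType R) n (U : set V) (f : V -> 'rV[R]_n) j :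
  open U -> C1_on U f -> C1_on U (fun x => f x 0 j : R^o).
Proof.
move=> oU [cf df cdf]; split=> [x Ux|x v Ux|x v Ux].
- by apply: (@continuous_comp _ _ _ f (fun y => y 0 j)); [exact: cf|exact: coord_continuous].
- by have [] := derive_coord j (df x v Ux).
have E : \forall y \near x, 'D_v f y 0 j = 'D_v (fun x => f x 0 j : R^o) y.
  apply: filterS (open_nbhs_nbhs (conj oU Ux)) => y Uy.
  by have [_ ->] := derive_coord j (df y v Uy).
apply: cvg_trans (near_eq_cvg E) _.
rewrite -(nbhs_singleton E).
apply: (@continuous_comp _ _ _ ('D_v f) (fun y => y 0 j)); first exact: cdf.
exact: coord_continuous.
Qed.

Definition partial n (h : 'rV[R]_n) (k : nat) : 'rV[R]_n :=
  \row_j (if (j < k)%N then h 0 j else 0).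

Lemma partialS n (h : 'rV[R]_n) (k : 'I_n) :
  partial h k.+1 = partial h k + h 0 k *: delta_mx 0 k.
Proof.
apply/rowP => j; rewrite !mxE eqxx /= ltnS leq_eqVlt -val_eqE /=.
by case: eqP => [/val_inj ->|]; rewrite ?ltnn ?mulr1 ?add0r// mulr0 addr0.
Qed.

Lemma partial_norm n (h : 'rV[R]_n) (k : nat) t e : `|h| < e ->
  (forall j : 'I_n, k = j :> nat -> `|t| <= `|h 0 j|) ->
  `|partial h k + \row_j (if j == k :> nat then t else 0)| < e.
Proof.
move=> he ht; apply: le_lt_trans he; rewrite [leLHS]/Num.Def.normr/= mx_normrE.
apply: bigmax_le => // -[i j] _; rewrite !mxE /=.
have le_h : `|h 0 j| <= `|h|.
  by rewrite [leRHS]/Num.Def.normr/= mx_normrE; exact: (le_bigmax _ _ (0, j)).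
case: (ltngtP j k) => [_|_|jk]; rewrite ?addr0 ?normr0//.
by rewrite add0r (le_trans _ le_h)// ht.
Qed.

Lemma differentiable_approx (V W : normedModType R) (f : V -> W)
    (L : {linear V -> W}) x : continuous L ->
  (forall e, 0 < e -> \forall h \near (0 : V),
    `|f (x + h) - (f x + L h)| <= e * `|h|) ->
  differentiable f x.
Proof.
move=> Lc fL; have key : f \o shift x = cst (f x) + L +o_ 0 id.
  apply/eqaddoP => e e0; rewrite !near_simpl.
  by apply: filterS (fL e e0) => h; rewrite (addrC x h).
by apply/diff_locallyP; rewrite (diff_unique Lc key); split.
Qed.

(** The increment is split into steps along the coordinate axes. The mean value theorem turns each
    step into a partial derivative at a nearby point, which by continuity is close to the one at
    [x]. *)
Lemma C1_differentiable_scalar n (U : set 'rV[R]_n) (f : 'rV[R]_n -> R^o) x :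
  open U -> C1_on U f -> U x -> differentiable f x.
Proof.
move=> oU [_ df cdf] Ux.
pose L (h : 'rV[R]_n) : R^o := \sum_(j < n) h 0 j * 'D_(delta_mx 0 j) f x.
have Llin : linear L.
  move=> a u v; rewrite /L scaler_sumr -big_split; apply: eq_bigr => j _ /=.
  by rewrite !mxE mulrDl scalerAl.
have Lc : continuous L.
  apply: continuous_big => [|j _]; first exact: add_continuous.
  move=> h; apply: cvgMr_tmp; first exact: (nbhs_filter h).
  exact: (@coord_continuous R 1 n 0 j h).
pose LM := GRing.isLinear.Build _ _ _ _ _ Llin.
pose LL : {linear _ -> _} := HB.pack L LM.
apply: (@differentiable_approx _ _ _ LL) => // e e0.
(* There are [n] steps, each with an error of at most [e'] times the norm of [h]; dividing by n + 1
   also covers n = 0. *)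
pose e' := e / n.+1%:R; have e'0 : 0 < e' by rewrite divr_gt0.
have nearD : \forall y \near x, U y /\ forall j : 'I_n,
    `|'D_(delta_mx 0 j) f y - 'D_(delta_mx 0 j) f x| <= e'.
  near=> y; split; first by near: y; exact: open_nbhs_nbhs.
  near: y; apply: filter_forall => j.
  have /cvgrPdist_le /(_ e' e'0) := cdf x (delta_mx 0 j) Ux.
  by apply: filterS => y; rewrite distrC.
have /nbhs_ballP[d /= d0 Hd] := nearD.
apply: filterS (nbhsx_ballx (0 : 'rV[R]_n) d d0) => h.
rewrite -ball_normE /= sub0r normrN => hd.
have telescope : f (x + h) - f x = \sum_(j < n)
    (f (x + partial h j.+1) - f (x + partial h j)).
  rewrite -(big_mkord xpredT (fun j => f (x + partial h j.+1) - f (x + partial h j))).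
  rewrite telescope_sumr//; congr (f (x + _) - f _); apply/rowP => j; rewrite !mxE ?ltn_ord//.
  by rewrite addr0.
have -> : f (x + h) - (f x + LL h) = \sum_(j < n)
    (f (x + partial h j.+1) - f (x + partial h j) - h 0 j * 'D_(delta_mx 0 j) f x).
  by rewrite sumrB -telescope opprD addrA.
have bnd (j : 'I_n) : `|f (x + partial h j.+1) - f (x + partial h j) -
    h 0 j * 'D_(delta_mx 0 j) f x| <= e' * `|h|.
  have pd t : `|t| <= `|h 0 j| -> ball x d (x + partial h j + t *: delta_mx 0 j).
    move=> th; rewrite -ball_normE /= -addrA opprD addNKr normrN.
    have -> : t *: delta_mx 0 j = \row_i (if i == j :> nat then t else 0).
      apply/rowP => i; rewrite !mxE eqxx /= -val_eqE.
      by case: eqP => _; rewrite ?mulr1 ?mulr0.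
    by apply: partial_norm => // i /val_inj <-.
  have [|t th] := @MVT_dir _ f (x + partial h j) (delta_mx 0 j) (h 0 j).
    by move=> t th; apply: df; have [] := Hd _ (pd t th).
  rewrite -addrA -partialS => ->; rewrite -mulrBr normrM mulrC ler_pM//.
    by have [_] := Hd _ (pd t th); apply.
  by rewrite [leRHS]/Num.Def.normr/= mx_normrE; exact: (le_bigmax _ _ (0, j)).
rewrite (le_trans (ler_norm_sum _ _ _))//.
rewrite (le_trans (ler_sum _ (fun j _ => bnd j)))// sumr_const card_ord.
rewrite -mulrnAl ler_wpM2r// -mulr_natl /e' mulrCA ger_pMr//.
by rewrite ler_pdivrMr ?ltr0n// mul1r ler_nat.
Unshelve. all: by end_near. Qed.

Lemma C1_differentiable m n (U : set 'rV[R]_m) (f : 'rV[R]_m -> 'rV[R]_n) x :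
  open U -> C1_on U f -> U x -> differentiable f x.
Proof.
move=> oU fs Ux.
have -> : f = \sum_(j < n) (fun x => f x 0 j *: delta_mx 0 j).
  by apply/funext => y; rewrite fct_sumE {1}[f y]row_sum_delta.
apply: differentiable_sum => j; apply: differentiableZl.
exact: (C1_differentiable_scalar oU (C1_coord j oU fs) Ux).
Qed.

Lemma derivable_derive_continuous (V : normedModType R) (c : R^o -> V) (t : R^o) v :
  is_derive t 1 c v -> {for t, continuous c}.
Proof.
move=> dc; apply: differentiable_continuous; apply/derivable1_diffP.
exact: ex_derive.
Qed.

Lemma is_derive_comp (V W : normedModType R) (f : V -> W) (c : R^o -> V) (t : R^o) v :
  differentiable f (c t) -> is_derive t 1 c v ->
  is_derive t 1 (f \o c) ('D_v f (c t)).
Proof.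
move=> df dc; have cdiff : differentiable c t.
  by apply/derivable1_diffP; exact: ex_derive.
apply: DeriveDef; first by apply/derivable1_diffP; exact: differentiable_comp.
rewrite deriveE; last exact: differentiable_comp.
by rewrite diff_comp// /= deriveE// -[in RHS](@derive_val _ _ _ _ _ _ _ dc) deriveE.
Qed.

Lemma is_derive_coord n (c : R^o -> 'rV[R]_n) (t : R^o) v j :
  is_derive t 1 c v -> is_derive t 1 (fun s => c s 0 j : R^o) (v 0 j).
Proof.
move=> [dc cv]; have [d1 d2] := derive_coord j dc.
by apply: DeriveDef => //; rewrite d2 cv.
Qed.

Lemma is_derive_pos (g : R^o -> R^o) (t : R^o) d : is_derive t 1 g d -> 0 < d ->
  \forall s \near t, (t < s -> g t < g s) /\ (s < t -> g s < g t).
Proof.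
move=> [dg gd] d0; move: dg; rewrite /derivable -[lim _]/('D_1 g t) gd => dg.
have /nbhs_ballP[e /= e0 H] : \forall h \near 0, h != 0 -> 0 < h^-1 *: ((g \o shift t) (h *: 1) - g t).
  exact: (cvgr_gt _ dg _ d0).
apply/nbhs_ballP; exists e => // s; rewrite /ball/= => ts.
have key : s - t != 0 -> 0 < (s - t)^-1 * (g s - g t).
  move=> st; have := H (s - t); rewrite /ball/= sub0r normrN distrC => /(_ ts st).
  by rewrite [(s - t) *: 1]mulr1 subrK.
split=> st.
  have := key; rewrite subr_eq0 gt_eqF// => /(_ isT).
  by rewrite pmulr_rgt0 ?subr_gt0// invr_gt0 subr_gt0.
have := key; rewrite subr_eq0 lt_eqF// => /(_ isT).
by rewrite nmulr_rgt0 ?subr_lt0// invr_lt0 subr_lt0.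
Qed.
End Calculus.

(** * Vectors, bivectors and normals *)

Section Space.
Variable R : realType.
Local Notation R3 := 'rV[R]_3.
Local Notation R4 := 'rV[R]_4.
Implicit Types (u v w a b c : R3).

Lemma ord3P (P : 'I_3 -> Prop) :
  P (inord 0) -> P (inord 1) -> P (inord 2) -> forall i, P i.
Proof.
move=> P0 P1 P2 [[|[|[|k]]] lk] //.
- by rewrite (_ : Ordinal lk = inord 0)//; apply: val_inj; rewrite /= inordK.
- by rewrite (_ : Ordinal lk = inord 1)//; apply: val_inj; rewrite /= inordK.
- by rewrite (_ : Ordinal lk = inord 2)//; apply: val_inj; rewrite /= inordK.
Qed.

Lemma sum3 (V : zmodType) (F : 'I_3 -> V) :
  \sum_(i < 3) F i = F (inord 0) + F (inord 1) + F (inord 2).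
Proof.
rewrite !big_ord_recl big_ord0 addr0 addrA.
by congr (F _ + F _ + F _); apply: val_inj; rewrite /= ?inordK.
Qed.

Lemma dotE u v : dot u v = u 0 (inord 0) * v 0 (inord 0) +
  u 0 (inord 1) * v 0 (inord 1) + u 0 (inord 2) * v 0 (inord 2).
Proof. by rewrite /dot mxE sum3 !mxE. Qed.

Lemma dotC u v : dot u v = dot v u.
Proof. by rewrite !dotE; ring. Qed.

Lemma dotZl k u w : dot (k *: u) w = k * dot u w.
Proof. by rewrite !dotE !mxE; ring. Qed.

Lemma dotZr k u w : dot u (k *: w) = k * dot u w.
Proof. by rewrite !dotE !mxE; ring. Qed.

Lemma dot0l w : dot (0 : R3) w = 0.
Proof. by rewrite !dotE !mxE; ring. Qed.

Lemma dot_gt0 u : u != 0 -> 0 < dot u u.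
Proof.
move=> u0; rewrite dotE -!expr2 lt_neqAle !addr_ge0 ?sqr_ge0// andbT eq_sym.
apply: contraNneq u0 => /eqP; rewrite !paddr_eq0 ?addr_ge0 ?sqr_ge0// !sqrf_eq0.
move=> /andP[/andP[/eqP h0 /eqP h1] /eqP h2].
by apply/eqP/rowP; apply: ord3P; rewrite !mxE.
Qed.

Definition cross a b : R3 :=
  \row_(i < 3) [:: a 0 (inord 1) * b 0 (inord 2) - a 0 (inord 2) * b 0 (inord 1);
    a 0 (inord 2) * b 0 (inord 0) - a 0 (inord 0) * b 0 (inord 2);
    a 0 (inord 0) * b 0 (inord 1) - a 0 (inord 1) * b 0 (inord 0)]`_i.

Lemma crossE a b :
  [/\ cross a b 0 (inord 0) =
        a 0 (inord 1) * b 0 (inord 2) - a 0 (inord 2) * b 0 (inord 1),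
      cross a b 0 (inord 1) =
        a 0 (inord 2) * b 0 (inord 0) - a 0 (inord 0) * b 0 (inord 2) &
      cross a b 0 (inord 2) =
        a 0 (inord 0) * b 0 (inord 1) - a 0 (inord 1) * b 0 (inord 0)].
Proof. by split; rewrite mxE inordK. Qed.

Definition triple a b c : R := dot (cross a b) c.

Lemma tripleE a b c : triple a b c =
  (a 0 (inord 1) * b 0 (inord 2) - a 0 (inord 2) * b 0 (inord 1)) * c 0 (inord 0) +
  (a 0 (inord 2) * b 0 (inord 0) - a 0 (inord 0) * b 0 (inord 2)) * c 0 (inord 1) +
  (a 0 (inord 0) * b 0 (inord 1) - a 0 (inord 1) * b 0 (inord 0)) * c 0 (inord 2).
Proof. by rewrite /triple dotE; have [-> -> ->] := crossE a b. Qed.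

Lemma det_mx3 (E : nat -> nat -> R) : \det (\matrix_(i < 3, j < 3) E i j) =
  E 0%N 0%N * (E 1%N 1%N * E 2%N 2%N - E 1%N 2%N * E 2%N 1%N) -
  E 0%N 1%N * (E 1%N 0%N * E 2%N 2%N - E 1%N 2%N * E 2%N 0%N) +
  E 0%N 2%N * (E 1%N 0%N * E 2%N 1%N - E 1%N 1%N * E 2%N 0%N).
Proof.
rewrite (expand_det_row _ ord0) !big_ord_recl big_ord0 /cofactor.
rewrite !(expand_det_row _ ord0) !big_ord_recl !big_ord0 /cofactor !det_mx11.
by rewrite !mxE /= /bump /=; ring.
Qed.

Lemma det_triple a b c :
  \det (\matrix_(i < 3) [:: a; b; c]`_i) = triple a b c.
Proof.
rewrite (_ : \matrix_i _ = \matrix_(i < 3, j < 3) [:: a; b; c]`_i 0 (inord j)).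
  by rewrite (det_mx3 (fun i j => [:: a; b; c]`_i 0 (inord j))) tripleE /=; ring.
by apply/matrixP => i j; rewrite !mxE; congr (_ _ _); rewrite inord_val.
Qed.

(* The Gram determinant formula. *)
Lemma triple_mul a b c u v w :
  triple a b c * triple u v w =
  dot a u * (dot b v * dot c w - dot b w * dot c v) -
  dot a v * (dot b u * dot c w - dot b w * dot c u) +
  dot a w * (dot b u * dot c v - dot b v * dot c u).
Proof. by rewrite !tripleE !dotE; ring. Qed.

(** Expansion of [g] in terms of [cross a b], [a] and [b], with denominators cleared so that it also
    holds for dependent [a] and [b]. *)
Lemma cross_orth a b g : dot a g = 0 -> dot b g = 0 ->
  dot (cross a b) (cross a b) *: g = dot (cross a b) g *: cross a b.
Proof.
move=> ag bg; have E : dot (cross a b) (cross a b) *: g =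
    dot (cross a b) g *: cross a b +
    (dot a g * dot b b - dot b g * dot a b) *: a +
    (dot b g * dot a a - dot a g * dot a b) *: b.
  apply/rowP; have [c0 c1 c2] := crossE a b.
  by apply: ord3P; rewrite !mxE !dotE ?c0 ?c1 ?c2 ?inordK//=; ring.
by rewrite E ag bg !mul0r subrr !scale0r !addr0.
Qed.

Definition lift4 (x : R3) (s : R) : R4 :=
  \row_(i < 4) if unlift ord_max i is Some j then x 0 j else s.

Lemma widen_lift (j : 'I_3) : widen_ord (leqnSn 3) j = lift ord_max j.
Proof. by apply: val_inj; rewrite /= /bump leqNgt ltn_ord. Qed.

Lemma proj_lift4 x s : proj (lift4 x s) = x.
Proof. by apply/rowP => j; rewrite !mxE widen_lift liftK. Qed.

Lemma height_lift4 x s : height (lift4 x s) = s.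
Proof. by rewrite /height mxE unlift_none. Qed.

Lemma lift4K p : lift4 (proj p) (height p) = p.
Proof.
apply/rowP => j; rewrite !mxE; case: unliftP => [i ->|->//].
by rewrite mxE widen_lift.
Qed.

Lemma proj_linear : linear (@proj R).
Proof. by move=> k p q; apply/rowP => j; rewrite !mxE. Qed.

HB.instance Definition _ := GRing.isLinear.Build _ _ _ _ _ proj_linear.

Lemma row_continuous (T : topologicalType) n (f : T -> 'rV[R]_n) t :
  (forall j, {for t, continuous (fun s => f s 0 j)}) -> {for t, continuous f}.
Proof.
move=> fj; apply/cvgrPdist_lt => e e0; near=> s.
rewrite [ltLHS]/Num.Def.normr/= mx_normrE; apply: bigmax_lt => // -[i j] _ /=.
rewrite !mxE (ord1 i); move: j {i}; near: s; apply: filter_forall => j.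
by have /cvgrPdist_lt /(_ e e0) := fj j.
Unshelve. all: by end_near. Qed.

Lemma proj_continuous : continuous (@proj R).
Proof.
move=> p; apply: row_continuous => j.
rewrite [X in {for _, continuous X}](_ : _ = (fun q : R4 => q 0 (widen_ord (leqnSn 3) j))).
  exact: coord_continuous.
by apply/funext => q; rewrite mxE.
Qed.

Lemma height_continuous : continuous (@height R).
Proof. by move=> p; exact: coord_continuous. Qed.

Lemma lift4_continuous (T : topologicalType) (x : T -> R3) (s : T -> R) t :
  {for t, continuous x} -> {for t, continuous s} ->
  {for t, continuous (fun t => lift4 (x t) (s t))}.
Proof.
move=> cx cs; apply: row_continuous => j; case: (unliftP ord_max j) => [i ->|->].
  rewrite [X in {for _, continuous X}](_ : _ = (fun t => x t 0 i)).
    by apply: (@continuous_comp _ _ _ x (fun y => y 0 i)) => //; exact: coord_continuous.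
  by apply/funext => t'; rewrite mxE liftK.
rewrite [X in {for _, continuous X}](_ : _ = s)//.
by apply/funext => t'; rewrite mxE unlift_none.
Qed.

Lemma proj_coord (p : R4) k : (k < 3)%N -> proj p 0 (inord k) = p 0 (inord k).
Proof.
move=> k3; rewrite mxE; congr (p _ _); apply: val_inj.
by rewrite /= !inordK// ltnW.
Qed.

Lemma proj_lift (p : R4) (i : 'I_3) : proj p 0 i = p 0 (lift ord_max i).
Proof. by rewrite mxE widen_lift. Qed.

Lemma wedgeE (a b : R4) i j : wedge a b i j = a 0 i * b 0 j - b 0 i * a 0 j.
Proof. by rewrite !mxE !big_ord1 !mxE. Qed.

(** All four vectors lie in the graph of the linear form [dot _ g], so the minors that involve the
    height are combinations of those of the projections, which are the entries of the cross
    products. *)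
Lemma wedge_graph (g : R3) (a b x y : R4) nu :
  height a = dot (proj a) g -> height b = dot (proj b) g ->
  height x = dot (proj x) g -> height y = dot (proj y) g ->
  cross (proj x) (proj y) = nu *: cross (proj a) (proj b) ->
  wedge x y = nu *: wedge a b.
Proof.
move=> ha hb hx hy cxy.
have minor (i j : 'I_3) : proj x 0 i * proj y 0 j - proj y 0 i * proj x 0 j =
    nu * (proj a 0 i * proj b 0 j - proj b 0 i * proj a 0 j).
  have E k : cross (proj x) (proj y) 0 k = nu * cross (proj a) (proj b) 0 k.
    by rewrite cxy mxE.
  have [x0 x1 x2] := crossE (proj x) (proj y).
  have [a0 a1 a2] := crossE (proj a) (proj b).
  have := E (inord 0); have := E (inord 1); have := E (inord 2).
  rewrite x0 x1 x2 a0 a1 a2 => E2 E1 E0.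
  move: i j; apply: ord3P; apply: ord3P; lra.
have last (i : 'I_3) : proj x 0 i * height y - proj y 0 i * height x =
    nu * (proj a 0 i * height b - proj b 0 i * height a).
  rewrite ha hb hx hy !dotE.
  have m0 := minor i (inord 0); have m1 := minor i (inord 1).
  have m2 := minor i (inord 2).
  transitivity (g 0 (inord 0) * (proj x 0 i * proj y 0 (inord 0) - proj y 0 i * proj x 0 (inord 0)) +
    g 0 (inord 1) * (proj x 0 i * proj y 0 (inord 1) - proj y 0 i * proj x 0 (inord 1)) +
    g 0 (inord 2) * (proj x 0 i * proj y 0 (inord 2) - proj y 0 i * proj x 0 (inord 2))).
    by ring.
  by rewrite m0 m1 m2; ring.
apply/matrixP => i j; rewrite [RHS]mxE !wedgeE.
case: (unliftP ord_max i) => [i' ->|->]; case: (unliftP ord_max j) => [j' ->|->].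
- by rewrite -!proj_lift minor.
- by rewrite -!proj_lift last.
- by have := last j'; rewrite -!proj_lift /height => l; lra.
- by rewrite -/(height _); ring.
Qed.

Definition grad (f : R3 -> R^o) x : R3 := \row_i 'D_(delta_mx 0 i) f x.

Lemma derive_dot (f : R3 -> R^o) x v : differentiable f x ->
  'D_v f x = dot v (grad f x).
Proof.
move=> df; rewrite {1}(row_sum_delta v) deriveE// linear_sum sum3 dotE /=.
by rewrite !linearZ /= !mxE -!deriveE.
Qed.

Lemma near_eq_is_derive0 (V : normedModType R) (f g : R^o -> V) d d' :
  (\forall t \near (0 : R^o), f t = g t) ->
  is_derive (0 : R^o) 1 f d -> is_derive (0 : R^o) 1 g d' -> d = d'.
Proof.
move=> fg [_ <-] [_ <-]; exact: near_eq_derive.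
Qed.

Lemma is_derive_proj (c : R^o -> R4) (t : R^o) (v : R4) :
  is_derive t 1 c v -> is_derive t 1 (fun s => proj (c s)) (proj v).
Proof.
move=> dc; have dp : differentiable (@proj R) (c t).
  by apply: linear_differentiable; exact: proj_continuous.
have := is_derive_comp dp dc.
by rewrite deriveE// diff_lin//; exact: proj_continuous.
Qed.

(** Both local equations of the surface are differentiated along a curve with velocity [v]. *)
Lemma tangent_graph (F : set R4) (p v : R4) (l H : R3 -> R^o) : tangent F p v ->
  differentiable l (proj p) -> differentiable H (proj p) ->
  (\forall p' \near p, F p' -> l (proj p') = 0 /\ height p' = H (proj p')) ->
  dot (proj v) (grad l (proj p)) = 0 /\
  height v = dot (proj v) (grad H (proj p)).
Proof.
move=> [c [c0 Fc dc]] dl dH nF; rewrite -c0 in dl dH nF *.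
have cc := derivable_derive_continuous dc.
have dpc := is_derive_proj dc.
have near0 : \forall t \near (0 : R^o), l (proj (c t)) = 0 /\ height (c t) = H (proj (c t)).
  have := cc _ nF; rewrite !near_simpl /= => nFc.
  by apply: filterS2 Fc nFc => t h1 h2; exact: h2.
rewrite -!derive_dot//; split.
  have d1 := @is_derive_comp _ _ _ l (fun s => proj (c s)) 0 _ dl dpc.
  apply: (near_eq_is_derive0 _ d1 (is_derive_cst (0 : R^o) (0 : R^o) (1 : R^o))).
  by apply: filterS near0 => t [].
have d1 := @is_derive_comp _ _ _ H (fun s => proj (c s)) 0 _ dH dpc.
have d2 : is_derive (0 : R^o) 1 (fun t => height (c t) : R^o) (height v).
  exact: is_derive_coord.
by apply: (near_eq_is_derive0 _ d2 d1); apply: filterS near0 => t [].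
Qed.
End Space.

(** * The normal of a sheet *)

Section Normal.
Variables (R : realType) (D : diagram R).
Local Notation R3 := 'rV[R]_3.
Local Notation R4 := 'rV[R]_4.

Lemma normal_cross p a b : orient D p = wedge a b ->
  normal D p = cross (proj a) (proj b).
Proof.
move=> w; apply/rowP; have [c0 c1 c2] := crossE (proj a) (proj b).
by apply: ord3P; rewrite ?c0 ?c1 ?c2 [LHS]mxE inordK//= w wedgeE -!proj_coord//; ring.
Qed.

(** Tangent vectors project into the plane orthogonal to the gradient of [l] and are determined by
    their projections, so a zero normal would make the orientation bivector vanish. The last clause
    compares the orientation with tangent vectors obtained from any parametrization; it serves near
    branch points. *)
Lemma normal_graph p (l H : R3 -> R^o) : surf D p ->
  differentiable l (proj p) -> differentiable H (proj p) ->
  (\forall p' \near p, surf D p' -> l (proj p') = 0 /\ height p' = H (proj p')) ->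
  grad l (proj p) != 0 ->
  [/\ normal D p != 0,
      (exists2 la, la != 0 & normal D p = la *: grad l (proj p)) &
      forall x y, tangent (surf D) p x -> tangent (surf D) p y ->
        exists nu, wedge x y = nu *: orient D p].
Proof.
move=> Fp dl dH nF g0; have [_ /(_ p Fp)[w0 [a [b [ta tb w]]]]] := orientP D.
have [a1 a2] := tangent_graph ta dl dH nF.
have [b1 b2] := tangent_graph tb dl dH nF.
have nE := normal_cross w.
have n0 : normal D p != 0.
  apply/eqP => n0; apply: w0; rewrite w -[RHS](scale0r (wedge a b)).
  by apply: (wedge_graph a2 b2 a2 b2); rewrite -nE n0 scaler0.
have nn := dot_gt0 n0.
have orth := cross_orth a1 b1; rewrite -nE in orth.
have ng : dot (normal D p) (grad l (proj p)) != 0.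
  apply: contraNneq g0 => ng; move: orth; rewrite ng scale0r => /eqP.
  by rewrite scaler_eq0 gt_eqF.
split=> //.
  exists (dot (normal D p) (normal D p) / dot (normal D p) (grad l (proj p))).
    by rewrite mulf_neq0 ?invr_neq0// gt_eqF.
  by rewrite mulrC -scalerA orth scalerA mulVf// scale1r.
move=> x y tx ty.
have [x1 x2] := tangent_graph tx dl dH nF.
have [y1 y2] := tangent_graph ty dl dH nF.
have nl : normal D p = (dot (normal D p) (normal D p) / dot (normal D p) (grad l (proj p)))
    *: grad l (proj p).
  by rewrite mulrC -scalerA orth scalerA mulVf// scale1r.
set c := cross (proj x) (proj y).
have cn : dot c c *: normal D p = dot c (normal D p) *: c.
  by apply: cross_orth; rewrite nl dotZr ?x1 ?y1 mulr0.
have [c0|c0] := eqVneq c 0.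
  exists 0; rewrite w; apply: (wedge_graph a2 b2 x2 y2).
  by rewrite -/c c0 scale0r.
have cc := dot_gt0 c0.
have cn0 : dot c (normal D p) != 0.
  apply: contraNneq n0 => cn0; move: cn; rewrite cn0 scale0r => /eqP.
  by rewrite scaler_eq0 gt_eqF.
exists (dot c c / dot c (normal D p)); rewrite w.
apply: (wedge_graph a2 b2 x2 y2).
by rewrite -nE mulrC -scalerA cn scalerA mulVf// scale1r.
Qed.
End Normal.

(** * Regions, double curves and triple points in a chart of sheets *)

Lemma near_and (T : topologicalType) (t : T) (P Q : T -> Prop) :
  (\forall s \near t, P s) -> (\forall s \near t, Q s) ->
  \forall s \near t, P s /\ Q s.
Proof. exact: filterI. Qed.

Lemma near_fst (T U : topologicalType) (z : T * U) (P : T -> Prop) :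
  (\forall p \near z.1, P p) -> \forall q \near z, P q.1.
Proof. by move=> Pz; exists (P, setT) => [|q []//]; split=> //; exact: filterT. Qed.

Lemma near_snd (T U : topologicalType) (z : T * U) (P : U -> Prop) :
  (\forall p \near z.2, P p) -> \forall q \near z, P q.2.
Proof. by move=> Pz; exists (setT, P) => [|q []//]; split=> //; exact: filterT. Qed.

Section Diffeo.
Variable R : realType.
Local Notation R3 := 'rV[R]_3.
Implicit Types (U W : set R3) (f g : R3 -> R3).

Lemma diffeo_sym U W f g : diffeo U W f g -> diffeo W U g f.
Proof. by case=> oU oW [sf sg] fg gf; split. Qed.

Lemma diffeo_D U W f g x v : diffeo U W f g -> U x ->
  'D_('D_v f x) g (f x) = v.
Proof.
case=> oU oW [sf sg] fg gf Ux; have [Wfx gfx] := fg x Ux.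
have df := C1_differentiable oU (smooth_C1 sf) Ux.
have dg := C1_differentiable oW (smooth_C1 sg) Wfx.
have d1 : is_derive (0 : R^o) 1 (fun t : R^o => f (x + t *: v)) ('D_v f x).
  have := @is_derive_ray R _ _ f x v 0; rewrite scale0r addr0; apply.
  exact: diff_derivable.
have d2 : is_derive (0 : R^o) 1 (fun t : R^o => x + t *: v) v.
  have := @is_derive_ray R _ _ id x v 0; rewrite scale0r addr0 derive_id; apply.
  exact: derivable_id.
have dg0 : differentiable g ((fun t : R^o => f (x + t *: v)) 0).
  by rewrite scale0r addr0.
have d3 := is_derive_comp dg0 d1; rewrite scale0r addr0 in d3.
have c2 := derivable_derive_continuous d2.
apply: near_eq_is_derive0 d3 d2.
have : \forall t \near (0 : R^o), U (x + t *: v).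
  apply: c2; rewrite scale0r addr0; exact: open_nbhs_nbhs.
by apply: filterS => t /fg[].
Qed.

Definition coordinate (f : R3 -> R3) i : R3 -> R^o := fun x => f x 0 (inord i).
Definition axis (g : R3 -> R3) i z : R3 := 'D_(delta_mx 0 (inord i)) g z.

Lemma derive_comp U W f g i x v : diffeo U W f g -> U x ->
  differentiable (coordinate f i) x /\ dot v (grad (coordinate f i) x) = 'D_v f x 0 (inord i).
Proof.
case=> oU oW [sf sg] fg gf Ux.
have df := C1_differentiable_scalar oU (C1_coord (inord i) oU (smooth_C1 sf)) Ux.
split=> //; rewrite -derive_dot//.
have [_ dfx _] := smooth_C1 sf.
by have [_ <-] := derive_coord (inord i) (dfx x v Ux).
Qed.

(** By the chain rule, the coordinate velocities of the inverse chart and the gradients of the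
    coordinates are dual bases. *)
Lemma dot_axis U W f g i j x : diffeo U W f g -> U x -> (i < 3)%N -> (j < 3)%N ->
  dot (axis g j (f x)) (grad (coordinate f i) x) = (i == j)%:R.
Proof.
move=> d Ux i3 j3; have [_ ->] := derive_comp i (axis g j (f x)) d Ux.
have [_ _ _ fg _] := d; have [Wfx gfx] := fg x Ux.
have := diffeo_D (delta_mx 0 (inord j)) (diffeo_sym d) Wfx.
rewrite gfx -/(axis g j (f x)) => ->; rewrite mxE eqxx /=.
by rewrite -val_eqE /= !inordK.
Qed.
End Diffeo.

(** * Recognizing the region next to a point *)

Section Regions.
Variables (R : realType) (D : diagram R).
Local Notation R3 := 'rV[R]_3.
Local Notation R4 := 'rV[R]_4.

Lemma region_eq (r r' : set R3) x : region D r -> region D r' -> r x -> r' x ->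
  r = r'.
Proof.
move=> [a Ca ->] [b Cb ->] /same_connected_component -> .
by move=> /same_connected_component ->.
Qed.

(** [local_region] is a choice by [xget]. The direction [v0] makes it unique: two candidates both
    contain the points close to [x] on the ray along [v0], and regions that share a point are
    equal. *)
Lemma local_regionE x (N : seq R3) r v0 : region D r ->
  all (fun nu => 0 < dot v0 nu) N ->
  (forall v, all (fun nu => 0 < dot v nu) N ->
     \forall t \near 0^'+, r (x + t *: v)) ->
  local_region D x N = r.
Proof.
move=> rr v0N Hr; apply: xget_unique => // r' [rr' Hr'].
have [t [rt r't]] := filter_ex (filterI (Hr v0 v0N) (Hr' v0 v0N)).
exact: region_eq rr' rr r't rt.
Qed.

(** The image of a segment from [z0] is connected and avoids the projection, so a star-shaped set of
    the chart stays in one component. *)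
Lemma star_region (S W : set R3) (psi : R3 -> R3) z0 :
  (forall z, W z -> {for z, continuous psi}) -> S `<=` W -> S z0 ->
  (forall z t, S z -> 0 <= t <= 1 -> S (z0 + t *: (z - z0))) ->
  (forall z, S z -> complement D (psi z)) ->
  region D (connected_component (complement D) (psi z0)) /\
  psi @` S `<=` connected_component (complement D) (psi z0).
Proof.
move=> cpsi SW Sz0 star SC; split; first by exists (psi z0) => //; exact: SC.
move=> _ [z Sz <-]; pose c (t : R) := psi (z0 + t *: (z - z0)).
pose B := c @` `[0, 1]%classic.
have cB : connected B.
  apply: connected_continuous_connected; first exact: segment_connected.
  apply: continuous_in_subspaceT => t; rewrite inE /= in_itv /= => t01.
  apply: (@continuous_comp _ _ _ (fun t : R => z0 + t *: (z - z0)) psi).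
    apply: cvgD; first exact: cvg_cst.
    exact: scalel_continuous.
  exact/cpsi/SW/star.
have BC : B `<=` complement D.
  by move=> _ [t t01 <-]; apply/SC/star => //; move: t01; rewrite /= in_itv.
have B0 : B (psi z0).
  by exists 0; rewrite /= ?in_itv /= ?lexx ?ler01// /c scale0r addr0.
apply: (connected_component_max B0 BC cB).
by exists 1; rewrite /= ?in_itv /= ?lexx ?ler01// /c scale1r addrC subrK.
Qed.
End Regions.

Lemma norm_rV_lt (R : realType) n (z : 'rV[R]_n) e : 0 < e ->
  (`|z| < e) = [forall j, `|z 0 j| < e].
Proof.
move=> e0; apply/idP/forallP => [ze j|H].
  apply: le_lt_trans ze; rewrite [leRHS]/Num.Def.normr/= mx_normrE.
  exact: (le_bigmax _ _ (0, j)).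
rewrite [ltLHS]/Num.Def.normr/= mx_normrE; apply: bigmax_lt => // -[i j] _ /=.
by rewrite (ord1 i).
Qed.

Section Limits.
Variables (R : realType) (D : diagram R).
Local Notation R3 := 'rV[R]_3.
Local Notation R4 := 'rV[R]_4.

Lemma cvg_coord (T : Type) (G : set_system T) (FG : Filter G) n
    (u : T -> 'rV[R]_n) (a : 'rV[R]_n) j : u @ G --> a -> (fun t => u t 0 j) @ G --> a 0 j.
Proof.
move=> ua; apply: (@cvg_comp _ _ _ u (fun y : 'rV[R]_n => y 0 j) _ _ _ ua).
exact: coord_continuous.
Qed.

Lemma cvg_dot (T : Type) (G : set_system T) (FG : Filter G) (u v : T -> R3) (a b : R3) :
  u @ G --> a -> v @ G --> b -> (fun t => dot (u t) (v t)) @ G --> dot a b.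
Proof.
move=> ua vb; rewrite [X in X @ _](_ : _ = fun t =>
  u t 0 (inord 0) * v t 0 (inord 0) + u t 0 (inord 1) * v t 0 (inord 1) +
  u t 0 (inord 2) * v t 0 (inord 2)); last by apply/funext => t; rewrite dotE.
rewrite dotE; apply: cvgD; last by apply: cvgM; exact: cvg_coord.
by apply: cvgD; apply: cvgM; exact: cvg_coord.
Qed.

Lemma orient_within p i j : surf D p ->
  (fun q => orient D q i j) @ within (surf D) (nbhs p) --> orient D p i j.
Proof.
move=> Fp; have [cw _] := orientP D.
have H : orient D @ within (surf D) (nbhs p) --> orient D p.
  by rewrite nbhs_subspace_in//; exact: cw.
apply: (@cvg_comp _ _ _ (orient D) (fun y : 'M[R]_4 => y i j) _ _ _ H).
exact: coord_continuous.
Qed.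

Lemma cvg_row (T : Type) (G : set_system T) (FG : Filter G) n
    (u : T -> 'rV[R]_n) (a : 'rV[R]_n) :
  (forall j, (fun t => u t 0 j) @ G --> a 0 j) -> u @ G --> a.
Proof.
move=> uj; apply/cvgrPdist_lt => e e0; near=> t.
rewrite norm_rV_lt//; apply/forallP => j; rewrite !mxE.
move: j; near: t; apply: filter_forall => j.
by have /cvgrPdist_lt /(_ e e0) := uj j.
Unshelve. all: by end_near. Qed.

Lemma normal_within p : surf D p ->
  normal D @ within (surf D) (nbhs p) --> normal D p.
Proof.
move=> Fp; apply: cvg_row; apply: ord3P; rewrite [normal D p _ _]mxE inordK//=.
- rewrite [X in X @ _](_ : _ = fun q => orient D q (inord 1) (inord 2)).
    exact: orient_within.
  by apply/funext => q; rewrite mxE inordK.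
- rewrite [X in X @ _](_ : _ = fun q => orient D q (inord 2) (inord 0)).
    exact: orient_within.
  by apply/funext => q; rewrite mxE inordK.
- rewrite [X in X @ _](_ : _ = fun q => orient D q (inord 0) (inord 1)).
    exact: orient_within.
  by apply/funext => q; rewrite mxE inordK.
Qed.

Lemma cvg_triple (T : Type) (G : set_system T) (FG : Filter G)
    (u v w : T -> R3) (a b c : R3) :
  u @ G --> a -> v @ G --> b -> w @ G --> c ->
  (fun t => triple (u t) (v t) (w t)) @ G --> triple a b c.
Proof.
move=> ua vb wc; rewrite [X in X @ _](_ : _ = fun t =>
  (u t 0 (inord 1) * v t 0 (inord 2) - u t 0 (inord 2) * v t 0 (inord 1)) * w t 0 (inord 0) +
  (u t 0 (inord 2) * v t 0 (inord 0) - u t 0 (inord 0) * v t 0 (inord 2)) * w t 0 (inord 1) +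
  (u t 0 (inord 0) * v t 0 (inord 1) - u t 0 (inord 1) * v t 0 (inord 0)) * w t 0 (inord 2));
  last by apply/funext => t; rewrite tripleE.
rewrite tripleE; do 2?[apply: cvgD]; apply: cvgM; try exact: cvg_coord.
all: by apply: cvgB; apply: cvgM; exact: cvg_coord.
Qed.

End Limits.

Lemma triple_mul_diag (R : realType) (a b c u v w : 'rV[R]_3) la lb :
  dot a u = la -> dot a v = 0 -> dot a w = 0 ->
  dot b u = 0 -> dot b v = lb -> dot b w = 0 ->
  triple a b c * triple u v w = la * lb * dot c w.
Proof. by move=> au av aw bu bv bw; rewrite triple_mul au av aw bu bv bw; ring. Qed.

Lemma is_derive_triple (R : realType) (c : R^o -> 'rV[R]_3) (t : R^o) (a b v : 'rV[R]_3) :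
  is_derive t 1 c v ->
  is_derive t 1 (fun s => triple a b (c s) : R^o) (triple a b v).
Proof.
move=> dc; have d k := is_derive_coord (inord k) dc.
have dE (u : 'rV[R]_3) : triple a b u = cross a b 0 (inord 0) *: (u 0 (inord 0) : R^o) +
    cross a b 0 (inord 1) *: (u 0 (inord 1) : R^o) +
    cross a b 0 (inord 2) *: (u 0 (inord 2) : R^o) by rewrite /triple dotE.
rewrite dE; under [X in is_derive _ _ X _]eq_fun do rewrite dE.
have z k := @is_deriveZ _ _ _ _ (cross a b 0 (inord k)) _ _ _ (d k).
exact: (@is_deriveD _ _ _ _ _ _ _ _ _
  (@is_deriveD _ _ _ _ _ _ _ _ _ (z 0%N) (z 1%N)) (z 2%N)).
Qed.

Lemma mulss_gt0 (R : realDomainType) (x : R) : x != 0 -> 0 < x * x.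
Proof. by move=> x0; rewrite lt_neqAle eq_sym mulf_neq0//= -expr2 sqr_ge0. Qed.

(** The product of all five hypotheses is [e * x] times squares. *)
Lemma sign_transfer (R : realFieldType) (e x f f' a a' b b' : R) :
  0 < x * f' * (a' * b') -> 0 < e * (a * b * f) -> 0 < f * f' ->
  0 < a * a' -> 0 < b * b' -> 0 < e * x.
Proof.
move=> h1 h2 hf ha hb; have := mulr_gt0 (mulr_gt0 h1 h2) (mulr_gt0 (mulr_gt0 hf ha) hb).
have p : 0 < (f * f') ^+ 2 * (a * a') ^+ 2 * (b * b') ^+ 2.
  by apply: mulr_gt0; [apply: mulr_gt0|]; rewrite exprn_gt0.
have -> : x * f' * (a' * b') * (e * (a * b * f)) * (f * f' * (a * a') * (b * b')) =
    (e * x) * ((f * f') ^+ 2 * (a * a') ^+ 2 * (b * b') ^+ 2) by ring.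
by rewrite pmulr_lgt0.
Qed.

(** By the equation, [x] has the sign of [a * b * f] times that of [c], and [e] has the sign of
    [a * b * f]. In the application [x] is a determinant of normals, [f] one of chart axes, and [a],
    [b], [c] are the factors between them. *)
Lemma sign_triple (R : realFieldType) (e x f a b c : R) :
  x * f = a * b * c -> 0 < e * (a * b * f) -> c != 0 ->
  0 < (if 0 < x then 1 else -1) * c * e.
Proof.
move=> xf p c0; have q : 0 < e * c * x.
  have sq : 0 < (f * (a * b)) ^+ 2.
    rewrite lt_neqAle eq_sym sqrf_eq0 sqr_ge0 andbT; apply: contraTneq p => ab.
    by rewrite (mulrC (a * b)) ab mulr0 ltxx.
  have E : e * c * x * (f * (a * b)) ^+ 2 = (c * (a * b)) ^+ 2 * (e * (a * b * f)).
    transitivity (e * c * (x * f) * f * (a * b) ^+ 2); first by ring.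
    by rewrite xf; ring.
  rewrite -(pmulr_lgt0 _ sq) E mulr_gt0// lt_neqAle eq_sym sqrf_eq0 sqr_ge0 andbT.
  by rewrite mulf_neq0//; apply: contraTneq p => ->; rewrite mul0r mulr0 ltxx.
have [x0|x0] := ltP 0 x; first by rewrite mul1r mulrC -(pmulr_lgt0 _ x0).
have {}x0 : x < 0 by rewrite lt_neqAle x0 andbT; apply: contraTneq q => ->; rewrite mulr0 ltxx.
by rewrite !mulNr mul1r oppr_gt0 mulrC -(nmulr_lgt0 _ x0).
Qed.

HB.instance Definition _ (T U : ptopologicalType) := Pointed.on (T * U)%type.

(** * The oriented curve of crossings *)

Section Crossings.
Variables (R : realType) (D : diagram R).
Local Notation R4 := 'rV[R]_4.

(** Unlike in [double_points], the fibre may contain a third point, so that this curve runs through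
    the triple points. *)
Definition crossings : set (R4 * R4) :=
  [set q | [/\ surf D q.1, surf D q.2, proj q.1 = proj q.2 & height q.2 < height q.1]].

(** The cross product of the two normals is tangent to the projected double curve and directs it;
    the value tells to first order whether [q'] lies ahead of [q] or behind it. *)
Definition side (q q' : R4 * R4) : R :=
  triple (normal D q.1) (normal D q.2) (proj q'.1 - proj q.1).
End Crossings.

Section Sheets.
Variables (R : realType) (D : diagram R).
Local Notation R3 := 'rV[R]_3.
Local Notation R4 := 'rV[R]_4.
Variables (m : nat) (U W : set R3) (phi psi : R3 -> R3) (h : nat -> R3 -> R^o).
Hypotheses (m3 : (m <= 3)%N) (dif : diffeo U W phi psi).
Hypothesis hs : forall i, (i < m)%N -> smooth_on U (h i).
Hypothesis hd : forall i j x, (i < m)%N -> (j < m)%N -> i <> j -> U x ->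
  phi x 0 (inord i) = 0 -> phi x 0 (inord j) = 0 -> h i x <> h j x.
Hypothesis hF : forall p, U (proj p) -> surf D p <->
  exists2 i, (i < m)%N & phi (proj p) 0 (inord i) = 0 /\ height p = h i (proj p).

Definition sheet i z : R4 := lift4 (psi z) (h i (psi z)).

Lemma chart_in z : W z -> U (psi z) /\ phi (psi z) = z.
Proof. by have [_ _ _ _ H] := dif; exact: H. Qed.

Lemma chart_out x : U x -> W (phi x) /\ psi (phi x) = x.
Proof. by have [_ _ _ H _] := dif; exact: H. Qed.

Lemma sheet_surf i z : W z -> (i < m)%N -> z 0 (inord i) = 0 -> surf D (sheet i z).
Proof.
move=> Wz im zi; have [Uz pz] := chart_in Wz.
apply/hF; rewrite /sheet proj_lift4 ?height_lift4//.
by exists i => //; rewrite pz.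
Qed.

Lemma surf_sheet p : U (proj p) -> surf D p ->
  exists i, [/\ (i < m)%N, phi (proj p) 0 (inord i) = 0 & p = sheet i (phi (proj p))].
Proof.
move=> Up /(hF Up)[i im [h1 h2]]; exists i; split=> //.
by rewrite /sheet (chart_out Up).2 -h2 lift4K.
Qed.

Lemma fibre_sheet z p : W z ->
  fibre D (psi z) p <-> exists i, [/\ (i < m)%N, z 0 (inord i) = 0 & p = sheet i z].
Proof.
move=> Wz; have [Uz pz] := chart_in Wz; split=> [[Fp /= pp]|[i [im zi ->]]].
  have Up : U (proj p) by rewrite pp.
  by have := surf_sheet Up Fp; rewrite pp pz.
by split; [exact: sheet_surf|rewrite /= /sheet proj_lift4].
Qed.

Lemma h_continuous i x : (i < m)%N -> U x -> {for x, continuous (h i)}.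
Proof. by move=> im Ux; have [c _ _] := smooth_C1 (hs im); exact: c. Qed.

Lemma phi_continuous x : U x -> {for x, continuous phi}.
Proof. by move=> Ux; have [_ _ [/smooth_C1[c _ _] _] _ _] := dif; exact: c. Qed.

Lemma psi_continuous z : W z -> {for z, continuous psi}.
Proof. by move=> Wz; have [_ _ [_ /smooth_C1[c _ _]] _ _] := dif; exact: c. Qed.

Lemma sheet_continuous i z : (i < m)%N -> W z -> {for z, continuous (sheet i)}.
Proof.
move=> im Wz; have [Uz _] := chart_in Wz.
apply: lift4_continuous; first exact: psi_continuous.
by apply: (@continuous_comp _ _ _ psi (h i)); [exact: psi_continuous|exact: h_continuous].
Qed.

Lemma near_U p : U (proj p) -> \forall p' \near p, U (proj p').
Proof.
by move=> Up; have [oU _ _ _ _] := dif; apply: proj_continuous; exact: open_nbhs_nbhs.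
Qed.

Lemma near_W z : W z -> \forall z' \near z, W z'.
Proof. by move=> Wz; have [_ oW _ _ _] := dif; exact: open_nbhs_nbhs. Qed.

(** Every other sheet stays away from [p]: either its coordinate is nonzero at the projection of
    [p], or its height there is different, and both conditions are open. *)
Lemma sheet_local p i : (i < m)%N -> U (proj p) ->
  phi (proj p) 0 (inord i) = 0 -> height p = h i (proj p) ->
  \forall p' \near p, surf D p' ->
    phi (proj p') 0 (inord i) = 0 /\ height p' = h i (proj p').
Proof.
move=> im Up pi hi.
have other (j : 'I_m) : \forall p' \near p, val j <> i ->
    ~ (phi (proj p') 0 (inord j) = 0 /\ height p' = h j (proj p')).
  case: (eqVneq (val j) i) => [ji|ji]; first by apply: (@filterE _ (nbhs p)) => p' [].
  have cphi : {for p, continuous (fun p' => phi (proj p') 0 (inord j))}.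
    apply: (@continuous_comp _ _ _ (phi \o @proj R) (fun x : R3 => x 0 (inord j))).
      by apply: continuous_comp; [exact: proj_continuous|exact: phi_continuous].
    exact: coord_continuous.
  have cdh : {for p, continuous (fun p' => height p' - h j (proj p'))}.
    have ch : (fun p' => h j (proj p')) @ p --> h j (proj p).
      by apply: (@continuous_comp _ _ _ (@proj R) (h j)); [exact: proj_continuous|exact: h_continuous].
    exact: cvgB (@height_continuous R p) ch.
  have [pj|pj] := eqVneq (phi (proj p) 0 (inord j)) 0.
    have hij : height p - h j (proj p) != 0.
      by rewrite subr_eq0 hi; apply/eqP/hd => //; apply/eqP; rewrite eq_sym.
    have : \forall p' \near p, height p' - h j (proj p') != 0 by exact: (cvgr_neq0 _ cdh hij).
    by apply: filterS => p' /eqP hp _ [_ hj]; apply: hp; rewrite hj subrr.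
  have : \forall p' \near p, phi (proj p') 0 (inord j) != 0 by exact: (cvgr_neq0 _ cphi pj).
  by apply: filterS => p' /eqP hp _ [hj _]; exact: hp.
have others : \forall p' \near p, forall j : 'I_m, val j <> i ->
    ~ (phi (proj p') 0 (inord j) = 0 /\ height p' = h j (proj p')).
  exact: filter_forall other.
apply: filterS2 (near_U Up) others => p' Up' H /(hF Up')[j jm Hj].
have := H (Ordinal jm) => /= Hji; have [<-//|/eqP/Hji/(_ Hj)//] := eqVneq j i.
Qed.

(** On the plane z_i = 0, the normal of the i-th sheet is this multiple of the gradient of the i-th
    coordinate; its sign compares the co-orientation with the chart. *)
Definition lam i z := dot (axis psi i z) (normal D (sheet i z)).

Lemma normal_sheet i z : (i < m)%N -> W z -> z 0 (inord i) = 0 ->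
  [/\ lam i z != 0, normal D (sheet i z) != 0,
      (forall v, dot v (normal D (sheet i z)) = lam i z * 'D_v phi (psi z) 0 (inord i)) &
      (forall x y, tangent (surf D) (sheet i z) x -> tangent (surf D) (sheet i z) y ->
        exists nu, wedge x y = nu *: orient D (sheet i z))].
Proof.
move=> im Wz zi; have [Uz pz] := chart_in Wz; have [oU _ _ _ _] := dif.
set p := sheet i z; have pp : proj p = psi z by rewrite proj_lift4.
have [dl _] := derive_comp i 0 dif Uz; rewrite -pp in dl.
have dh : differentiable (h i) (proj p).
  by apply: C1_differentiable_scalar oU (smooth_C1 (hs im)) _; rewrite pp.
have i3 : (i < 3)%N by exact: leq_trans m3.
have da := dot_axis dif Uz i3 i3; rewrite pz eqxx in da.
have g0 : grad (coordinate phi i) (proj p) != 0.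
  rewrite pp; apply/eqP => g0; move: da; rewrite g0 dotC dot0l => /eqP.
  by rewrite eq_sym oner_eq0.
have sl : \forall p' \near p, surf D p' -> coordinate phi i (proj p') = 0 /\ height p' = h i (proj p').
  by apply: sheet_local => //; rewrite ?pp ?pz// /p height_lift4.
have [n0 [la la0 nE] tg] := normal_graph (sheet_surf Wz im zi) dl dh sl g0.
have laE : lam i z = la by rewrite /lam -/p nE dotZr pp da mulr1.
split=> //; first by rewrite laE.
move=> v; rewrite laE -/p nE dotZr pp; congr (_ * _).
by have [_ ->] := derive_comp i v dif Uz.
Qed.

Lemma sheet_within i z0 : (i < m)%N -> W z0 -> z0 0 (inord i) = 0 ->
  sheet i @ within (fun z : R3 => z 0 (inord i) = 0) (nbhs z0) -->
  within (surf D) (nbhs (sheet i z0)).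
Proof.
move=> im Wz zi B HB.
have : \forall z \near z0, surf D (sheet i z) -> B (sheet i z).
  exact: (sheet_continuous im Wz HB).
rewrite /fmap /= /within; apply: filterS2 (near_W Wz) => z Wz' H zi'.
by apply: H; exact: sheet_surf.
Qed.

Lemma normal_sheet_cvg i z0 : (i < m)%N -> W z0 -> z0 0 (inord i) = 0 ->
  (fun z => normal D (sheet i z)) @ within (fun z : R3 => z 0 (inord i) = 0) (nbhs z0)
    --> normal D (sheet i z0).
Proof.
move=> im Wz zi; apply: (@cvg_comp _ _ _ (sheet i) (normal D) _ _ _ (sheet_within im Wz zi)).
exact: normal_within (sheet_surf Wz im zi).
Qed.

Lemma axis_cvg i z0 : W z0 -> axis psi i @ z0 --> axis psi i z0.
Proof. by move=> Wz; have [_ _ [_ /smooth_C1[_ _ c]] _ _] := dif; exact: c. Qed.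

(** The orientation is continuous within the surface only, so signs are compared along the
    coordinate plane of the sheet. *)
Lemma lam_near i z0 : (i < m)%N -> W z0 -> z0 0 (inord i) = 0 ->
  \forall z \near z0, (z : R3) 0 (inord i) = 0 -> 0 < lam i z0 * lam i z.
Proof.
move=> im Wz zi; pose G := within (fun z : R3 => z 0 (inord i) = 0) (nbhs z0).
have FG : Filter G by exact: within_filter.
have c1 : axis psi i @ G --> axis psi i z0.
  by apply: cvg_trans (axis_cvg Wz); apply: cvg_app; exact: cvg_within.
have c2 := cvg_dot FG c1 (normal_sheet_cvg im Wz zi).
have [l0 _ _ _] := normal_sheet im Wz zi.
have c3 : (fun z => lam i z0 * lam i z) @ G --> lam i z0 * lam i z0.
  by apply: cvgMl_tmp; exact: c2.
have ll : 0 < lam i z0 * lam i z0 by rewrite -expr2 lt_neqAle eq_sym sqrf_eq0 l0 sqr_ge0.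
exact: (cvgr_gt _ c3 _ ll).
Qed.

Lemma good_radius : W 0 -> exists rho : R, 0 < rho /\ forall z : R3, `|z| < rho ->
  W z /\ forall i, (i < m)%N -> z 0 (inord i) = 0 -> 0 < lam i 0 * lam i z.
Proof.
move=> W0.
have near_lam (i : 'I_m) : \forall z \near (0 : R3), (z : R3) 0 (inord i) = 0 ->
    0 < lam i 0 * lam i z.
  by apply: lam_near; rewrite ?mxE.
have near_lams : \forall z \near (0 : R3), forall i : 'I_m,
    (z : R3) 0 (inord i) = 0 -> 0 < lam i 0 * lam i z.
  exact: filter_forall near_lam.
have /nbhs_ballP[e /= e0 He] := near_and (near_W W0) near_lams.
exists e; split=> // z ze.
have [Wz Hz] : W z /\ forall i : 'I_m, z 0 (inord i) = 0 -> 0 < lam i 0 * lam i z.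
  by apply: He; rewrite -ball_normE /= sub0r normrN.
by split=> // i im; exact: (Hz (Ordinal im)).
Qed.

(** * Octants of a chart of sheets and their regions *)

Section Octants.
Variable rho : R.
Hypothesis rho0 : 0 < rho.
Hypothesis rhoP : forall z : R3, `|z| < rho ->
  W z /\ forall i, (i < m)%N -> z 0 (inord i) = 0 -> 0 < lam i 0 * lam i z.
Implicit Type s : nat -> R.

(** The sign [s i] is relative to the co-orientation, hence the factor [lam i 0]; coordinates of
    index at least [m] are free. *)
Definition octant s : set R3 :=
  [set z : R3 | `|z| < rho /\ forall i, (i < m)%N -> 0 < s i * lam i 0 * z 0 (inord i)].

Definition corner s : R3 := \row_(j < 3) (rho / 2 * Num.sg (s j * lam j 0)).

Definition octant_region s : set R3 :=
  connected_component (complement D) (psi (corner s)).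

Lemma lam0_neq0 i : (i < m)%N -> lam i 0 != 0.
Proof.
move=> im; have [_ /(_ i im)] := rhoP (z := 0) ltac:(by rewrite normr0).
by rewrite mxE => /(_ erefl); apply: contraTneq => ->; rewrite mul0r ltxx.
Qed.

Lemma corner_octant s : (forall i, (i < m)%N -> s i != 0) -> octant s (corner s).
Proof.
move=> s0; have r2 : 0 < rho / 2 by rewrite divr_gt0.
split.
  rewrite norm_rV_lt//; apply/forallP => j; rewrite mxE normrM gtr0_norm//.
  have sg1 : `|Num.sg (s j * lam j 0)| <= 1.
    by rewrite normr_sg; case: (_ == 0); rewrite /= ?ler01.
  rewrite (le_lt_trans (y := rho / 2))//; first by apply: ler_piMr => //; exact: ltW.
  by rewrite ltr_pdivrMr// ltr_pMr// ltr1n.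
move=> i im; rewrite mxE mulrCA mulr_gt0// inordK ?(leq_trans im)// mulrC -normrEsg.
by rewrite normr_gt0 mulf_neq0 ?s0 ?lam0_neq0.
Qed.

Lemma octant_regionP s : (forall i, (i < m)%N -> s i != 0) ->
  region D (octant_region s) /\ psi @` octant s `<=` octant_region s.
Proof.
move=> s0; have [c1 c2] := corner_octant s0.
apply: (@star_region _ D (octant s) W psi (corner s)).
- exact: psi_continuous.
- by move=> z [/rhoP[]].
- by split.
- move=> z t [z1 z2] /andP[t0 t1].
  have E j : (corner s + t *: (z - corner s)) 0 j = (1 - t) * corner s 0 j + t * z 0 j.
    by rewrite !mxE; ring.
  have t1' : 0 <= 1 - t by rewrite subr_ge0.
  split=> [|i im].
    move: c1 z1; rewrite !norm_rV_lt// => /forallP c1 /forallP z1.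
    apply/forallP => j; rewrite E (le_lt_trans (ler_normD _ _))// !normrM.
    rewrite (ger0_norm t0) (ger0_norm t1').
    have [->|tn] := eqVneq t 0; first by rewrite subr0 mul1r mul0r addr0.
    rewrite [ltRHS](_ : _ = (1 - t) * rho + t * rho); last by ring.
    by rewrite ler_ltD ?ler_wpM2l ?(ltW (c1 _))// ltr_pM2l// lt_neqAle eq_sym tn.
  rewrite E mulrDr mulrCA [X in _ + X]mulrCA.
  have [->|tn] := eqVneq t 0; first by rewrite subr0 mul1r mul0r addr0 c2.
  have tp : 0 < t by rewrite lt_neqAle eq_sym tn.
  have h1 := mulr_ge0 t1' (ltW (c2 i im)); have h2 := mulr_gt0 tp (z2 i im).
  by rewrite ltr_wpDl.
- move=> z [/rhoP[Wz _] z2] [p Fp pz].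
  have : fibre D (psi z) p by split.
  by move=> /(fibre_sheet _ Wz)[i [im zi _]]; have := z2 i im; rewrite zi mulr0 ltxx.
Qed.

(* Along the i-th sheet, a i *: normal points into the chosen octant when a i and
   s i have the same sign. *)
Lemma local_region_octant (z : R3) (S : seq nat) s (a : nat -> R) : `|z| < rho ->
  (forall i, (i \in S) = (i < m)%N && (z 0 (inord i) == 0)) ->
  (forall i, (i < m)%N -> s i != 0) ->
  (forall i, i \in S -> 0 < a i * s i) ->
  (forall i, (i < m)%N -> i \notin S -> 0 < s i * lam i 0 * z 0 (inord i)) ->
  local_region D (psi z) [seq a i *: normal D (sheet i z) | i <- S] = octant_region s.
Proof.
move=> zr HS s0 as0 zs; have [Wz lz] := rhoP zr; have [Uz pz] := chart_in Wz.
have [reg sub] := octant_regionP s0.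
have inS i : i \in S -> (i < m)%N /\ z 0 (inord i) = 0.
  by rewrite HS => /andP[im /eqP zi].
(* The direction with these coordinate velocities pairs with [a i] times the i-th normal to the
   square of [a i * lam i z], so it is admissible. *)
pose zeta : R3 := \row_j (a j * lam j z).
apply: (local_regionE (v0 := 'D_zeta psi z)) => //.
  apply/allP => _ /mapP[i iS ->]; have [im zi] := inS i iS.
  have [l0 _ dn _] := normal_sheet im Wz zi.
  rewrite dotZr dn; have := diffeo_D zeta (diffeo_sym dif) Wz; rewrite ?pz => ->.
  rewrite mxE inordK ?(leq_trans im)// mulrA -expr2 lt_neqAle sqr_ge0 andbT eq_sym.
  rewrite sqrf_eq0 mulf_neq0//; apply: contraTneq (as0 i iS) => ->.
  by rewrite mul0r ltxx.
move=> v vN; set x := psi z; pose c (t : R^o) := phi (x + t *: v).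
have c0 : c 0 = z by rewrite /c scale0r addr0.
have ray : {for (0 : R^o), continuous (fun t : R^o => x + t *: v)}.
  by apply: (@cvgD _ R3 _ _ _ (cst x)); [exact: cvg_cst|exact: scalel_continuous].
have nU : \forall t \near (0 : R^o), U (x + t *: v).
  by apply: ray; rewrite scale0r addr0; have [oU _ _ _ _] := dif; exact: open_nbhs_nbhs.
have cc : {for (0 : R^o), continuous c}.
  apply: (@continuous_comp _ _ _ (fun t : R^o => x + t *: v) phi) => //.
  by rewrite scale0r addr0; exact: phi_continuous.
have nr : \forall t \near (0 : R^o), `|c t| < rho.
  have : \forall w \near (c 0 : R3), `|w| < rho.
    rewrite c0; apply/nbhs_ballP; exists (rho - `|z|); first by rewrite /= subr_gt0.
    move=> w; rewrite -ball_normE /= => zw.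
    rewrite -(subrK z w) (le_lt_trans (ler_normD _ _))// -ltrBrDr distrC.
    exact: zw.
  exact: cc.
have dc i : is_derive (0 : R^o) 1 (fun t : R^o => c t 0 (inord i) : R^o) ('D_v phi x 0 (inord i)).
  apply: is_derive_coord; have := @is_derive_ray R _ _ phi x v 0.
  rewrite scale0r addr0; apply.
  by have [_ _ [/smooth_C1[_ d _] _] _ _] := dif; exact: d.
have ns (i : 'I_m) : \forall t \near (0 : R^o), 0 < t -> 0 < s i * lam i 0 * c t 0 (inord i).
  (* Sheets that miss the point keep their sign by continuity; for those through it, the sign is
     that of the derivative along [v], which the condition on [v] prescribes. *)
  have [iS|iS] := boolP (val i \in S); last first.
    have ci : (fun t => s i * lam i 0 * c t 0 (inord i)) @ (0 : R^o) --> s i * lam i 0 * z 0 (inord i).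
      by apply: cvgMl_tmp; rewrite -c0; exact: cvg_coord cc.
    have H : \forall t \near (0 : R^o), 0 < s i * lam i 0 * c t 0 (inord i).
      exact: (cvgr_gt _ ci _ (zs i (ltn_ord i) iS)).
    by apply: filterS H.
  have [im zi] := inS i iS; have [l0 _ dn _] := normal_sheet im Wz zi.
  have pos := allP vN _ (map_f (fun i => a i *: normal D (sheet i z)) iS).
  rewrite /= dotZr dn in pos.
  have dpos : 0 < s i * lam i 0 * 'D_v phi x 0 (inord i).
    have p1 := lz i im zi; have p2 := as0 i iS.
    have p3 : 0 < (a i * lam i z) ^+ 2.
      rewrite lt_neqAle eq_sym sqrf_eq0 sqr_ge0 andbT; apply: contraTneq pos.
      by rewrite mulrA => ->; rewrite mul0r ltxx.
    rewrite -(pmulr_rgt0 _ p3) [ltRHS](_ : _ = (a i * (lam i z * 'D_v phi x 0 (inord i))) * (a i * s i) * (lam i 0 * lam i z)).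
      by rewrite mulr_gt0// mulr_gt0.
    by ring.
  have dg : is_derive (0 : R^o) 1 (fun t : R^o => s i * lam i 0 * c t 0 (inord i) : R^o)
      (s i * lam i 0 * 'D_v phi x 0 (inord i)).
    exact: (@is_deriveZ _ _ _ _ (s i * lam i 0) _ _ _ (dc i)).
  have := is_derive_pos dg dpos; apply: filterS => t [+ _] t0.
  by move=> /(_ t0); rewrite c0 zi mulr0.
have nsa : \forall t \near (0 : R^o), forall i : 'I_m, 0 < t -> 0 < s i * lam i 0 * c t 0 (inord i).
  exact: filter_forall ns.
rewrite near_withinE; near=> t => /= t0; apply: sub; exists (c t); last first.
  by rewrite /c (chart_out _).2//; near: t.
split; first by near: t.
move=> i im; have ns' : forall i : 'I_m, 0 < t -> 0 < s i * lam i 0 * c t 0 (inord i) by near: t.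
exact: (ns' (Ordinal im) t0).
Unshelve. all: by end_near. Qed.

Lemma octant_region_eq s s' : (forall i, (i < 3)%N -> s i = s' i) ->
  octant_region s = octant_region s'.
Proof.
move=> ss; rewrite /octant_region (_ : corner s = corner s')//.
by apply/rowP => j; rewrite !mxE ss.
Qed.

(** * The double curve of an over-sheet i and an under-sheet j *)

Section Pair.
Variables i j l : nat.
Hypotheses (im : (i < m)%N) (jm : (j < m)%N) (l3 : (l < 3)%N).
Hypotheses (ij : i != j) (il : i != l) (jl : j != l).
Hypothesis hij : h j (psi 0) < h i (psi 0).

Definition line (t : R) : R3 := t *: delta_mx 0 (inord l).

Lemma i3 : (i < 3)%N. Proof. exact: leq_trans m3. Qed.
Lemma j3 : (j < 3)%N. Proof. exact: leq_trans m3. Qed.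

Lemma lineE t e : (e < 3)%N -> line t 0 (inord e) = if e == l then t else 0.
Proof.
move=> e3; rewrite !mxE eqxx /= -val_eqE /= !inordK//.
by case: eqP; rewrite ?mulr1 ?mulr0.
Qed.

Lemma line_i t : line t 0 (inord i) = 0.
Proof. by rewrite lineE ?i3// (negbTE il). Qed.
Lemma line_j t : line t 0 (inord j) = 0.
Proof. by rewrite lineE ?j3// (negbTE jl). Qed.

Lemma norm_line t e : 0 < e -> `|t| < e -> `|line t| < e.
Proof.
move=> e0 te; rewrite norm_rV_lt//; apply/forallP => a.
by rewrite -[a]inord_val lineE//; case: eqP; rewrite ?normr0.
Qed.

Lemma lineP (z : R3) : z 0 (inord i) = 0 -> z 0 (inord j) = 0 ->
  z = line (z 0 (inord l)).
Proof.
move=> zi zj; apply/rowP => a; rewrite -[a]inord_val lineE//.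
case: eqP => [-> //|/eqP al].
have : (a == i :> nat) || (a == j :> nat).
  by move: i3 j3 l3 ij il jl al (ltn_ord a); lia.
by case/orP => /eqP ->.
Qed.

Lemma line_continuous : continuous (line : R -> R3).
Proof. by move=> t; exact: scalel_continuous. Qed.

(** The orientation of the chart: a chart may reverse that of R^3, so this sign enters the
    comparisons below. *)
Definition frame z := triple (axis psi i z) (axis psi j z) (axis psi l z).

Lemma dot_axis_normal e e' z : W z -> (e < m)%N -> z 0 (inord e) = 0 -> (e' < 3)%N ->
  dot (normal D (sheet e z)) (axis psi e' z) = (e == e')%:R * lam e z.
Proof.
move=> Wz em ze e'3; have [_ _ dn _] := normal_sheet em Wz ze.
rewrite dotC dn /axis (diffeo_D _ (diffeo_sym dif) Wz) mxE eqxx /= -val_eqE /=.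
by rewrite !inordK ?(leq_trans em)// mulrC.
Qed.

Lemma axis_neq0 e z : W z -> (e < 3)%N -> axis psi e z != 0.
Proof.
move=> Wz e3; apply/eqP => a0.
have := diffeo_D (delta_mx 0 (inord e)) (diffeo_sym dif) Wz.
rewrite -/(axis psi e z) a0 derive0 => /rowP/(_ (inord e)).
by rewrite !mxE !eqxx => /eqP; rewrite eq_sym oner_eq0.
Qed.

(** The normals of the two sheets are multiples of vectors dual to the axes, which leaves one
    nonzero entry in each of two rows of the Gram matrix. *)
Lemma frame_diag c z : W z -> z 0 (inord i) = 0 -> z 0 (inord j) = 0 ->
  triple (normal D (sheet i z)) (normal D (sheet j z)) c * frame z =
  lam i z * lam j z * dot c (axis psi l z).
Proof.
move=> Wz zi zj; apply: triple_mul_diag.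
- by rewrite (dot_axis_normal Wz im zi i3) eqxx mul1r.
- by rewrite (dot_axis_normal Wz im zi j3) (negbTE ij) mul0r.
- by rewrite (dot_axis_normal Wz im zi l3) (negbTE il) mul0r.
- by rewrite (dot_axis_normal Wz jm zj i3) eq_sym (negbTE ij) mul0r.
- by rewrite (dot_axis_normal Wz jm zj j3) eqxx mul1r.
- by rewrite (dot_axis_normal Wz jm zj l3) (negbTE jl) mul0r.
Qed.

Lemma frame_normal z : W z -> z 0 (inord i) = 0 -> z 0 (inord j) = 0 ->
  0 < triple (normal D (sheet i z)) (normal D (sheet j z)) (axis psi l z) *
      frame z * (lam i z * lam j z).
Proof.
move=> Wz zi zj; rewrite (frame_diag _ Wz zi zj).
have := dot_gt0 (axis_neq0 Wz l3); set d := dot _ _ => d0.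
have [li _ _ _] := normal_sheet im Wz zi; have [lj _ _ _] := normal_sheet jm Wz zj.
rewrite [ltRHS](_ : _ = d * (lam i z * lam j z) ^+ 2); last by ring.
by rewrite mulr_gt0// lt_neqAle eq_sym sqrf_eq0 mulf_neq0//= sqr_ge0.
Qed.

Lemma frame_normal3 z : (l < m)%N -> W z -> z 0 (inord i) = 0 -> z 0 (inord j) = 0 ->
  z 0 (inord l) = 0 ->
  triple (normal D (sheet i z)) (normal D (sheet j z)) (normal D (sheet l z)) *
      frame z = lam i z * lam j z * lam l z.
Proof.
move=> lm Wz zi zj zl; rewrite (frame_diag _ Wz zi zj).
by rewrite (dot_axis_normal Wz lm zl l3) eqxx mul1r.
Qed.

Lemma W00 : W 0.
Proof. by have [] := rhoP (z := 0); rewrite ?normr0. Qed.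

Lemma frame0_neq0 : frame 0 != 0.
Proof.
have /= := @frame_normal 0 W00; rewrite !mxE => /(_ erefl erefl).
by apply: contraTneq => ->; rewrite mulr0 mul0r ltxx.
Qed.

(** The sign with which the cross product of the two normals pairs with the third axis; it makes the
    arc run into the positive side. *)
Definition arc_sign : R := Num.sg (lam i 0 * lam j 0 * frame 0).

Lemma eps_sqr : arc_sign * arc_sign = 1.
Proof.
rewrite /arc_sign -expr2 sqr_sg.
by rewrite !mulf_neq0 ?lam0_neq0 ?frame0_neq0.
Qed.

Lemma eps_pos : 0 < arc_sign * (lam i 0 * lam j 0 * frame 0).
Proof. by rewrite /arc_sign -normrEsg normr_gt0 !mulf_neq0 ?lam0_neq0 ?frame0_neq0. Qed.

Definition arc_map (t : R) : R4 * R4 := (sheet i (line (t * arc_sign)), sheet j (line (t * arc_sign))).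
Definition arc_inv (q : R4 * R4) : R := arc_sign * phi (proj q.1) 0 (inord l).

Lemma arc_line_continuous : continuous (fun t : R => line (t * arc_sign)).
Proof.
move=> t; apply: (@continuous_comp _ _ _ (fun t : R => t * arc_sign) line).
  by apply: cvgMr_tmp; exact: cvg_id.
exact: line_continuous.
Qed.

Lemma norm_eps t : `|t * arc_sign| = `|t|.
Proof.
have e1 : `|arc_sign| = 1.
  by apply/eqP; rewrite -sqrp_eq1// -normrX expr2 eps_sqr normr1.
by rewrite normrM e1 mulr1.
Qed.

(** The derivative of [side] along the arc is the determinant of the two normals and [arc_sign]
    times the third axis; it is positive as long as [frame] and the factors [lam] keep their signs.
    The radius also preserves the order of the heights. *)
Lemma arc_exists : exists d, [/\ arc (crossings D) (side D) arc_map arc_inv d,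
  d <= rho & forall t, `|t| < d -> height (arc_map t).2 < height (arc_map t).1].
Proof.
have l0 : line (0 * arc_sign) = 0 by rewrite mul0r /line scale0r.
have nh : \forall t \near (0 : R), h j (psi (line (t * arc_sign))) < h i (psi (line (t * arc_sign))).
  have cd : (fun t : R => h i (psi (line (t * arc_sign))) - h j (psi (line (t * arc_sign)))) @ (0 : R)
      --> h i (psi 0) - h j (psi 0).
    have ch e : (e < m)%N -> (fun t : R => h e (psi (line (t * arc_sign)))) @ (0 : R) --> h e (psi 0).
      move=> em; rewrite -l0.
      apply: (@continuous_comp _ _ _ (fun t : R => line (t * arc_sign)) (h e \o psi)).
        exact: arc_line_continuous.
      rewrite l0; apply: continuous_comp; first exact: psi_continuous W00.
      by apply: h_continuous => //; have [] := chart_in W00.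
    by apply: cvgB; exact: ch.
  have pos : 0 < h i (psi 0) - h j (psi 0) by rewrite subr_gt0.
  have : \forall t \near (0 : R), 0 < h i (psi (line (t * arc_sign))) - h j (psi (line (t * arc_sign))).
    exact: (cvgr_gt _ cd _ pos).
  by apply: filterS => t; rewrite subr_gt0.
have nf : \forall t \near (0 : R), 0 < frame 0 * frame (line (t * arc_sign)).
  have cf : (fun t : R => frame 0 * frame (line (t * arc_sign))) @ (0 : R) --> frame 0 * frame 0.
    apply: cvgMl_tmp; rewrite -l0.
    have ca e : (fun t : R => axis psi e (line (t * arc_sign))) @ (0 : R) --> axis psi e (line (0 * arc_sign)).
      apply: (@continuous_comp _ _ _ (fun t : R => line (t * arc_sign)) (axis psi e)).
        exact: arc_line_continuous.
      by rewrite l0; exact: axis_cvg W00.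
    by apply: cvg_triple; exact: ca.
  have pos : 0 < frame 0 * frame 0 by rewrite -expr2 lt_neqAle eq_sym sqrf_eq0 frame0_neq0 sqr_ge0.
  exact: (cvgr_gt _ cf _ pos).
have [d' d'0 Hd'] := near_norm (near_and nh nf).
exists (Num.min d' rho); split; [|by rewrite ge_min lexx orbT|]; last first.
  move=> t; rewrite lt_min => /andP[td _]; have [+ _] := Hd' t ltac:(by rewrite subr0).
  by rewrite /= /sheet !height_lift4.
split; first by rewrite lt_min d'0.
move=> t; rewrite lt_min => /andP[td tr]; have [ht ft] := Hd' t ltac:(by rewrite subr0).
set z := line (t * arc_sign) in ht ft.
have zr : `|z| < rho by apply: norm_line; rewrite ?norm_eps.
have zi : z 0 (inord i) = 0 by exact: line_i.
have zj : z 0 (inord j) = 0 by exact: line_j.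
have [Wz lz] := rhoP zr; have [Uz pz] := chart_in Wz.
have cl : {for t, continuous (fun t : R => line (t * arc_sign))} by exact: arc_line_continuous.
have kc : arc_inv (arc_map t) = t.
  rewrite /arc_inv /arc_map /= /sheet proj_lift4 pz /z lineE// eqxx.
  by rewrite mulrCA eps_sqr mulr1.
split => //.
- split; rewrite /= ?proj_lift4 ?height_lift4//; exact: sheet_surf.
- have cs e : (e < m)%N -> {for t, continuous (fun t : R => sheet e (line (t * arc_sign)))}.
    move=> em; apply: (@continuous_comp _ _ _ (fun t : R => line (t * arc_sign)) (sheet e)) => //.
    exact: sheet_continuous.
  exact: cvg_pair (cs i im) (cs j jm).
- move=> e e0.
  have Uc : U (proj (sheet i z)) by rewrite proj_lift4.
  have cc : {for arc_map t, continuous arc_inv}.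
    apply: cvgMl_tmp.
    apply: (@continuous_comp _ _ _ (fun q : R4 * R4 => proj q.1) (coordinate phi l)).
      apply: (@continuous_comp _ _ _ (fst : R4 * R4 -> R4) (@proj R)); last exact: proj_continuous.
      exact: cvg_fst.
    apply: (@continuous_comp _ _ _ phi (fun y : R3 => y 0 (inord l))).
      exact: phi_continuous.
    exact: coord_continuous.
  have ninv : \forall q \near arc_map t, `|arc_inv q - t| < e.
    have /cvgrPdist_lt /(_ e e0) := cc.
    by apply: filterS => q; rewrite kc distrC.
  have s1 : \forall q \near arc_map t, surf D q.1 ->
      phi (proj q.1) 0 (inord i) = 0 /\ height q.1 = h i (proj q.1).
    apply: (near_fst (P := fun p => surf D p -> phi (proj p) 0 (inord i) = 0 /\ height p = h i (proj p))).
    by apply: sheet_local; rewrite ?proj_lift4 ?height_lift4 ?pz.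
  have s2 : \forall q \near arc_map t, surf D q.2 ->
      phi (proj q.2) 0 (inord j) = 0 /\ height q.2 = h j (proj q.2).
    apply: (near_snd (P := fun p => surf D p -> phi (proj p) 0 (inord j) = 0 /\ height p = h j (proj p))).
    by apply: sheet_local; rewrite ?proj_lift4 ?height_lift4 ?pz.
  have s3 : \forall q \near arc_map t, U (proj q.1).
    by apply: (near_fst (P := fun p => U (proj p))); exact: near_U.
  have nn := near_and (near_and ninv s3) (near_and s1 s2).
  apply: filterS nn => -[P Q] /= [[tq UP] [HP HQ]] [/= FP FQ PQ _].
  split=> //; have [p1 p2] := HP FP; have [q1 q2] := HQ FQ.
  rewrite -PQ in q1 q2; have [WP pP] := chart_out UP.
  have zE := lineP p1 q1.
  have -> : arc_map (arc_inv (P, Q)) = (sheet i (phi (proj P)), sheet j (phi (proj P))).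
    by rewrite /arc_map /arc_inv /= mulrAC eps_sqr mul1r -zE.
  by rewrite /sheet pP -p2 -q2 lift4K PQ lift4K.
- pose g (s : R^o) : R^o := side D (arc_map t) (arc_map s).
  have gE : g = fun s : R^o => triple (normal D (sheet i z)) (normal D (sheet j z))
      (psi (line (s * arc_sign)) - psi z).
    by apply/funext => s; rewrite /g /side /arc_map /= !proj_lift4.
  have dpsi : is_derive (t : R^o) 1 (fun s : R^o => psi (line (s * arc_sign))) (arc_sign *: axis psi l z).
    have dl : is_derive (t : R^o) 1 (fun s : R^o => line (s * arc_sign)) (arc_sign *: delta_mx 0 (inord l)).
      have := @is_derive_ray R _ _ id (0 : R3) (arc_sign *: delta_mx 0 (inord l)) t.
      rewrite derive_id (_ : (fun _ => _ + _) = fun s : R^o => line (s * arc_sign)); last first.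
        by apply/funext => s; rewrite add0r /line scalerA.
      by apply; exact: derivable_id.
    have dfp : differentiable psi (line (t * arc_sign)).
      by have [_ oW [_ /smooth_C1 s] _ _] := dif; exact: C1_differentiable oW s Wz.
    have := @is_derive_comp _ _ _ psi (fun s : R^o => line (s * arc_sign)) t _ dfp dl.
    by rewrite deriveE// linearZ /= -deriveE.
  have dg : is_derive (t : R^o) 1 g
      (triple (normal D (sheet i z)) (normal D (sheet j z)) (arc_sign *: axis psi l z)).
    rewrite gE; apply: is_derive_triple.
    have := @is_deriveB _ _ _ _ _ _ _ _ _ dpsi (is_derive_cst (psi z) (t : R^o) (1 : R^o)).
    by rewrite subr0.
  have gt0 : g t = 0 by rewrite gE /z subrr /triple dotC dot0l.
  have dpos : 0 < triple (normal D (sheet i z)) (normal D (sheet j z)) (arc_sign *: axis psi l z).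
    have q1 := frame_normal Wz zi zj; have q2 := lz i im zi; have q3 := lz j jm zj.
    have q4 := eps_pos; rewrite {1}/triple dotZr -/(triple _ _ _).
    exact: sign_transfer q1 q4 ft q2 q3.
  have := is_derive_pos dg dpos; apply: filterS => s [h1 h2].
  by rewrite -/(g s) -gt0; split.
Qed.

(** Signs for the over-sheet, the under-sheet and the third coordinate. *)
Definition pick3 (a b c : R) : nat -> R :=
  fun e => if e == i then a else if e == j then b else c.

Lemma pick_i a b c : pick3 a b c i = a. Proof. by rewrite /pick3 eqxx. Qed.
Lemma pick_j a b c : pick3 a b c j = b.
Proof. by rewrite /pick3 eq_sym (negbTE ij) eqxx. Qed.
Lemma pick_l a b c : pick3 a b c l = c.
Proof. by rewrite /pick3 ![l == _]eq_sym (negbTE il) (negbTE jl). Qed.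

Lemma pick_third e : (e < 3)%N -> e != i -> e != j -> e = l.
Proof. by move: i3 j3 l3 ij il jl; lia. Qed.

Lemma pick_neq0 a b c : a != 0 -> b != 0 -> c != 0 ->
  forall e, (e < m)%N -> pick3 a b c e != 0.
Proof. by move=> a0 b0 c0 e _; rewrite /pick3; case: (e == i) => //; case: (e == j). Qed.

(** If there is a third sheet, [c] must be the side of it on which the arc lies at parameter [t];
    otherwise [c] merely fills the vector of signs. *)
Lemma edge_region t a b c : `|t| < rho -> a != 0 -> b != 0 -> c != 0 ->
  ((l < m)%N -> 0 < c * lam l 0 * (t * arc_sign)) ->
  local_region D (proj (arc_map t).1)
    [:: a *: normal D (arc_map t).1; b *: normal D (arc_map t).2] =
  octant_region (pick3 a b c).
Proof.
move=> tr a0 b0 c0 Hl; set z := line (t * arc_sign).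
have zr : `|z| < rho by apply: norm_line; rewrite ?norm_eps.
have H := @local_region_octant z [:: i; j] (pick3 a b c) (pick3 a b c) zr.
rewrite /= pick_i pick_j in H; rewrite /arc_map /= proj_lift4; apply: H.
- move=> e; rewrite !inE; case: (eqVneq e i) => [->|ei]; first by rewrite im line_i eqxx.
  case: (eqVneq e j) => [->|ej]; first by rewrite jm line_j eqxx.
  case: (ltnP e m) => //= em; have el := pick_third (leq_trans em m3) ei ej.
  rewrite el lineE// eqxx; apply/esym/negbTE; apply: contraTneq (Hl _) => [->|].
    by rewrite mulr0 ltxx.
  by rewrite -el.
- exact: pick_neq0.
- move=> e; rewrite !inE => eS; apply: mulss_gt0.
  by apply: pick_neq0 => //; case/orP: eS => /eqP ->.
- move=> e em; rewrite !inE negb_or => /andP[ei ej].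
  have el := pick_third (leq_trans em m3) ei ej.
  by rewrite /pick3 (negbTE ei) (negbTE ej) el lineE// eqxx Hl// -el.
Qed.

Lemma double_arc t : `|t| < rho -> ((l < m)%N -> t != 0) ->
  height (arc_map t).2 < height (arc_map t).1 -> double_points D (arc_map t).
Proof.
move=> tr t0 ht; set z := line (t * arc_sign).
have zr : `|z| < rho by apply: norm_line; rewrite ?norm_eps.
have [Wz _] := rhoP zr; split=> //; rewrite /= proj_lift4; apply/seteqP; split=> p.
  move=> /(fibre_sheet _ Wz)[e [em ze ->]].
  case: (eqVneq e i) => [->|ei]; first by left.
  case: (eqVneq e j) => [->|ej]; first by right.
  have el := pick_third (leq_trans em m3) ei ej; move: ze em; rewrite el lineE// eqxx.
  by move=> te lm; have := t0 lm; rewrite -normr_eq0 -norm_eps te normr0 eqxx.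
case=> ->; apply/fibre_sheet => //.
  by exists i; rewrite line_i.
by exists j; rewrite line_j.
Qed.

Lemma triple_region a b c : (l < m)%N -> a != 0 -> b != 0 -> c != 0 ->
  local_region D (psi 0) [:: a *: normal D (sheet i 0); b *: normal D (sheet j 0);
    c *: normal D (sheet l 0)] = octant_region (pick3 a b c).
Proof.
move=> lm a0 b0 c0.
have H := @local_region_octant 0 [:: i; j; l] (pick3 a b c) (pick3 a b c).
rewrite normr0 /= pick_i pick_j pick_l in H; apply: H => //.
- move=> e; rewrite !inE mxE eqxx andbT.
  by move: i3 j3 l3 ij il jl im jm lm m3; lia.
- exact: pick_neq0.
- move=> e; rewrite !inE => eS; apply: mulss_gt0.
  by apply: pick_neq0 => //; case/or3P: eS => /eqP ->.
- move=> e em; rewrite !inE !negb_or => /and3P[ei ej].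
  by rewrite (pick_third (leq_trans em m3) ei ej) eqxx.
Qed.

Section Label.
Variables (T : Type) (G : set R3 -> set R3 -> set R3 -> T).

Definition edge_label (q : R4 * R4) : T :=
  let reg so su :=
    local_region D (proj q.1) [:: so *: normal D q.1; su *: normal D q.2] in
  G (reg (-1) (-1)) (reg (-1) 1) (reg 1 1).

Lemma edge_label_arc t c : `|t| < rho -> c != 0 ->
  ((l < m)%N -> 0 < c * lam l 0 * (t * arc_sign)) ->
  edge_label (arc_map t) = G (octant_region (pick3 (-1) (-1) c))
    (octant_region (pick3 (-1) 1 c)) (octant_region (pick3 1 1 c)).
Proof.
move=> tr c0 Hc; rewrite /edge_label !(@edge_region t _ _ c)// ?oner_eq0//.
all: by rewrite oppr_eq0 oner_eq0.
Qed.

Lemma arc_map0 : arc_map 0 = (sheet i 0, sheet j 0).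
Proof. by rewrite /arc_map mul0r /line scale0r. Qed.

Lemma near_arc : \forall q \near (sheet i 0, sheet j 0), crossings D q ->
  exists t, [/\ q = arc_map t, `|t| < rho,
    (0 < side D (sheet i 0, sheet j 0) q -> 0 < t) &
    (side D (sheet i 0, sheet j 0) q < 0 -> t < 0)].
Proof.
have [d [ad dr _]] := arc_exists.
have side0 q : side D q q = 0 by rewrite /side subrr /triple dotC dot0l.
have d0 : 0 < d by have [] := ad.
have z0 : `|0 : R| < d by rewrite normr0.
have := arc_near side0 ad z0 d0; rewrite arc_map0.
apply: filterS => q H /H [t [-> _ td s1 s2]]; exists t; split=> //.
by rewrite subr0 in td; exact: lt_le_trans dr.
Qed.

Lemma edge_label_double : (m <= l)%N ->
  \forall q \near (sheet i 0, sheet j 0), crossings D q ->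
    edge_label q = edge_label (sheet i 0, sheet j 0).
Proof.
move=> ml; have nl : ~ (l < m)%N by rewrite ltnNge ml.
apply: filterS near_arc => q H /H [t [-> tr _ _]].
rewrite -arc_map0 !(@edge_label_arc _ 1)// ?oner_eq0//.
by rewrite normr0.
Qed.

Definition normal_sign : R :=
  if 0 < triple (normal D (sheet i 0)) (normal D (sheet j 0)) (normal D (sheet l 0))
  then 1 else -1.

(** The arc advances along the cross product of its two normals, so it enters the positive side of
    the third sheet exactly when the third normal has a positive determinant with these. *)
Lemma normal_sign_pos : (l < m)%N -> 0 < normal_sign * lam l 0 * arc_sign.
Proof.
move=> lm; have e0 := eps_pos.
have := frame_normal3 lm W00; rewrite !mxE => /(_ erefl erefl erefl).
move=> xf; exact: (sign_triple xf e0 (lam0_neq0 lm)).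
Qed.

Lemma edge_label_triple : (l < m)%N ->
  let lab c := G (octant_region (pick3 (-1) (-1) c))
    (octant_region (pick3 (-1) 1 c)) (octant_region (pick3 1 1 c)) in
  (\forall q \near (sheet i 0, sheet j 0), crossings D q ->
    0 < side D (sheet i 0, sheet j 0) q -> edge_label q = lab normal_sign) /\
  (\forall q \near (sheet i 0, sheet j 0), crossings D q ->
    side D (sheet i 0, sheet j 0) q < 0 -> edge_label q = lab (- normal_sign)).
Proof.
move=> lm lab; have ns := normal_sign_pos lm.
have n0 : normal_sign != 0.
  by rewrite /normal_sign; case: ifP; rewrite ?oppr_eq0 oner_eq0.
split; apply: filterS near_arc => q H /H [t [-> tr h1 h2]].
  move=> /h1 t0; apply: edge_label_arc => // _.
  by rewrite mulrCA mulr_gt0.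
move=> /h2 t0; apply: edge_label_arc; rewrite ?oppr_eq0// => _.
by rewrite !mulNr mulrCA -mulNr mulr_gt0// oppr_gt0.
Qed.
End Label.

End Pair.

Lemma sheet_arrow e s : (e < m)%N -> (forall a, (a < m)%N -> s a != 0) ->
  arrow D (octant_region (fun a => if a == e then -1 else s a))
    (octant_region (fun a => if a == e then 1 else s a)).
Proof.
(* The corner is pushed onto the e-th sheet; its coordinates along the other sheets stay nonzero, so
   no other sheet passes through this point. *)
move=> em s0; pose z : R3 := \row_(a < 3) if a == e :> nat then 0 else corner s 0 a.
have [c1 c2] := corner_octant s0.
have zr : `|z| < rho.
  move: c1; rewrite !norm_rV_lt// => /forallP c1; apply/forallP => a.
  by rewrite mxE; case: eqP; rewrite ?normr0 ?c1.
have zE a : (a < 3)%N -> z 0 (inord a) = if a == e then 0 else corner s 0 (inord a).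
  by move=> a3; rewrite mxE inordK.
have ze : z 0 (inord e) = 0 by rewrite zE ?eqxx ?(leq_trans em).
have znz a : (a < m)%N -> a != e -> z 0 (inord a) != 0.
  move=> am ae; rewrite zE ?(leq_trans am)// (negbTE ae).
  by apply: contraTneq (c2 a am) => ->; rewrite mulr0 ltxx.
have [Wz _] := rhoP zr; have [_ n0 _ _] := normal_sheet em Wz ze.
have reg x : x != 0 -> local_region D (psi z) [:: x *: normal D (sheet e z)] =
    octant_region (fun a => if a == e then x else s a).
  move=> x0; have := @local_region_octant z [:: e] (fun a => if a == e then x else s a)
    (fun a => if a == e then x else s a) zr.
  rewrite /= eqxx; apply.
  - move=> a; rewrite inE; case: (ltnP a m) => am /=.
      case: eqP => [->|/eqP ae]; first by rewrite ze eqxx.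
      by rewrite (negbTE (znz a am ae)).
    by apply/eqP => ae; move: am; rewrite ae leqNgt em.
  - by move=> a am; case: (a == e) => //; exact: s0.
  - by move=> a; rewrite inE => /eqP ->; rewrite eqxx mulss_gt0.
  - move=> a am; rewrite inE => ae; rewrite (negbTE ae) zE ?(leq_trans am)// (negbTE ae).
    exact: c2.
exists (sheet e z).
  split; last exact/eqP.
  rewrite proj_lift4; apply/seteqP; split=> p.
    move=> /(fibre_sheet _ Wz)[a [am za ->]].
    have [->//|ae] := eqVneq a e.
    by have := znz a am ae; rewrite za eqxx.
  by move=> ->; apply/fibre_sheet => //; exists e.
by rewrite proj_lift4 -!reg ?oner_eq0 ?oppr_eq0 ?oner_eq0// scaleN1r scale1r.
Qed.
End Octants.
End Sheets.

(** * Branch points *)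

Section Charts.
Variables (R : realType) (D : diagram R).
Local Notation R3 := 'rV[R]_3.
Local Notation R4 := 'rV[R]_4.

Definition sheet_chart (y : R3) m (U W : set R3) (phi psi : R3 -> R3)
    (h : nat -> R3 -> R^o) : Prop :=
  [/\ (m <= 3)%N, diffeo U W phi psi, W 0 /\ psi 0 = y,
      (forall i, (i < m)%N -> smooth_on U (h i)) &
      (forall i j x, (i < m)%N -> (j < m)%N -> i <> j -> U x ->
         phi x 0 (inord i) = 0 -> phi x 0 (inord j) = 0 -> h i x <> h j x) /\
      (forall p, U (proj p) -> surf D p <->
         exists2 i, (i < m)%N & phi (proj p) 0 (inord i) = 0 /\ height p = h i (proj p))].

Lemma genericE y :
  (exists m U W phi psi h, sheet_chart y m U W phi psi h) \/ branch_at (surf D) y.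
Proof.
have [[m m3 [U [W [phi [psi [h [dif [Uy py] hs hd hF]]]]]]]|] := genericP D y; last by right.
left; exists m, U, W, phi, psi, h; split=> //.
by have [_ _ _ H _] := dif; have := H y Uy; rewrite py.
Qed.

Lemma row2P (u v : 'rV[R]_2) : u 0 0 = v 0 0 -> u 0 1 = v 0 1 -> u = v.
Proof.
move=> uv0 uv1; apply/rowP => -[[|[|k]] lk] //.
- by rewrite (_ : Ordinal lk = 0)//; apply: val_inj.
- by rewrite (_ : Ordinal lk = 1)//; apply: val_inj.
Qed.

Lemma whitney_eq0 (u : 'rV[R]_2) : whitney u = 0 -> u = 0.
Proof.
move=> /rowP E; have := E (inord 0); have := E (inord 1).
rewrite !mxE !inordK//= => /eqP; rewrite sqrf_eq0 => /eqP u1 u0.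
by apply: row2P; rewrite mxE.
Qed.

Lemma branch_fibre y p p' : branch_at (surf D) y ->
  fibre D y p -> fibre D y p' -> p = p'.
Proof.
move=> [U [W [phi [psi [h [dif [Uy py] _ _ hF]]]]]] [Fp /= pp] [Fp' /= pp'].
have Up : U (proj p) by rewrite pp.
have Up' : U (proj p') by rewrite pp'.
have [u [wu hu]] := (hF _ Up).1 Fp; have [u' [wu' hu']] := (hF _ Up').1 Fp'.
rewrite -(lift4K p) -(lift4K p') pp pp' hu hu'.
have u0 : u = 0 by apply: whitney_eq0; rewrite -wu pp.
have u0' : u' = 0 by apply: whitney_eq0; rewrite -wu' pp'.
by rewrite u0 u0'.
Qed.

Lemma fibre_chart p p' : surf D p -> surf D p' -> proj p = proj p' -> p <> p' ->
  exists m U W phi psi h i j, [/\ sheet_chart (proj p) m U W phi psi h,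
    (i < m)%N, (j < m)%N & [/\ i != j, p = sheet psi h i 0 & p' = sheet psi h j 0]].
Proof.
move=> Fp Fp' pp ne; have fp : fibre D (proj p) p by [].
have fp' : fibre D (proj p) p' by split=> //=; rewrite pp.
have [[m [U [W [phi [psi [h ch]]]]]]|br] := genericE (proj p); last first.
  by case: ne; exact: branch_fibre br fp fp'.
have [m3 dif [W0 p0] hs [hd hF]] := ch.
have [i [im _ pi]] := (fibre_sheet dif hF p W0).1 ltac:(by rewrite p0).
have [j [jm _ pj]] := (fibre_sheet dif hF p' W0).1 ltac:(by rewrite p0).
exists m, U, W, phi, psi, h, i, j; split=> //; split=> //.
by apply/eqP => ij; apply: ne; rewrite pi pj ij.
Qed.

(** A branch point is alone in its fibre, so [p'] forces a chart of sheets at [p]. This applies to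
    both preimages of a double point next to a branch point. *)
Lemma wedge_fibre p p' : surf D p -> surf D p' -> proj p = proj p' -> p <> p' ->
  forall x y, tangent (surf D) p x -> tangent (surf D) p y ->
    exists nu, wedge x y = nu *: orient D p.
Proof.
move=> Fp Fp' pp ne; have [m [U [W [phi [psi [h [i [j [ch im jm [_ pi _]]]]]]]]]] :=
  fibre_chart Fp Fp' pp ne.
have [m3 dif [W0 p0] hs [hd hF]] := ch; rewrite pi.
by have [_ _ _] := normal_sheet m3 dif hs hd hF im W0 (mxE _ _ _ _).
Qed.

End Charts.

Section Derivatives.
Variable R : realType.

Lemma derive_scale (V W : normedModType R) (f : V -> W) x a u :
  differentiable f x -> 'D_(a *: u) f x = a *: 'D_u f x.
Proof. by move=> df; rewrite !deriveE// linearZ. Qed.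

Lemma derive_linear2 (V W : normedModType R) (f : V -> W) x a b u v :
  differentiable f x -> 'D_(a *: u + b *: v) f x = a *: 'D_u f x + b *: 'D_v f x.
Proof. by move=> df; rewrite !deriveE// linearD !linearZ. Qed.

Local Notation R3 := 'rV[R]_3.
Local Notation R4 := 'rV[R]_4.

Lemma is_derive_row n (c : R^o -> 'rV[R]_n) (t : R^o) (v : 'rV[R]_n) :
  (forall j, is_derive t 1 (fun s => c s 0 j : R^o) (v 0 j)) -> is_derive t 1 c v.
Proof.
move=> dc; have d : derivable c t 1.
  by apply/derivable_mxP => a j; rewrite (ord1 a); have [] := dc j.
apply: DeriveDef => //; rewrite derive_mx//; apply/rowP => j; rewrite mxE.
by have [_ ->] := dc j.
Qed.

Lemma is_derive_lift4 (c : R^o -> R3) (s : R^o -> R^o) (t : R^o) (v : R3) (w : R^o) :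
  is_derive t 1 c v -> is_derive t 1 s w ->
  is_derive t 1 (fun t => lift4 (c t) (s t)) (lift4 v w).
Proof.
move=> dc ds; apply: is_derive_row => j; rewrite mxE.
under [X in is_derive _ _ X _]eq_fun do rewrite mxE.
by case: (unlift ord_max j) => [i|//]; exact: is_derive_coord.
Qed.

Lemma wedge_entry (a b : R4) i j x y :
  a 0 i = x -> b 0 j = y -> b 0 i = 0 -> wedge a b i j = x * y.
Proof. by move=> ai bj bi; rewrite wedgeE ai bj bi mul0r subr0. Qed.

Lemma cvg_wedge (T : Type) (G : set_system T) (FG : Filter G) (u v : T -> R4) (a b : R4) i j :
  u @ G --> a -> v @ G --> b -> (fun t => wedge (u t) (v t) i j) @ G --> wedge a b i j.
Proof.
move=> ua vb; rewrite wedgeE [X in X @ _](_ : _ = fun t =>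
  u t 0 i * v t 0 j - v t 0 i * u t 0 j); last by apply/funext => t; rewrite wedgeE.
have ui k := cvg_coord (j := k) FG ua; have vi k := cvg_coord (j := k) FG vb.
exact: cvgB (cvgM (ui i) (vi j)) (cvgM (vi i) (ui j)).
Qed.

Lemma cvg_eq_punctured (f g : R -> R) : f @ (0 : R) --> f 0 -> g @ (0 : R) --> g 0 ->
  (\forall t \near (0 : R), t != 0 -> f t = g t) -> f 0 = g 0.
Proof.
move=> cf cg fg.
have cf' : f @ (0 : R)^' --> f 0 by exact: cvg_within_filter.
have cg' : g @ (0 : R)^' --> g 0 by exact: cvg_within_filter.
have fg' : \forall t \near (0 : R)^', g t = f t.
  by rewrite near_withinE; apply: filterS fg => t H t0; rewrite H.
have gf : f @ (0 : R)^' --> g 0 by exact: (cvg_trans (near_eq_cvg fg') cg').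
by rewrite -(cvg_lim (@Rhausdorff R) cf') -(cvg_lim (@Rhausdorff R) gf).
Qed.

Lemma triple_umbrella (a b c : R3) t x y z :
  triple (a + t *: c) ((2 * t) *: b) (x *: a + y *: b + z *: c) =
  2 * t * triple a b c * (z - t * x).
Proof. by rewrite !tripleE !mxE; ring. Qed.

Definition uv (s t : R) : 'rV[R]_2 := \row_(i < 2) [:: s; t]`_i.
Definition umbrella (x y z : R) : R3 := \row_(i < 3) [:: x; y; z]`_i.

Lemma uvE s t : (uv s t 0 0 = s) * (uv s t 0 1 = t).
Proof. by rewrite !mxE. Qed.

Lemma umbrellaE x y z : (umbrella x y z 0 (inord 0) = x) *
  (umbrella x y z 0 (inord 1) = y) * (umbrella x y z 0 (inord 2) = z).
Proof. by rewrite !mxE !inordK. Qed.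

Lemma whitney_uv s t : whitney (uv s t) = umbrella s (t ^+ 2) (s * t).
Proof. by apply/rowP; apply: ord3P; rewrite mxE !uvE umbrellaE inordK. Qed.

Lemma uv_eta (u : 'rV[R]_2) : u = uv (u 0 0) (u 0 1).
Proof. by apply: row2P; rewrite uvE. Qed.

Lemma whitney_inj (u u' : 'rV[R]_2) : whitney u = whitney u' -> u <> u' ->
  exists t, [/\ t != 0, u = uv 0 t & u' = uv 0 (- t)].
Proof.
rewrite (uv_eta u) (uv_eta u') !whitney_uv; move: (u 0 0) (u 0 1) (u' 0 0) (u' 0 1).
move=> s t s' t' /rowP E; have := E (inord 0); have := E (inord 1); have := E (inord 2).
rewrite !umbrellaE => st /eqP; rewrite eqf_sqr => /orP[]/eqP tt ss ne; subst s' t.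
  by case: ne.
have st0 : s * t' = 0 by lra.
exists (- t'); rewrite opprK.
have t0 : t' != 0 by apply: contra_notN ne => /eqP ->; rewrite oppr0.
have -> : s = 0 by move/eqP: st0; rewrite mulf_eq0 (negbTE t0) orbF => /eqP.
by rewrite oppr_eq0.
Qed.
End Derivatives.

Lemma derive_axes (R : realType) (g : 'rV[R]_3 -> 'rV[R]_3) z v : differentiable g z ->
  'D_v g z = v 0 (inord 0) *: axis g 0 z + v 0 (inord 1) *: axis g 1 z +
    v 0 (inord 2) *: axis g 2 z.
Proof.
move=> dg; rewrite {1}(row_sum_delta v) deriveE// linear_sum sum3 /=.
by rewrite !linearZ /= /axis !deriveE.
Qed.

Lemma wedge_normal (R : realType) (D : diagram R) p x y nu :
  wedge x y = nu *: orient D p -> cross (proj x) (proj y) = nu *: normal D p.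
Proof.
move=> w; apply/rowP; have [c0 c1 c2] := crossE (proj x) (proj y).
have E i j : x 0 i * y 0 j - y 0 i * x 0 j = nu * orient D p i j.
  by rewrite -wedgeE w mxE.
by apply: ord3P; rewrite ?c0 ?c1 ?c2 [RHS]mxE [in RHS]mxE inordK//= -E -!proj_coord//; ring.
Qed.

Lemma norm_segment (R : realType) (V : normedModType R) (a b : V) t rho : `|a| < rho ->
  `|b| < rho -> 0 <= t <= 1 -> `|a + t *: (b - a)| < rho.
Proof.
move=> ar br /andP[t0 t1]; have t1' : 0 <= 1 - t by rewrite subr_ge0.
have -> : a + t *: (b - a) = (1 - t) *: a + t *: b.
  by rewrite scalerBr scalerBl scale1r addrCA addrC.
rewrite (le_lt_trans (ler_normD _ _))// !normrZ (ger0_norm t0) (ger0_norm t1').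
have [->|tn] := eqVneq t 0; first by rewrite subr0 mul1r mul0r addr0.
rewrite [ltRHS](_ : _ = (1 - t) * rho + t * rho); last by ring.
by rewrite ler_ltD ?ler_wpM2l ?(ltW ar)// ltr_pM2l// lt_neqAle eq_sym tn.
Qed.

(** Contraction towards (0, -c, 0) scales x and z by [t] and replaces a nonnegative y by a value
    that is no larger, so the outside of the umbrella is star-shaped. *)
Lemma umbrella_segment (R : realFieldType) (x y z c t : R) : 0 < c -> 0 <= t <= 1 ->
  y < 0 \/ x ^+ 2 * y < z ^+ 2 ->
  let y' := (1 - t) * - c + t * y in y' < 0 \/ (t * x) ^+ 2 * y' < (t * z) ^+ 2.
Proof.
move=> c0 /andP[t0 t1] H y'; case: (ltP y' 0) => y'0; first by left.
right; have tn : t != 0.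
  by apply/eqP => t00; move: y'0; rewrite /y' t00; lra.
have tp : 0 < t by rewrite lt_neqAle eq_sym tn.
have u0 : 0 <= (1 - t) * c by rewrite mulr_ge0 ?subr_ge0// ltW.
have y0 : 0 <= y by rewrite -(pmulr_rge0 _ tp); move: y'0; rewrite /y'; lra.
case: H => [|H]; first by rewrite ltNge y0.
rewrite !exprMn -mulrA ltr_pM2l ?exprn_gt0//; apply: le_lt_trans H.
have u1 : 0 <= (1 - t) * y by rewrite mulr_ge0 ?subr_ge0.
by rewrite ler_wpM2l ?sqr_ge0// /y'; lra.
Qed.

(** The product of the two equations has the right-hand side -k^2 (a^2 - b^2). They will describe
    the two sheets of the umbrella, whose tangent planes on the double line are z = t x and z = - t
    x. *)
Lemma opposite_sides (R : realFieldType) (nu nu' g g' k a b : R) : 0 < nu * nu' ->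
  nu * g = k * (a - b) -> nu' * g' = - k * (a + b) -> g * g' < 0 -> b ^+ 2 < a ^+ 2.
Proof.
move=> nn E E' gg; have : 0 < - (nu * nu' * (g * g')) by rewrite oppr_gt0 pmulr_rlt0.
have -> : - (nu * nu' * (g * g')) = k ^+ 2 * (a ^+ 2 - b ^+ 2).
  by transitivity (- (nu * g * (nu' * g'))); [ring|rewrite E E'; ring].
have [k0|k0] := eqVneq k 0; first by rewrite k0 expr2 !mul0r ltxx.
by rewrite pmulr_rgt0 ?subr_gt0// expr2 mulss_gt0.
Qed.

(** * The umbrella at a branch point *)

Section Branch.
Variables (R : realType) (D : diagram R).
Local Notation R3 := 'rV[R]_3.
Local Notation R4 := 'rV[R]_4.
Variables (U W : set R3) (phi psi : R3 -> R3) (h : 'rV[R]_2 -> R^o).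
Hypothesis dif : diffeo U W phi psi.
Hypothesis W0 : W 0.
Hypothesis hs : smooth_on (@whitney R @^-1` W) h.
Hypothesis h1 : 'D_(delta_mx 0 1) h 0 <> 0.
Hypothesis hF : forall p, U (proj p) ->
  surf D p <-> exists u, phi (proj p) = whitney u /\ height p = h u.

Definition branch_map u : R4 := lift4 (psi (whitney u)) (h u).
Definition double_base (t : R) : R3 := umbrella 0 (t ^+ 2) 0.
Definition double_map t : R4 := branch_map (uv 0 t).

Lemma whitney_double t : whitney (uv 0 t) = double_base t.
Proof. by rewrite whitney_uv mul0r. Qed.

Lemma branch_surf u : W (whitney u) -> surf D (branch_map u).
Proof.
move=> Wu; have [Uu pu] := chart_in dif Wu.
by apply/hF; rewrite proj_lift4 ?height_lift4//; exists u.
Qed.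

Lemma surf_branch p : U (proj p) -> surf D p ->
  exists u, phi (proj p) = whitney u /\ p = branch_map u.
Proof.
move=> Up /(hF Up)[u [pu hu]]; exists u; split=> //.
by rewrite /branch_map -pu (chart_out dif Up).2 -hu lift4K.
Qed.

Lemma tangent_branch (c : R^o -> 'rV[R]_2) (w : R3) (k : R^o) : W (whitney (c 0)) ->
  is_derive (0 : R^o) 1 (fun s => whitney (c s)) w ->
  is_derive (0 : R^o) 1 (fun s => h (c s)) k ->
  tangent (surf D) (branch_map (c 0)) (lift4 ('D_w psi (whitney (c 0))) k).
Proof.
move=> Wc dc dh; exists (branch_map \o c); split=> //.
  have cc := derivable_derive_continuous dc; have := cc W (near_W dif Wc).
  by rewrite !near_simpl /=; apply: filterS => s; exact: branch_surf.
apply: is_derive_lift4 => //; apply: (@is_derive_comp _ _ _ psi) => //.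
have [_ oW [_ sp] _ _] := dif; exact: C1_differentiable oW (smooth_C1 sp) Wc.
Qed.

Lemma derive_psi a b z : W z ->
  'D_(umbrella a 0 b) psi z = a *: axis psi 0 z + b *: axis psi 2 z.
Proof.
move=> Wz; have [_ oW [_ sp] _ _] := dif.
have dp := C1_differentiable oW (smooth_C1 sp) Wz.
have -> : umbrella a 0 b = a *: delta_mx 0 (inord 0) + b *: delta_mx 0 (inord 2).
  by apply/rowP; apply: ord3P; rewrite umbrellaE !mxE !eqxx -!val_eqE /= !inordK//=; ring.
exact: derive_linear2.
Qed.

(** Partial derivatives of [branch_map] at (0, t), where those of the umbrella are (1, 0, t) and (0,
    2 t, 0). *)
Definition tangent_s t : R4 :=
  lift4 (axis psi 0 (double_base t) + t *: axis psi 2 (double_base t))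
    ('D_(delta_mx 0 0) h (uv 0 t)).
Definition tangent_t t : R4 :=
  lift4 ((2 * t) *: axis psi 1 (double_base t)) ('D_(delta_mx 0 1) h (uv 0 t)).

Lemma tangent_sP t : W (double_base t) -> tangent (surf D) (double_map t) (tangent_s t).
Proof.
move=> Wt; have Wt' : W (whitney (uv 0 t)) by rewrite whitney_double.
pose c (s : R^o) := uv 0 t + s *: delta_mx 0 0.
have c0 : c 0 = uv 0 t by rewrite /c scale0r addr0.
have cE s : c s = uv s t by apply: row2P; rewrite uvE !mxE /=; ring.
have dh : is_derive (0 : R^o) 1 (fun s => h (c s)) ('D_(delta_mx 0 0) h (uv 0 t)).
  have := @is_derive_ray _ _ _ h (uv 0 t) (delta_mx 0 0) 0; rewrite scale0r addr0; apply.
  by have [_ d _] := smooth_C1 hs; exact: d.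
have dw : is_derive (0 : R^o) 1 (fun s => whitney (c s)) (umbrella 1 0 t).
  rewrite [X in is_derive _ _ X _](_ : _ = fun s : R^o => double_base t + s *: umbrella 1 0 t).
    have := @is_derive_ray _ _ _ id (double_base t) (umbrella 1 0 t) 0.
    by rewrite scale0r addr0 derive_id; apply; exact: derivable_id.
  apply/funext => s; rewrite cE whitney_uv.
  by apply/rowP; apply: ord3P; rewrite umbrellaE !mxE !inordK//=; ring.
have := tangent_branch _ dw dh; rewrite c0 => /(_ Wt').
by rewrite /tangent_s whitney_double derive_psi// scale1r.
Qed.

Lemma tangent_tP t : W (double_base t) -> tangent (surf D) (double_map t) (tangent_t t).
Proof.
move=> Wt; have Wt' : W (whitney (uv 0 t)) by rewrite whitney_double.
pose c (s : R^o) := uv 0 t + s *: delta_mx 0 1.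
have c0 : c 0 = uv 0 t by rewrite /c scale0r addr0.
have cE s : c s = uv 0 (t + s) by apply: row2P; rewrite uvE !mxE /=; ring.
have dh : is_derive (0 : R^o) 1 (fun s => h (c s)) ('D_(delta_mx 0 1) h (uv 0 t)).
  have := @is_derive_ray _ _ _ h (uv 0 t) (delta_mx 0 1) 0; rewrite scale0r addr0; apply.
  by have [_ d _] := smooth_C1 hs; exact: d.
have dw : is_derive (0 : R^o) 1 (fun s => whitney (c s)) ((2 * t) *: delta_mx 0 (inord 1)).
  have E : (fun s => whitney (c s)) = fun s : R^o => double_base t + (2 * t * s + s ^+ 2) *: delta_mx 0 (inord 1).
    apply/funext => s; rewrite cE whitney_uv.
    apply/rowP; apply: ord3P; rewrite umbrellaE !mxE !inordK//= -?val_eqE /= ?inordK//=; ring.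
  have dq : is_derive (0 : R^o) 1 (fun s : R^o => 2 * t * s + s ^+ 2 : R^o) (2 * t).
    have := @is_deriveD _ _ _ _ _ _ _ _ _
      (@is_deriveZ _ _ _ id (2 * t) (0 : R^o) 1 1 (is_derive_id _ _))
      (@is_deriveX _ _ id 2 (0 : R^o) 1 1 (is_derive_id _ _)).
    move=> H; apply: is_derive_eq H _.
    by rewrite /= expr1 mulr0 scale0r addr0 [LHS]mulr1.
  rewrite E; apply: is_derive_row => j.
  have dj (b k : R^o) : is_derive (0 : R^o) 1
      (fun s : R^o => b + k *: (2 * t * s + s ^+ 2 : R^o) : R^o) (0 + k *: (2 * t : R^o)).
    exact: (@is_deriveD _ _ _ _ _ _ _ _ _ (is_derive_cst _ _ _) (@is_deriveZ _ _ _ _ k _ _ _ dq)).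
  have := dj (double_base t 0 j) ((delta_mx 0 (inord 1) : R3) 0 j).
  rewrite add0r [X in is_derive _ _ _ X -> _]mulrC.
  rewrite (_ : (fun s : R^o => _ + _) =
    fun s : R^o => (double_base t + (2 * t * s + s ^+ 2) *: delta_mx 0 (inord 1)) 0 j).
    by rewrite [X in _ -> is_derive _ _ _ X]mxE.
  apply/funext => s; rewrite [RHS]mxE; congr (_ + _).
  by rewrite [RHS]mxE; exact: mulrC.
have := tangent_branch _ dw dh; rewrite c0 => /(_ Wt').
rewrite whitney_double; congr (tangent _ _ (lift4 _ _)).
have [_ oW [_ sp] _ _] := dif.
have dp := C1_differentiable oW (smooth_C1 sp) Wt.
exact: derive_scale.
Qed.

Hypothesis hinj : forall u u', W (whitney u) -> whitney u = whitney u' -> h u = h u' -> u = u'.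

Lemma double_baseN t : double_base (- t) = double_base t.
Proof. by rewrite /double_base sqrrN. Qed.

Lemma double_base0 : double_base 0 = 0.
Proof. by apply/rowP; apply: ord3P; rewrite umbrellaE mxE ?expr2 ?mul0r. Qed.

Lemma double_base_continuous : {for (0 : R), continuous double_base}.
Proof.
apply: cvg_row; apply: ord3P; rewrite umbrellaE;
  under [X in X @ _]eq_fun do rewrite umbrellaE.
- exact: cvg_cst.
- exact: exprn_continuous.
- exact: cvg_cst.
Qed.

Lemma near_double_base : \forall t \near (0 : R), W (double_base t).
Proof. by apply: double_base_continuous; rewrite double_base0; exact: (near_W dif W0). Qed.

Lemma uv00 : uv 0 0 = 0 :> 'rV[R]_2.
Proof. by apply: row2P; rewrite uvE mxE. Qed.

Lemma uv_continuous : {for (0 : R), continuous (uv 0 : R -> 'rV[R]_2)}.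
Proof.
apply: cvg_row => j; rewrite mxE; under [X in X @ _]eq_fun do rewrite mxE.
by case: j => [[|[|k]] lk] /=; [exact: cvg_cst|exact: cvg_id|].
Qed.

Lemma W_whitney0 : W (whitney (uv 0 0)).
Proof. by rewrite whitney_double double_base0. Qed.

Lemma double_map_continuous : {for (0 : R), continuous double_map}.
Proof.
apply: lift4_continuous.
  rewrite [X in {for _, continuous X}](_ : _ = psi \o double_base); last first.
    by apply/funext => t; rewrite /= whitney_double.
  apply: continuous_comp; first exact: double_base_continuous.
  by apply: (psi_continuous dif); rewrite double_base0.
apply: (@continuous_comp _ _ _ (uv 0) h); first exact: uv_continuous.
by have [c _ _] := smooth_C1 hs; apply: c; exact: W_whitney0.
Qed.

Lemma double_map_surf t : W (double_base t) -> surf D (double_map t).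
Proof. by move=> Wt; apply: branch_surf; rewrite whitney_double. Qed.

Lemma double_map0_surf : surf D (double_map 0).
Proof. by apply: double_map_surf; rewrite double_base0. Qed.

Lemma orient_double_cvg i j :
  (fun t => orient D (double_map t) i j) @ (0 : R) --> orient D (double_map 0) i j.
Proof.
apply: (@cvg_comp _ _ _ double_map (fun p => orient D p i j) _ _ _ _ (orient_within (i := i) (j := j) double_map0_surf)).
move=> B HB; have : \forall t \near (0 : R), surf D (double_map t) -> B (double_map t).
  exact: (double_map_continuous HB).
rewrite /fmap /=; apply: filterS2 near_double_base => t Wt H.
by apply: H; exact: double_map_surf.
Qed.

Lemma axis_double_cvg k : (axis psi k \o double_base) @ (0 : R) --> axis psi k (double_base 0).
Proof.
apply: (@continuous_comp _ _ _ double_base (axis psi k)); first exact: double_base_continuous.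
by apply: (axis_cvg dif); rewrite double_base0.
Qed.

Lemma derive_h_cvg k :
  (fun t => 'D_(delta_mx 0 k) h (uv 0 t)) @ (0 : R) --> 'D_(delta_mx 0 k) h (uv 0 0).
Proof.
apply: (@continuous_comp _ _ _ (uv 0) ('D_(delta_mx 0 k) h)); first exact: uv_continuous.
by have [_ _ c] := smooth_C1 hs; apply: c; exact: W_whitney0.
Qed.

(** It is continuous at the branch point and, thanks to the height, nonzero there, although its
    projection to R^3 vanishes. *)
Definition surface_bivector t : 'M[R]_4 := wedge (tangent_s t) (tangent_t t).

Lemma surface_bivector_cvg i j :
  (fun t => surface_bivector t i j) @ (0 : R) --> surface_bivector 0 i j.
Proof.
have cs : {for (0 : R), continuous tangent_s}.
  apply: lift4_continuous; last exact: derive_h_cvg.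
  by apply: cvgD; [exact: axis_double_cvg|apply: cvgZ; [exact: cvg_id|exact: axis_double_cvg]].
have ct : {for (0 : R), continuous tangent_t}.
  apply: lift4_continuous; last exact: derive_h_cvg.
  apply: cvgZ; last exact: axis_double_cvg.
  by apply: cvgMl_tmp; exact: cvg_id.
exact: cvg_wedge cs ct.
Qed.

Lemma double_map_neq t : t != 0 -> W (double_base t) -> double_map t <> double_map (- t).
Proof.
move=> t0 Wt /(congr1 (@height R)); rewrite !height_lift4 => /hinj.
rewrite !whitney_double double_baseN => /(_ Wt erefl) /rowP/(_ 1); rewrite !uvE => tt.
by move/eqP: t0; apply; lra.
Qed.

Lemma proj_double t : proj (double_map t) = psi (double_base t).
Proof. by rewrite proj_lift4 whitney_double. Qed.

Lemma surface_bivector_orient t : t != 0 -> W (double_base t) ->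
  exists nu, surface_bivector t = nu *: orient D (double_map t).
Proof.
move=> t0 Wt; apply: (@wedge_fibre _ _ _ (double_map (- t))).
- exact: double_map_surf.
- by apply: double_map_surf; rewrite double_baseN.
- by rewrite !proj_double double_baseN.
- exact: double_map_neq.
- exact: tangent_sP.
- exact: tangent_tP.
Qed.

(** For small nonzero [t] the two bivectors are proportional. Written with 2 x 2 minors, this passes
    to the limit without any control of the factor. *)
Lemma orient_branch i j a b :
  surface_bivector 0 i j * orient D (double_map 0) a b =
  surface_bivector 0 a b * orient D (double_map 0) i j.
Proof.
apply: (@cvg_eq_punctured _ (fun t => surface_bivector t i j * orient D (double_map t) a b)
  (fun t => surface_bivector t a b * orient D (double_map t) i j)).
- by apply: cvgM; [exact: surface_bivector_cvg|exact: orient_double_cvg].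
- by apply: cvgM; [exact: surface_bivector_cvg|exact: orient_double_cvg].
apply: filterS near_double_base => t Wt t0.
have [nu ->] := surface_bivector_orient t0 Wt; rewrite !mxE; ring.
Qed.

(* The entry is a nonzero coordinate of the tangent line of the branch point
   times the vertical velocity of h. *)
Lemma branch_entry : exists i j,
  surface_bivector 0 i j != 0 /\ orient D (double_map 0) i j != 0.
Proof.
have [k ak] : exists k, axis psi 0 0 0 k != 0.
  apply: contrapT => H; have := axis_neq0 dif W0 (isT : (0 < 3)%N) => /eqP; apply.
  apply/rowP => k; rewrite mxE; apply: contrapT => /eqP ak; apply: H; by exists k.
pose i := lift ord_max k : 'I_4.
have sb : surface_bivector 0 i ord_max != 0.
  have ti : tangent_t 0 0 i = 0.
    by rewrite -(proj_lift (tangent_t 0)) proj_lift4 mulr0 scale0r mxE.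
  have si : tangent_s 0 0 i = axis psi 0 0 0 k.
    by rewrite -(proj_lift (tangent_s 0)) proj_lift4 scale0r addr0 double_base0.
  have th : tangent_t 0 0 ord_max = 'D_(delta_mx 0 1) h 0.
    by rewrite -[LHS]/(height (tangent_t 0)) height_lift4 uv00.
  have h0 : 'D_(delta_mx 0 1) h 0 != 0 :> R by apply/eqP.
  by rewrite /surface_bivector (wedge_entry si th ti) mulf_neq0.
exists i, ord_max; split=> //; apply/eqP => o0.
have [_ /(_ _ double_map0_surf)[]] := orientP D; case.
apply/matrixP => a b; have := orient_branch i ord_max a b; rewrite o0 mulr0 => /eqP.
by rewrite mulf_eq0 (negbTE sb) mxE => /eqP.
Qed.

(** One entry is nonzero in both bivectors at the branch point and keeps its sign nearby by
    continuity, so the factors at [t] and [- t] have equal signs. This links the co-orientations of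
    the two sheets. *)
Lemma branch_sign : exists2 d, 0 < d & forall t, t != 0 -> `|t| < d ->
  W (double_base t) /\ exists nu nu', [/\ 0 < nu * nu',
    surface_bivector t = nu *: orient D (double_map t) &
    surface_bivector (- t) = nu' *: orient D (double_map (- t))].
Proof.
have [i [j [w0 o0]]] := branch_entry.
pose o t := orient D (double_map t) i j.
pose w t := surface_bivector t i j.
have nw : \forall t \near (0 : R), 0 < w 0 * w t.
  have c : (fun t => w 0 * w t) @ (0 : R) --> w 0 * w 0.
    by apply: cvgMl_tmp; exact: surface_bivector_cvg.
  exact: (cvgr_gt _ c _ (mulss_gt0 w0)).
have no : \forall t \near (0 : R), 0 < o 0 * o t.
  have c : (fun t => o 0 * o t) @ (0 : R) --> o 0 * o 0.
    by apply: cvgMl_tmp; exact: orient_double_cvg.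
  exact: (cvgr_gt _ c _ (mulss_gt0 o0)).
have /nbhs_ballP[d /= d0 Hd] := near_and near_double_base (near_and nw no).
have {}Hd t : `|t| < d -> W (double_base t) /\ 0 < w 0 * w t /\ 0 < o 0 * o t.
  by move=> td; apply: Hd; rewrite -ball_normE /= sub0r normrN.
exists d => // t t0 td; have [Wt [wt ot]] := Hd t td.
have [WNt [wNt oNt]] := Hd (- t) ltac:(by rewrite normrN).
have [nu nE] := surface_bivector_orient t0 Wt.
have [nu' nE'] := surface_bivector_orient (t := - t) ltac:(by rewrite oppr_eq0) WNt.
split=> //; exists nu, nu'; split=> //.
have E : w t = nu * o t by rewrite /w nE mxE.
have E' : w (- t) = nu' * o (- t) by rewrite /w nE' mxE.
move: (mulr_gt0 wt wNt) (mulr_gt0 ot oNt); rewrite E E' => p1 p2.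
have q2 : 0 < (w 0 * o 0 * (o t * o (- t))) ^+ 2.
  rewrite lt_neqAle eq_sym sqrf_eq0 sqr_ge0 andbT; apply: contraTneq p2 => z.
  have z' : o 0 * (w 0 * o 0 * (o t * o (- t))) = 0 by rewrite z mulr0.
  rewrite -(pmulr_rgt0 _ (mulss_gt0 w0)).
  have -> : w 0 * w 0 * (o 0 * o t * (o 0 * o (- t))) = w 0 * (o 0 * (w 0 * o 0 * (o t * o (- t)))) by ring.
  by rewrite z' mulr0 ltxx.
rewrite -(pmulr_lgt0 _ q2).
have -> : nu * nu' * (w 0 * o 0 * (o t * o (- t))) ^+ 2 =
  w 0 * (nu * o t) * (w 0 * (nu' * o (- t))) * (o 0 * o t * (o 0 * o (- t))) by ring.
exact: mulr_gt0.
Qed.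

Lemma psi_differentiable z : W z -> differentiable psi z.
Proof. by move=> Wz; have [_ oW [_ sp] _ _] := dif; exact: C1_differentiable oW (smooth_C1 sp) Wz. Qed.

Definition axes_det z := triple (axis psi 0 z) (axis psi 1 z) (axis psi 2 z).

Lemma axes_det_neq0 z : W z -> axes_det z != 0.
Proof.
move=> Wz; have [Uz pz] := chart_in dif Wz.
have da i j : (i < 3)%N -> (j < 3)%N ->
    dot (axis psi j z) (grad (coordinate phi i) (psi z)) = (i == j)%:R.
  by move=> i3 j3; rewrite -(dot_axis dif Uz i3 j3) pz.
have E := triple_mul_diag (axis psi 2 z) (da 0 0 isT isT) (da 1 0 isT isT) (da 2 0 isT isT)
  (da 0 1 isT isT) (da 1 1 isT isT) (da 2 1 isT isT).
rewrite (da 2 2 isT isT) in E.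
apply/eqP => a0; move/eqP: E; rewrite -/(axes_det z) a0 mul0r !mul1r eq_sym.
by rewrite oner_eq0.
Qed.

(** In the chart, the sheet through the preimage [t] has the tangent plane z = t x, whence the last
    factor; the factor [2 * t] changes sign between the two preimages. *)
Lemma dot_branch_normal t nu v : W (double_base t) ->
  surface_bivector t = nu *: orient D (double_map t) ->
  let zeta := 'D_v phi (psi (double_base t)) in
  nu * dot v (normal D (double_map t)) =
  2 * t * axes_det (double_base t) * (zeta 0 (inord 2) - t * zeta 0 (inord 0)).
Proof.
move=> Wt /wedge_normal; rewrite !proj_lift4 => E zeta.
have [Ut pt] := chart_in dif Wt.
have vE : v = 'D_zeta psi (double_base t).
  by have := diffeo_D v dif Ut; rewrite pt.
rewrite dotC -dotZl -E -/(triple _ _ _) [in LHS]vE.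
rewrite derive_axes; last exact: psi_differentiable.
exact: triple_umbrella.
Qed.

(* These points, in the coordinates of the umbrella z^2 = x^2 y, lie on either
   side of its double line x = z = 0 < y, but they are joined around y < 0. *)
Definition outside (rho : R) : set R3 :=
  [set z : R3 | `|z| < rho /\ (z 0 (inord 1) < 0 \/
     z 0 (inord 0) ^+ 2 * z 0 (inord 1) < z 0 (inord 2) ^+ 2)].

Definition outside_base (rho : R) : R3 := umbrella 0 (- (rho / 2)) 0.

Lemma outside_region rho : 0 < rho -> (forall z : R3, `|z| < rho -> W z) ->
  let r := connected_component (complement D) (psi (outside_base rho)) in
  region D r /\ psi @` outside rho `<=` r.
Proof.
move=> rho0 rhoW; have r2 : 0 < rho / 2 by rewrite divr_gt0.
have r2r : rho / 2 < rho by rewrite ltr_pdivrMr// ltr_pMr// ltr1n.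
have base : `|outside_base rho| < rho.
  rewrite norm_rV_lt//; apply/forallP; apply: ord3P; rewrite umbrellaE ?normr0//.
  by rewrite normrN gtr0_norm.
apply: (@star_region _ D (outside rho) W psi (outside_base rho)).
- exact: (psi_continuous dif).
- by move=> z [/rhoW].
- by split=> //; left; rewrite umbrellaE oppr_lt0.
- move=> z t [zr zz] t01; split; first exact: norm_segment.
  set w := _ + _; have [-> -> ->] : [/\ w 0 (inord 0) = t * z 0 (inord 0),
      w 0 (inord 1) = (1 - t) * - (rho / 2) + t * z 0 (inord 1) &
      w 0 (inord 2) = t * z 0 (inord 2)].
    by split; rewrite !mxE !inordK//=; ring.
  exact: umbrella_segment.
- move=> z [/rhoW Wz zz] [p Fp pz]; have [Uz pz'] := chart_in dif Wz.
  have Up : U (proj p) by rewrite pz.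
  have [u [pu _]] := surf_branch Up Fp; move: zz; rewrite -pz' -pz pu !mxE !inordK//=.
  rewrite exprMn ltxx => -[|//]; by rewrite ltNge sqr_ge0.
Qed.

(** For the chart coordinates x, y, z at parameter [s] of the ray, x / s and z / s tend to the
    velocities and y tends to t^2, so (z^2 - x^2 y) / s^2 has a limit that the hypothesis makes
    positive. *)
Lemma outside_ray rho t v : W (double_base t) -> `|double_base t| < rho ->
  let zeta := 'D_v phi (psi (double_base t)) in
  t ^+ 2 * zeta 0 (inord 0) ^+ 2 < zeta 0 (inord 2) ^+ 2 ->
  \forall s \near 0^'+, (psi @` outside rho) (psi (double_base t) + s *: v).
Proof.
move=> Wt tr zeta Hz; have [Ut pt] := chart_in dif Wt.
set x := psi (double_base t); pose c (s : R^o) := phi (x + s *: v).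
have c0 : c 0 = double_base t by rewrite /c scale0r addr0.
have dc : is_derive (0 : R^o) 1 c zeta.
  have := @is_derive_ray R _ _ phi x v 0; rewrite scale0r addr0; apply.
  by have [_ _ [/smooth_C1[_ d _] _] _ _] := dif; exact: d.
have cc := derivable_derive_continuous dc.
have nU : \forall s \near (0 : R^o), U (x + s *: v).
  have ray : {for (0 : R^o), continuous (fun s : R^o => x + s *: v)}.
    by apply: (@cvgD _ R3 _ _ _ (cst x)); [exact: cvg_cst|exact: scalel_continuous].
  by apply: ray; rewrite scale0r addr0; have [oU _ _ _ _] := dif; exact: open_nbhs_nbhs.
have nr : \forall s \near (0 : R^o), `|c s| < rho.
  have c1 : (fun s => `|c s|) @ (0 : R^o) --> `|c 0| by exact: cvg_norm cc.
  by apply: (cvgr_lt _ c1); rewrite c0.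
have quotient k : double_base t 0 (inord k) = 0 ->
    (fun s : R => s^-1 * c s 0 (inord k)) @ (0 : R)^' --> zeta 0 (inord k).
  move=> bk; have [d1 d2] := is_derive_coord (inord k) dc.
  move: d1; rewrite /derivable; move: d2; rewrite /derive => ->.
  apply: cvg_trans; apply: near_eq_cvg; near=> s.
  by rewrite /= addr0 c0 bk subr0 [s *: 1]mulr1.
have q0 := quotient 0%N (umbrellaE _ _ _).1.1; have q2 := quotient 2%N (umbrellaE _ _ _).2.
have c1 : (fun s : R => c s 0 (inord 1)) @ (0 : R)^' --> t ^+ 2.
  have := cvg_coord (j := inord 1) _ cc; rewrite c0 umbrellaE => H.
  exact: cvg_within_filter (H _).
have lim : (fun s : R => (s^-1 * c s 0 (inord 2)) ^+ 2 -
    (s^-1 * c s 0 (inord 0)) ^+ 2 * c s 0 (inord 1)) @ (0 : R)^' -->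
    zeta 0 (inord 2) ^+ 2 - zeta 0 (inord 0) ^+ 2 * t ^+ 2.
  rewrite !expr2; under [X in X @ _]eq_fun do rewrite !expr2.
  by apply: cvgB; apply: cvgM => //; apply: cvgM.
have pos : \forall s \near (0 : R)^', 0 < (s^-1 * c s 0 (inord 2)) ^+ 2 -
    (s^-1 * c s 0 (inord 0)) ^+ 2 * c s 0 (inord 1).
  by apply: (cvgr_gt _ lim); rewrite subr_gt0 mulrC.
move: pos; rewrite near_withinE => pos; rewrite near_withinE.
near=> s => /= s0; exists (c s); last by rewrite /c (chart_out dif _).2//; near: s.
split; first by near: s.
right; have : s != 0 -> 0 < (s^-1 * c s 0 (inord 2)) ^+ 2 -
    (s^-1 * c s 0 (inord 0)) ^+ 2 * c s 0 (inord 1) by near: s.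
rewrite gt_eqF// => /(_ isT).
rewrite !exprMn -[X in _ - X]mulrA -mulrBr pmulr_rgt0 ?subr_gt0//.
by rewrite exprn_gt0// invr_gt0.
Unshelve. all: by end_near. Qed.

(** A direction on the positive side of one sheet and the negative side of the other points outside
    of the umbrella, because the factors at [t] and [- t] have equal signs. Both values of [e] thus
    give the same region, whichever preimage is the upper one. *)
Lemma branch_region : exists d r, 0 < d /\ forall t, t != 0 -> `|t| < d ->
  W (double_base t) /\ forall e, e ^+ 2 = 1 -> local_region D (psi (double_base t))
    [:: - e *: normal D (double_map t); e *: normal D (double_map (- t))] = r.
Proof.
have [d1 d10 sgn] := branch_sign.
have /nbhs_ballP[rho /= rho0 rhoW] := near_W dif W0.
have {}rhoW (z : R3) : `|z| < rho -> W z.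
  by move=> zr; apply: rhoW; rewrite -ball_normE /= sub0r normrN.
have nr : \forall t \near (0 : R), `|double_base t| < rho.
  have c1 : (fun t => `|double_base t|) @ (0 : R) --> `|double_base 0|.
    exact: cvg_norm double_base_continuous.
  by apply: (cvgr_lt _ c1); rewrite double_base0 normr0.
have /nbhs_ballP[d2 /= d20 Hd2] := nr.
have [reg sub] := outside_region rho0 rhoW.
exists (Num.min d1 d2), (connected_component (complement D) (psi (outside_base rho))).
split=> [|t t0]; first by rewrite lt_min d10.
rewrite lt_min => /andP[td1 td2]; have [Wt [nu [nu' [nn nE nE']]]] := sgn t t0 td1.
have tr : `|double_base t| < rho by apply: Hd2; rewrite -ball_normE /= sub0r normrN.
split=> // e e1; set n := normal D (double_map t); set n' := normal D (double_map (- t)).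
pose k := 2 * t * axes_det (double_base t).
have E v : let zeta := 'D_v phi (psi (double_base t)) in
    nu * dot v n = k * (zeta 0 (inord 2) - t * zeta 0 (inord 0)) /\
    nu' * dot v n' = - k * (zeta 0 (inord 2) + t * zeta 0 (inord 0)).
  move=> zeta; split; first exact: dot_branch_normal.
  have := dot_branch_normal (t := - t) (nu := nu') v; rewrite double_baseN => /(_ Wt nE') ->.
  by rewrite /k mulrN !mulNr opprK.
have k0 : k != 0 by rewrite /k !mulf_neq0 ?axes_det_neq0 ?pnatr_eq0.
have [g1 g2] := E (axis psi 2 (double_base t)).
set g := dot _ n in g1; set g' := dot _ n' in g2.
have gg : g * g' < 0.
  have z2 : 'D_(axis psi 2 (double_base t)) phi (psi (double_base t)) = delta_mx 0 (inord 2).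
    exact: diffeo_D (diffeo_sym dif) Wt.
  move: g1 g2; rewrite z2 !mxE !eqxx -val_eqE /= !inordK//= mulr0 subr0 addr0 !mulr1 => g1 g2.
  have := mulss_gt0 k0; rewrite -oppr_lt0 -mulrN -{1}g1 -g2.
  by rewrite mulrACA pmulr_rlt0.
(* The third axis lies on opposite sides of the two sheets; the factor [- e * g] directs it to the
   sides selected by [e]. *)
apply: (local_regionE (v0 := (- e * g) *: axis psi 2 (double_base t))) => //.
  rewrite /= andbT !dotZl !dotZr -/g -/g'.
  have -> : - e * g * (- e * g) = e ^+ 2 * g ^+ 2 by ring.
  have -> : - e * g * (e * g') = e ^+ 2 * - (g * g') by ring.
  rewrite e1 !mul1r oppr_gt0 gg andbT expr2 mulss_gt0//.
  by apply: contraTneq gg => ->; rewrite mul0r ltxx.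
move=> v; rewrite /= andbT !dotZr => /andP[v1 v2]; have [E1 E2] := E v.
have vv : dot v n * dot v n' < 0.
  have := mulr_gt0 v1 v2.
  have -> : - e * dot v n * (e * dot v n') = e ^+ 2 * - (dot v n * dot v n') by ring.
  by rewrite e1 mul1r oppr_gt0.
have := opposite_sides nn E1 E2 vv; rewrite exprMn => H.
by apply: filterS (outside_ray Wt tr H) => s; exact: sub.
Qed.

Lemma branch_crossings : \forall q \near (double_map 0, double_map 0), crossings D q ->
  double_points D q /\
  local_region D (proj q.1) [:: (-1) *: normal D q.1; 1 *: normal D q.2] =
  local_region D (proj q.1) [:: 1 *: normal D q.1; (-1) *: normal D q.2].
Proof.
have [d [r [d0 reg]]] := branch_region.
have p0 : proj (double_map 0) = psi 0 by rewrite proj_double double_base0.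
have [U0 f0] := chart_in dif W0.
have nU : \forall p \near double_map 0, U (proj p) by apply: (near_U dif); rewrite p0.
(* On the double line the second umbrella coordinate is t^2, so bounding it by d^2 bounds [t] by
   [d]. *)
have nd : \forall p \near double_map 0, phi (proj p) 0 (inord 1) < d ^+ 2.
  have c : {for double_map 0, continuous (fun p => phi (proj p))}.
    apply: continuous_comp; first exact: proj_continuous.
    by apply: (phi_continuous dif); rewrite p0.
  have := cvg_coord (j := inord 1) _ c; rewrite p0 f0 mxE => c1.
  have d2 : 0 < d ^+ 2 by exact: exprn_gt0.
  exact: (cvgr_lt _ (c1 _) _ d2).
have n1 : \forall q \near (double_map 0, double_map 0),
    U (proj q.1) /\ phi (proj q.1) 0 (inord 1) < d ^+ 2.
  exact: (near_fst (z := (double_map 0, double_map 0)) (near_and nU nd)).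
apply: filterS n1 => -[q q'] /= [Uq qd] [/= Fq Fq' qq' hq].
have [u [pu qE]] := surf_branch Uq Fq.
have [u' [pu' qE']] := surf_branch (p := q') ltac:(by rewrite -qq') Fq'.
have uu' : u <> u' by move=> E; move: hq; rewrite qE qE' E ltxx.
have [t [t0 uE uE']] := whitney_inj (etrans (esym pu) (etrans (congr1 phi qq') pu')) uu'.
have td : `|t| < d.
  move: qd; rewrite pu uE whitney_double umbrellaE -real_normK ?num_real//.
  by rewrite ltr_pXn2r ?nnegrE ?(ltW d0).
have [Wt {}reg] := reg t t0 td.
have {}qE : q = double_map t by rewrite qE uE.
have {}qE' : q' = double_map (- t) by rewrite qE' uE'.
have pq : proj q = psi (double_base t) by rewrite qE proj_double.
split; last first.
  rewrite pq qE qE'; have := reg 1 (expr1n _ 2); have := reg (-1).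
  rewrite sqrrN expr1n => /(_ erefl); by rewrite opprK => -> ->.
split=> //=; apply/seteqP; split=> p.
  move=> [Fp /= pp]; have Up : U (proj p) by rewrite pp.
  have [w [pw pE]] := surf_branch Up Fp.
  have [wt|wt] := eqVneq w (uv 0 t); first by left; rewrite /= qE pE wt.
  right; rewrite /= qE' pE.
  have E : whitney (uv 0 t) = whitney w by rewrite -pw pp pu uE.
  have [t' [_ /rowP/(_ 1) tt ->]] := whitney_inj E (fun e => negP wt (introT (@eqP _ _ _) (esym e))).
  by move: tt; rewrite !uvE => ->.
by case=> ->; split.
Qed.
End Branch.

Section Diagonal.
Variables (R : realType) (D : diagram R).
Local Notation R4 := 'rV[R]_4.

(** In a chart of sheets the surface near [P] is a single graph and has no crossings, so only branch
    points matter. *)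
Lemma diagonal_crossings (P : R4) : surf D P -> \forall q \near (P, P), crossings D q ->
  double_points D q /\
  local_region D (proj q.1) [:: (-1) *: normal D q.1; 1 *: normal D q.2] =
  local_region D (proj q.1) [:: 1 *: normal D q.1; (-1) *: normal D q.2].
Proof.
move=> FP; have fP : fibre D (proj P) P by [].
have [[m [U [W [phi [psi [h [m3 dif [W0 p0] hs [hd hF]]]]]]]]|br] := genericE D (proj P).
  have [i [im _ PE]] := (fibre_sheet dif hF P W0).1 ltac:(by rewrite p0).
  have [U0 f0] := chart_in dif W0.
  have nP : \forall p \near P, surf D p ->
      phi (proj p) 0 (inord i) = 0 /\ height p = h i (proj p).
    apply: (sheet_local dif hs hd hF im); rewrite -?p0 ?f0 ?mxE//.
    by rewrite PE height_lift4.
  have := near_and (near_fst (z := (P, P)) nP) (near_snd (z := (P, P)) nP).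
  apply: filterS => q [H1 H2] [F1 F2 pq]; have [_ h1] := H1 F1; have [_ h2] := H2 F2.
  by rewrite h1 h2 pq ltxx.
have [U [W [phi [psi [h [dif [Uy py] [hs h1] hinj hF]]]]]] := br.
have [Wy yp] := chart_out dif Uy; rewrite py in Wy yp.
have F0 := double_map0_surf dif Wy hF.
have pr0 : proj (double_map psi h 0) = proj P by rewrite proj_double double_base0.
have -> : P = double_map psi h 0 by apply: (branch_fibre br fP); split.
exact: (branch_crossings dif Wy hs h1 hF hinj).
Qed.
End Diagonal.

(** * The labels of the double points *)

Section Geometry.
Variables (R : realType) (D : diagram R).
Local Notation R3 := 'rV[R]_3.
Local Notation R4 := 'rV[R]_4.

Lemma third_index i j : (i < 3)%N -> (j < 3)%N -> i != j ->
  exists l, [/\ (l < 3)%N, i != l & j != l].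
Proof. by move=> i3 j3 ij; exists (3 - i - j)%N; split; lia. Qed.

Lemma crossing_chart q : crossings D q ->
  exists m U W phi psi h i j l, [/\ sheet_chart D (proj q.1) m U W phi psi h,
    (i < m)%N, (j < m)%N, (l < 3)%N & [/\ i != j, i != l, j != l,
    q = (sheet psi h i 0, sheet psi h j 0) & h j (psi 0) < h i (psi 0)]].
Proof.
case: q => P Q [/= FP FQ PQ hQP].
have ne : P <> Q by move=> E; move: hQP; rewrite E ltxx.
have [m [U [W [phi [psi [h [i [j [ch im jm [ij PE QE]]]]]]]]]] := fibre_chart FP FQ PQ ne.
have [m3 _ _ _ _] := ch.
have [l [l3 il jl]] := third_index (leq_trans im m3) (leq_trans jm m3) ij.
exists m, U, W, phi, psi, h, i, j, l; split=> //; split=> //; first by rewrite -PE -QE.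
by move: hQP; rewrite PE QE !height_lift4.
Qed.

Lemma sheet_chart_rho y m U W phi psi h : sheet_chart D y m U W phi psi h ->
  exists2 rho : R, 0 < rho & forall z : R3, `|z| < rho ->
    W z /\ forall i, (i < m)%N -> z 0 (inord i) = 0 ->
      0 < lam D psi h i 0 * lam D psi h i z.
Proof.
move=> [m3 dif [W0 _] hs [hd hF]]; have [rho [rho0 H]] := good_radius m3 dif hs hd hF W0.
by exists rho.
Qed.

Lemma side_self q : side D q q = 0.
Proof. by rewrite /side subrr /triple dotC dot0l. Qed.

Lemma crossing_arc q : crossings D q ->
  exists c k d, arc (crossings D) (side D) c k d /\ c 0 = q.
Proof.
move=> /crossing_chart[m [U [W [phi [psi [h [i [j [l [ch im jm l3 [ij il jl -> hij]]]]]]]]]]].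
have [rho rho0 rhoP] := sheet_chart_rho ch; have [m3 dif [W0 _] hs [hd hF]] := ch.
have [d [ad _ _]] := arc_exists m3 dif hs hd hF rho0 rhoP im jm l3 ij il jl hij.
by exists (arc_map D psi h i j l), (arc_inv D phi psi h i j l), d; rewrite arc_map0.
Qed.

(** Different projections and the wrong strict order of heights are open conditions, and equal
    projections with equal heights would make the two points equal. *)
Lemma crossing_neq z : surf D z.1 -> surf D z.2 -> ~ crossings D z -> z.1 <> z.2 ->
  \forall q \near z, ~ crossings D q.
Proof.
case: z => P Q /= FP FQ nc PQ.
have c1 : {for (P, Q), continuous (fun q : R4 * R4 => proj q.1 - proj q.2)}.
  apply: cvgB.
    apply: (@continuous_comp _ _ _ fst (@proj R)); first exact: cvg_fst.
    exact: proj_continuous.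
  apply: (@continuous_comp _ _ _ snd (@proj R)); first exact: cvg_snd.
  exact: proj_continuous.
have c2 : {for (P, Q), continuous (fun q : R4 * R4 => height q.1 - height q.2)}.
  apply: cvgB.
    apply: (@continuous_comp _ _ _ fst (@height R)); first exact: cvg_fst.
    exact: height_continuous.
  apply: (@continuous_comp _ _ _ snd (@height R)); first exact: cvg_snd.
  exact: height_continuous.
have [pp|pp] := eqVneq (proj P) (proj Q); last first.
  have n0 : proj P - proj Q != 0 by rewrite subr_eq0.
  have : \forall q \near (P, Q), proj q.1 - proj q.2 != 0 by exact: (cvgr_neq0 _ c1 n0).
  by apply: filterS => q /eqP H [_ _ E _]; apply: H; rewrite E subrr.
have [hh|hh|hh] := ltgtP (height P) (height Q).
- have n0 : height P - height Q < 0 by rewrite subr_lt0.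
  have : \forall q \near (P, Q), height q.1 - height q.2 < 0 by exact: (cvgr_lt _ c2 _ n0).
  by apply: filterS => q + [_ _ _]; rewrite subr_lt0 => /lt_trans/[apply]; rewrite ltxx.
- by case: nc.
- by case: PQ; rewrite -(lift4K P) -(lift4K Q) pp hh.
Qed.
End Geometry.

Lemma order3_unique (R : realDomainType) (T : Type) (f : T -> R) a b c a' b' c' :
  f c < f b -> f b < f a -> f c' < f b' -> f b' < f a' ->
  [set a'; b'; c'] a -> [set a'; b'; c'] b -> [set a'; b'; c'] c ->
  [/\ a = a', b = b' & c = c'].
Proof.
move=> h1 h2 h3 h4 fa fb fc.
case: fa => [[]|] /= Ea; case: fb => [[]|] /= Eb; case: fc => [[]|] /= Ec; subst a b c => //.
all: exfalso; lra.
Qed.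

(** * Triple points and their finiteness *)

Section Triples.
Variables (R : realType) (D : diagram R).
Local Notation R3 := 'rV[R]_3.
Local Notation R4 := 'rV[R]_4.

Lemma triple_chart q : triple_points D q ->
  exists U W phi psi h i j l, sheet_chart D (proj q.1.1) 3 U W phi psi h /\
  [/\ (i < 3)%N, (j < 3)%N, (l < 3)%N,
    [/\ i != j, i != l, j != l & q = (sheet psi h i 0, sheet psi h j 0, sheet psi h l 0)] &
    h j (psi 0) < h i (psi 0) /\ h l (psi 0) < h j (psi 0)].
Proof.
case: q => -[P Q] T [/= fib /andP[hTQ hQP]].
have fP : fibre D (proj P) P by rewrite fib; left; left.
have fQ : fibre D (proj P) Q by rewrite fib; left; right.
have fT : fibre D (proj P) T by rewrite fib; right.
have ne : P <> Q by move=> E; move: hQP; rewrite E ltxx.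
have [m [U [W [phi [psi [h [i [j [ch im jm [ij PE QE]]]]]]]]]] :=
  fibre_chart fP.1 fQ.1 (esym fQ.2) ne.
have [m3 dif [W0 p0] hs [hd hF]] := ch.
have [l [lm _ TE]] := (fibre_sheet dif hF T W0).1 ltac:(by rewrite p0).
have il : i != l by apply/eqP => E; move: (lt_trans hTQ hQP); rewrite PE TE E ltxx.
have jl : j != l by apply/eqP => E; move: hTQ; rewrite QE TE E ltxx.
have mE : m = 3 by move: m3 im jm lm ij il jl; lia.
rewrite mE in ch im jm lm.
exists U, W, phi, psi, h, i, j, l; split=> //; split=> //; first by split=> //; rewrite -PE -QE -TE.
by move: hQP hTQ; rewrite PE QE TE !height_lift4.
Qed.

Lemma chart_triple y U W phi psi h i j l : sheet_chart D y 3 U W phi psi h ->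
  (i < 3)%N -> (j < 3)%N -> (l < 3)%N -> i != j -> i != l -> j != l ->
  h j (psi 0) < h i (psi 0) -> h l (psi 0) < h j (psi 0) ->
  triple_points D (sheet psi h i 0, sheet psi h j 0, sheet psi h l 0).
Proof.
move=> [m3 dif [W0 _] hs [hd hF]] i3 j3 l3 ij il jl hij hjl.
split; last by rewrite /= !height_lift4 hjl.
rewrite /= proj_lift4; apply/seteqP; split=> p.
  move=> /(fibre_sheet dif hF _ W0)[e [e3 _ ->]].
  have : [|| e == i, e == j | e == l] by move: e3 i3 j3 l3 ij il jl; lia.
  by case/or3P => /eqP ->; [left; left|left; right|right].
have H e : (e < 3)%N -> fibre D (psi 0) (sheet psi h e 0).
  by move=> e3; apply/(fibre_sheet dif hF _ W0); exists e; rewrite mxE.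
by case=> [[]|] ->; exact: H.
Qed.

Lemma triple_fibre q : triple_points D q ->
  [/\ fibre D (proj q.1.1) q.1.1, fibre D (proj q.1.1) q.1.2 & fibre D (proj q.1.1) q.2].
Proof. by case: q => -[P Q] T [/= -> _]; split; [left; left|left; right|right]. Qed.

Lemma triple_proj_inj q q' : triple_points D q -> triple_points D q' ->
  proj q.1.1 = proj q'.1.1 -> q = q'.
Proof.
move=> Tq Tq' E; have [f1 f2 f3] := triple_fibre Tq.
case: q Tq E f1 f2 f3 => -[P Q] T [/= _ /andP[a1 a2]] E.
case: q' Tq' E => -[P' Q'] T' [/= fib /andP[b1 b2]] E.
rewrite E fib => f1 f2 f3.
have H := order3_unique (f := @height R) a1 a2 b1 b2 f1 f2 f3.
by case: H => -> -> ->.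
Qed.

(** In a chart of sheets a triple point annuls all three coordinates, so it is the centre; near a
    branch point there is none, because the umbrella map is at most two to one. *)
Lemma triple_isolated y : \forall x \near y,
  (exists2 q, triple_points D q & proj q.1.1 = x) -> x = y.
Proof.
have [[m [U [W [phi [psi [h [m3 dif [W0 p0] hs [hd hF]]]]]]]]|] := genericE D y.
  have [U0 _] := chart_in dif W0; rewrite p0 in U0.
  have nU : \forall x \near y, U x by have [oU _ _ _ _] := dif; exact: open_nbhs_nbhs.
  apply: filterS nU => x Ux [q Tq qx]; have [Wx px] := chart_out dif Ux.
  have [f1 f2 f3] := triple_fibre Tq; rewrite qx -px in f1 f2 f3.
  have [i [im zi iE]] := (fibre_sheet dif hF _ Wx).1 f1.
  have [j [jm zj jE]] := (fibre_sheet dif hF _ Wx).1 f2.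
  have [l [lm zl lE]] := (fibre_sheet dif hF _ Wx).1 f3.
  have [_ /andP[h1 h2]] := Tq.
  have ij : i != j by apply/eqP => E; move: h2; rewrite iE jE E ltxx.
  have jl : j != l by apply/eqP => E; move: h1; rewrite jE lE E ltxx.
  have il : i != l by apply/eqP => E; move: (lt_trans h1 h2); rewrite iE lE E ltxx.
  rewrite -px -p0; congr psi; apply/rowP => a; rewrite [RHS]mxE -[a]inord_val.
  have : [|| val a == i, val a == j | val a == l].
    by move: (ltn_ord a) m3 im jm lm ij il jl => /=; lia.
  by case/or3P => /eqP ->.
move=> [U [W [phi [psi [h [dif [Uy _] _ _ hF]]]]]].
have nU : \forall x \near y, U x by have [oU _ _ _ _] := dif; exact: open_nbhs_nbhs.
apply: filterS nU => x Ux [q Tq qx].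
have [f1 f2 f3] := triple_fibre Tq; rewrite qx in f1 f2 f3.
have S p : fibre D x p -> exists u, phi x = whitney u /\ p = branch_map psi h u.
  move=> [Fp /= pp]; have [|u [uE pE]] := surf_branch dif hF (p := p) _ Fp; first by rewrite pp.
  by exists u; rewrite -uE pp.
have [u1 [w1 e1]] := S _ f1; have [u2 [w2 e2]] := S _ f2; have [u3 [w3 e3]] := S _ f3.
have [_ /andP[h1 h2]] := Tq.
have u12 : u1 <> u2 by move=> E; move: h2; rewrite e1 e2 E ltxx.
have u13 : u1 <> u3 by move=> E; move: (lt_trans h1 h2); rewrite e1 e3 E ltxx.
have [t [_ a1 a2]] := whitney_inj (etrans (esym w1) w2) u12.
have [t' [_ b1 b3]] := whitney_inj (etrans (esym w1) w3) u13.
move: h1; rewrite e2 e3 a2 b3; move: a1; rewrite b1 => /rowP/(_ 1); rewrite !uvE => ->.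
by rewrite ltxx.
Qed.

(** The heights order a fibre, so a triple point is determined by its projection, and these
    projections are isolated in the compact projection of the surface. *)
Lemma finite_triple_points : finite_set (triple_points D).
Proof.
pose S := [set x : R3 | exists2 q, triple_points D q & proj q.1.1 = x].
have finS : finite_set S.
  have [cF _] := surfP D.
  have cK : compact (@proj R @` surf D).
    by apply: continuous_compact => //; apply: continuous_subspaceT; exact: proj_continuous.
  apply: (finite_isolated cK) => [x [q Tq <-]|y _].
    by have [[Fp _] _ _] := triple_fibre Tq; exists q.1.1.
  exact: triple_isolated.
have /choice[g Hg] : forall x, exists q, S x -> triple_points D q /\ proj q.1.1 = x.
  move=> x; case: (pselect (S x)) => [[q Tq qx]|nS]; first by exists q.
  by exists (0, 0, 0).
apply: (sub_finite_set _ (finite_image g finS)) => q Tq.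
have Sq : S (proj q.1.1) by exists q.
exists (proj q.1.1) => //; have [Tg pg] := Hg _ Sq.
exact: triple_proj_inj Tg Tq pg.
Qed.
End Triples.

Definition limits_at (R : realType) (D : diagram R) (T : Type)
    (f : 'rV[R]_4 * 'rV[R]_4 -> T) q a b : Prop :=
  (\forall q' \near q, crossings D q' -> 0 < side D q q' -> f q' = a) /\
  (\forall q' \near q, crossings D q' -> side D q q' < 0 -> f q' = b).

(** * Labels on the double edges at a triple point *)

Section TripleColors.
Variables (R : realType) (D : diagram R) (X : choiceType) (br : X -> X -> X -> X).
Local Notation R3 := 'rV[R]_3.
Local Notation R4 := 'rV[R]_4.
Variables (U W : set R3) (phi psi : R3 -> R3) (h : nat -> R3 -> R^o) (rho : R).
Hypothesis dif : diffeo U W phi psi.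
Hypothesis hs : forall i, (i < 3)%N -> smooth_on U (h i).
Hypothesis hd : forall i j x, (i < 3)%N -> (j < 3)%N -> i <> j -> U x ->
  phi x 0 (inord i) = 0 -> phi x 0 (inord j) = 0 -> h i x <> h j x.
Hypothesis hF : forall p, U (proj p) -> surf D p <->
  exists2 i, (i < 3)%N & phi (proj p) 0 (inord i) = 0 /\ height p = h i (proj p).
Hypothesis rho0 : 0 < rho.
Hypothesis rhoP : forall z : R3, `|z| < rho ->
  W z /\ forall i, (i < 3)%N -> z 0 (inord i) = 0 -> 0 < lam D psi h i 0 * lam D psi h i z.

Local Notation oct := (octant_region D psi h rho).

(** The coloring relation is available at double points only. One is found on the arc of the two
    sheets, off the third sheet and on the side of it prescribed by [c]. *)
Lemma octant_ktq i j l (G : coloring R X) c : ktq_coloring D br G ->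
  (i < 3)%N -> (j < 3)%N -> (l < 3)%N -> i != j -> i != l -> j != l ->
  h j (psi 0) < h i (psi 0) -> c != 0 ->
  G (oct (pick3 i j 1 (-1) c)) = br (G (oct (pick3 i j (-1) (-1) c)))
    (G (oct (pick3 i j (-1) 1 c))) (G (oct (pick3 i j 1 1 c))).
Proof.
move=> HG i3 j3 l3 ij il jl hij c0.
have [d [ad dr hd0]] :=
  arc_exists (leqnn 3) dif hs hd hF rho0 rhoP i3 j3 l3 ij il jl hij.
have d0 : 0 < d by have [] := ad.
pose x := c * lam D psi h l 0 * arc_sign D psi h i j l.
have x0 : x != 0.
  rewrite /x !mulf_neq0 ?(lam0_neq0 rho0 rhoP)//.
  apply/eqP => e0; have := eps_sqr (leqnn 3) dif hs hd hF rho0 rhoP i3 j3 l3 ij il jl.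
  by rewrite e0 mul0r => /eqP; rewrite eq_sym oner_eq0.
(* Half of the radius stays within the arc; the sign of [x] selects the side [c] of the third
   sheet. *)
pose t := d / 2 * Num.sg x.
have td : `|t| = d / 2.
  by rewrite normrM normr_sg x0 mulr1 gtr0_norm// divr_gt0.
have td' : `|t| < d by rewrite td ltr_pdivrMr// ltr_pMr// ltr1n.
have t0 : t != 0 by rewrite -normr_gt0 td divr_gt0.
have Hl : (l < 3)%N -> 0 < c * lam D psi h l 0 * (t * arc_sign D psi h i j l).
  move=> _; rewrite mulrCA -/x /t -(mulrA (d / 2)) -normrEsg mulr_gt0 ?divr_gt0//.
  by rewrite normr_gt0.
have tr := lt_le_trans td' dr.
have reg a b : a != 0 -> b != 0 -> _ := fun a0 b0 =>
  edge_region (leqnn 3) dif hs hd hF rho0 rhoP i3 j3 l3 ij il jl hij tr a0 b0 c0 Hl.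
have dbl := double_arc (leqnn 3) dif hs hd hF rho0 rhoP i3 j3 l3 ij il jl hij tr (fun=> t0) (hd0 t td').
have := HG _ _ dbl; rewrite /= !reg ?oppr_eq0 ?oner_eq0//.
Qed.

Variables (p k : nat) (C : nat -> coloring R X) (A : comPzRingType).
Hypothesis hC : layered_coloring D br p k C.
Variables i j l : nat.
Hypotheses (i3 : (i < 3)%N) (j3 : (j < 3)%N) (l3 : (l < 3)%N).
Hypotheses (ij : i != j) (il : i != l) (jl : j != l).
Hypotheses (hij : h j (psi 0) < h i (psi 0)) (hjl : h l (psi 0) < h j (psi 0)).

Definition sgn (b : bool) : R := if b then 1 else -1.
Definition triple_octant (t m b : bool) := oct (pick3 i j (sgn t) (sgn m) (sgn b)).
Local Notation reg := triple_octant.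

Lemma sgn_neq0 b : sgn b != 0.
Proof. by case: b; rewrite ?oppr_eq0 oner_eq0. Qed.

Lemma pick_il (a b c : R) : oct (pick3 i l a c b) = oct (pick3 i j a b c).
Proof.
apply: octant_region_eq => e e3; rewrite /pick3.
case: (eqVneq e i) => // ei; case: (eqVneq e j) => [->|ej]; first by rewrite (negbTE jl).
by case: eqP => // el; move: e3 i3 j3 l3 ij il jl ei ej el; lia.
Qed.

Lemma pick_jl (a b c : R) : oct (pick3 j l b c a) = oct (pick3 i j a b c).
Proof.
apply: octant_region_eq => e e3; rewrite /pick3.
case: (eqVneq e j) => [->|ej]; first by rewrite eq_sym (negbTE ij).
case: (eqVneq e i) => [->|ei]; first by rewrite (negbTE il).
by case: eqP => // el; move: e3 i3 j3 l3 ij il jl ei ej el; lia.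
Qed.

Lemma ktq_top_middle b : C p (reg true false b) =
  br (C p (reg false false b)) (C p (reg false true b)) (C p (reg true true b)).
Proof. by have [kC _ _] := hC; apply: (octant_ktq (l := l)) => //; exact: sgn_neq0. Qed.

Lemma ktq_top_bottom m : C p (reg true m false) =
  br (C p (reg false m false)) (C p (reg false m true)) (C p (reg true m true)).
Proof.
have [kC _ _] := hC; rewrite /triple_octant -!pick_il.
have lj : l != j by rewrite eq_sym.
exact: (octant_ktq kC i3 l3 j3 il ij lj (lt_trans hjl hij) (sgn_neq0 m)).
Qed.

Lemma ktq_middle_bottom t : C p (reg t true false) =
  br (C p (reg t false false)) (C p (reg t false true)) (C p (reg t true true)).
Proof.
have [kC _ _] := hC; rewrite /triple_octant -!pick_jl.
have ji : j != i by rewrite eq_sym.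
have li : l != i by rewrite eq_sym.
exact: (octant_ktq kC j3 l3 i3 jl ji li hjl (sgn_neq0 t)).
Qed.

Lemma left_triple e (t m b : bool) : (0 < e <= p)%N -> (t + m + b = 1)%N ->
  C e.-1 (reg t m b) = br (C e.-1 (reg false false false)) (C e (reg false false false))
    (C e (reg t m b)).
Proof.
have [_ lC _] := hC => ep tmb; apply: (lC e ep).
(* The one sheet that separates this region from the source region. *)
pose f := if t then i else if m then j else l.
have f3 : (f < 3)%N by rewrite /f; case: (t); case: (m).
have := sheet_arrow (leqnn 3) dif hs hd hF rho0 rhoP (s := fun=> -1) f3.
have E s s' : (forall e, (e < 3)%N -> s e = s' e) -> oct s = oct s' := @octant_region_eq _ _ _ _ _ _ _.
rewrite (E _ (pick3 i j (-1) (-1) (-1))); last first.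
  by move=> a _; rewrite /pick3; case: (a == f); case: (a == i); case: (a == j).
rewrite (E (fun a => if a == f then 1 else -1) (pick3 i j (sgn t) (sgn m) (sgn b))).
  by move=> H; apply: H => a _; rewrite oppr_eq0 oner_eq0.
move=> a a3; rewrite /pick3 /f /sgn.
case: t tmb {f f3} => [|]; case: m => [|]; case: b => [|] //= _;
case: (eqVneq a i) => ai; case: (eqVneq a j) => aj; case: (eqVneq a l) => al //.
all: by move: a3 i3 j3 l3 ij il jl ai aj al; lia.
Qed.

Lemma right_triple e (t m b : bool) : (p <= e < p + k)%N -> (t + m + b = 2)%N ->
  C e.+1 (reg t m b) = br (C e (reg t m b)) (C e (reg true true true))
    (C e.+1 (reg true true true)).
Proof.
have [_ _ rC] := hC => ep tmb; apply: (rC e ep).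
(* The one sheet that separates this region from the target region. *)
pose f := if ~~ t then i else if ~~ m then j else l.
have f3 : (f < 3)%N by rewrite /f; case: (t); case: (m).
have := sheet_arrow (leqnn 3) dif hs hd hF rho0 rhoP (s := fun=> 1) f3.
have E s s' : (forall e, (e < 3)%N -> s e = s' e) -> oct s = oct s' := @octant_region_eq _ _ _ _ _ _ _.
rewrite (E (fun a => if a == f then 1 else 1) (pick3 i j 1 1 1)); last first.
  by move=> a _; rewrite /pick3; case: (a == f); case: (a == i); case: (a == j).
rewrite (E (fun a => if a == f then -1 else 1) (pick3 i j (sgn t) (sgn m) (sgn b))).
  by move=> H; apply: H => a _; rewrite oner_eq0.
move=> a a3; rewrite /pick3 /f /sgn.
case: t tmb {f f3} => [|]; case: m => [|]; case: b => [|] //= _;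
case: (eqVneq a i) => ai; case: (eqVneq a j) => aj; case: (eqVneq a l) => al //.
all: by move: a3 i3 j3 l3 ij il jl ai aj al; lia.
Qed.

Local Notation path := (triple_path p k C reg).
Local Notation label := (edge_label D (edge_path p k C)).
Let P e : R4 := sheet psi h e 0.

Lemma colored_path_triple : colored_path D p k C (P i, P j, P l) = path.
Proof.
have reg3 a b c : a != 0 -> b != 0 -> c != 0 -> _ := fun a0 b0 c0 =>
  triple_region (leqnn 3) dif hs hd hF rho0 rhoP i3 j3 l3 ij il jl hij l3 (a := a) (b := b) (c := c) a0 b0 c0.
rewrite /colored_path /= !proj_lift4.
rewrite !reg3 ?oppr_eq0 ?oner_eq0//.
Qed.

Lemma normal_triple_neq0 : triple (normal D (P i)) (normal D (P j)) (normal D (P l)) != 0.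
Proof.
have [W0 _] := rhoP (z := 0) ltac:(by rewrite normr0).
have z0 e : (0 : R3) 0 (inord e) = 0 by rewrite mxE.
have := frame_normal3 (leqnn 3) dif hs hd hF i3 j3 l3 ij il jl l3 W0 (z0 i) (z0 j) (z0 l).
move=> E; apply: contra_eq_neq E => ->; rewrite mul0r eq_sym.
by rewrite !mulf_neq0 ?(lam0_neq0 rho0 rhoP).
Qed.

Definition positive_triple : bool :=
  0 < triple (normal D (P i)) (normal D (P j)) (normal D (P l)).

Lemma negative_triple : (triple (normal D (P i)) (normal D (P j)) (normal D (P l)) < 0) =
  ~~ positive_triple.
Proof. by rewrite /positive_triple -leNgt lt_neqAle normal_triple_neq0. Qed.

Lemma triple_permE (a b c : R3) :
  (triple a c b = - triple a b c) * (triple b c a = triple a b c).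
Proof. by split; rewrite !tripleE; ring. Qed.

(** The third sheet is the bottom one. The left face is the label on its positive side, which lies
    ahead on the curve exactly at a positive triple point. *)
Lemma limits_top_middle : limits_at D label (P i, P j)
  (if positive_triple then dL br p path else dR br p path)
  (if positive_triple then dR br p path else dL br p path).
Proof.
have [-> _ _] := dL_triple k ktq_top_middle ktq_top_bottom ktq_middle_bottom left_triple.
have [-> _ _] := dR_triple ktq_top_middle ktq_top_bottom ktq_middle_bottom right_triple.
have := edge_label_triple (leqnn 3) dif hs hd hF rho0 rhoP i3 j3 l3 ij il jl hij (edge_path p k C) l3.
rewrite /normal_sign -/positive_triple.
by case: positive_triple; rewrite ?opprK.
Qed.

(** The third sheet is the middle one. Moving it to the last place is an odd permutation, which
    exchanges the two sides and matches the opposite sign of face [p + 1] in the boundary. *)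
Lemma limits_top_bottom : limits_at D label (P i, P l)
  (if positive_triple then dR br p.+1 path else dL br p.+1 path)
  (if positive_triple then dL br p.+1 path else dR br p.+1 path).
Proof.
have [_ -> _] := dL_triple k ktq_top_middle ktq_top_bottom ktq_middle_bottom left_triple.
have [_ -> _] := dR_triple ktq_top_middle ktq_top_bottom ktq_middle_bottom right_triple.
have lj : l != j by rewrite eq_sym.
have := edge_label_triple (leqnn 3) dif hs hd hF rho0 rhoP i3 l3 j3 il ij lj (lt_trans hjl hij)
  (edge_path p k C) j3.
rewrite /normal_sign !pick_il (triple_permE _ _ _).1 oppr_gt0 negative_triple if_neg.
by case: positive_triple; rewrite ?opprK.
Qed.

(** The third sheet is the top one. Moving it to the last place is a cyclic permutation, so the
    sides are as for face [p]. *)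
Lemma limits_middle_bottom : limits_at D label (P j, P l)
  (if positive_triple then dL br p.+2 path else dR br p.+2 path)
  (if positive_triple then dR br p.+2 path else dL br p.+2 path).
Proof.
have [_ _ ->] := dL_triple k ktq_top_middle ktq_top_bottom ktq_middle_bottom left_triple.
have [_ _ ->] := dR_triple ktq_top_middle ktq_top_bottom ktq_middle_bottom right_triple.
have ji : j != i by rewrite eq_sym.
have li : l != i by rewrite eq_sym.
have := edge_label_triple (leqnn 3) dif hs hd hF rho0 rhoP j3 l3 i3 jl ji li hjl
  (edge_path p k C) i3.
rewrite /normal_sign !pick_jl (triple_permE _ _ _).2 -/positive_triple.
by case: positive_triple; rewrite ?opprK.
Qed.
End TripleColors.

(** * Summation over the curve of crossings *)

Section Cycle.
Variables (R : realType) (D : diagram R) (X : choiceType) (br : X -> X -> X -> X).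
Variables (A : comPzRingType) (p k : nat) (C : nat -> coloring R X).
Hypothesis hC : layered_coloring D br p k C.
Local Notation R3 := 'rV[R]_3.
Local Notation R4 := 'rV[R]_4.
Local Notation label := (edge_label D (edge_path p k C)).

Definition positive (r : R4 * R4 * R4) : bool :=
  0 < triple (normal D r.1.1) (normal D r.1.2) (normal D r.2).

Lemma triple_limits r : triple_points D r ->
  let x := colored_path D p k C r in
  [/\ limits_at D label (r.1.1, r.1.2)
        (if positive r then dL br p x else dR br p x)
        (if positive r then dR br p x else dL br p x),
      limits_at D label (r.1.1, r.2)
        (if positive r then dR br p.+1 x else dL br p.+1 x)
        (if positive r then dL br p.+1 x else dR br p.+1 x) &
      limits_at D label (r.1.2, r.2)
        (if positive r then dL br p.+2 x else dR br p.+2 x)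
        (if positive r then dR br p.+2 x else dL br p.+2 x)].
Proof.
move=> /triple_chart[U [W [phi [psi [h [i [j [l [ch [i3 j3 l3 [ij il jl ->] [hij hjl]]]]]]]]]]].
have [rho rho0 rhoP] := sheet_chart_rho ch; have [_ dif [W0 _] hs [hd hF]] := ch.
rewrite /= (colored_path_triple dif hs hd hF rho0 rhoP p k C i3 j3 l3 ij il jl hij).
split.
- exact: (limits_top_middle dif hs hd hF rho0 rhoP hC i3 j3 l3 ij il jl hij hjl).
- exact: (limits_top_bottom dif hs hd hF rho0 rhoP hC i3 j3 l3 ij il jl hij hjl).
- exact: (limits_middle_bottom dif hs hd hF rho0 rhoP hC i3 j3 l3 ij il jl hij hjl).
Qed.

Lemma triple_signE r : triple_sign D A r = if positive r then 1 else -1.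
Proof. by rewrite /triple_sign det_triple. Qed.

Definition pairs : set (R4 * R4) :=
  [set (r.1.1, r.1.2) | r in triple_points D] `|`
  [set (r.1.1, r.2) | r in triple_points D] `|`
  [set (r.1.2, r.2) | r in triple_points D].

Lemma pairs_crossings : pairs `<=` crossings D.
Proof.
have H r : triple_points D r -> [/\ crossings D (r.1.1, r.1.2), crossings D (r.1.1, r.2) &
    crossings D (r.1.2, r.2)].
  move=> Tr; have [[F1 p1] [F2 p2] [F3 p3]] := triple_fibre Tr.
  have [_ /andP[h1 h2]] := Tr; rewrite /= in p2 p3.
  by split; split=> //=; rewrite ?p2 ?p3//; exact: lt_trans h1 h2.
by move=> q [[]|] [r /H[h1 h2 h3] <-].
Qed.

(** Without a third sheet the label is locally constant; with one, its height relative to the other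
    two tells which pair of a triple point [q] is. *)
Lemma crossing_limits q : crossings D q ->
  exists a b, limits_at D label q a b /\ (pairs q \/ a = b).
Proof.
move=> /crossing_chart[m [U [W [phi [psi [h [i [j [l [ch im jm l3 [ij il jl qE hij]]]]]]]]]]].
have [rho rho0 rhoP] := sheet_chart_rho ch; have [m3 dif [W0 _] hs [hd hF]] := ch.
have [ml|lm] := leqP m l.
  exists (label q), (label q); split; last by right.
  have := edge_label_double m3 dif hs hd hF rho0 rhoP im jm l3 ij il jl hij (edge_path p k C) ml.
  by rewrite -qE => H; split; apply: filterS H => q' H /H.
have H := edge_label_triple m3 dif hs hd hF rho0 rhoP im jm l3 ij il jl hij (edge_path p k C) lm.
rewrite -qE in H; do 2 eexists; split; first exact: H.
have mE : m = 3 by move: m3 im jm lm ij il jl; lia.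
left; rewrite {}mE {m3} in ch dif im jm lm hs hd hF rhoP H *.
have h0 e e' : (e < 3)%N -> (e' < 3)%N -> e != e' -> h e (psi 0) != h e' (psi 0).
  move=> e3 e'3 /eqP ee; have [U0 f0] := chart_in dif W0.
  by apply/eqP/hd => //; rewrite f0 mxE.
have ji : j != i by rewrite eq_sym.
have li : l != i by rewrite eq_sym.
have lj : l != j by rewrite eq_sym.
case: (ltgtP (h l (psi 0)) (h j (psi 0))) => hlj.
- left; left; exists (sheet psi h i 0, sheet psi h j 0, sheet psi h l 0); last by rewrite qE.
  exact: (chart_triple ch).
- case: (ltgtP (h l (psi 0)) (h i (psi 0))) => hli.
  + left; right; exists (sheet psi h i 0, sheet psi h l 0, sheet psi h j 0); last by rewrite qE.
    exact: (chart_triple ch).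
  + right; exists (sheet psi h l 0, sheet psi h i 0, sheet psi h j 0); last by rewrite qE.
    exact: (chart_triple ch).
  + by have := h0 l i lm im li; rewrite hli eqxx.
- by have := h0 l j lm jm lj; rewrite hlj eqxx.
Qed.

Lemma limits_unique (T : Type) (f : R4 * R4 -> T) q a b a' b' : crossings D q ->
  limits_at D f q a b -> limits_at D f q a' b' -> a = a' /\ b = b'.
Proof.
move=> Mq [fa fb] [fa' fb'].
have [[q' [Mq' sq' [h1 h2]]] _] := near_side (@crossing_arc _ D) Mq (near_and fa fa').
have [_ [q2 [Mq2 sq2 [h3 h4]]]] := near_side (@crossing_arc _ D) Mq (near_and fb fb').
by rewrite -h1// -h2// -h3// -h4.
Qed.

(** A pair determines the projection of its triple point and hence the triple point itself; the
    strict order of heights keeps the three families of pairs disjoint. *)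
Lemma sum_pairs (J : R4 * R4 -> A) :
  (forall q, crossings D q -> ~ pairs q -> J q = 0) ->
  \sum_(q \in crossings D) J q = \sum_(r \in triple_points D)
    (J (r.1.1, r.1.2) + J (r.1.1, r.2) + J (r.1.2, r.2)).
Proof.
move=> J0; rewrite -(fsbig_widen _ _ _ pairs_crossings); last by move=> q [Mq nq]; exact: J0.
have fT := finite_triple_points D.
have inj (g : R4 * R4 * R4 -> R4 * R4) : (forall r, triple_points D r ->
    proj (g r).1 = proj r.1.1) -> set_inj (triple_points D) g.
  move=> gE r r'; rewrite !inE => Tr Tr' gg; apply: (triple_proj_inj Tr Tr').
  by rewrite -(gE r Tr) -(gE r' Tr') gg.
have p2 r : triple_points D r -> proj r.1.2 = proj r.1.1.
  by move=> Tr; have [_ [_ /= ->] _] := triple_fibre Tr.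
have eqr r r' q : triple_points D r -> triple_points D r' -> proj q = proj r.1.1 ->
    proj q = proj r'.1.1 -> r = r'.
  by move=> Tr Tr' E E'; apply: (triple_proj_inj Tr Tr'); rewrite -E E'.
have irr (u : R4) : height u < height u -> False by rewrite ltxx.
have fI (g : R4 * R4 * R4 -> R4 * R4) : finite_set [set g r | r in triple_points D].
  exact: finite_image.
rewrite /pairs fsbigU//; last 2 first.
- by rewrite finite_setU.
- move=> q [[[r Tr <-]|[r Tr <-]] [r' Tr' [E1 E2]]].
    have E : r = r' by apply: (eqr r r' r.1.1) => //; rewrite -E1 p2.
    by have [_ /andP[_ +]] := Tr; rewrite -E1 E => /irr.
  have E : r = r' by apply: (eqr r r' r.1.1) => //; rewrite -E1 p2.
  by have [_ /andP[_ +]] := Tr; rewrite -E1 E => /irr.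
rewrite fsbigU//; last first.
  move=> q [[r Tr <-] [r' Tr' [E1 E2]]].
  have E : r = r' by apply: (eqr r r' r.1.1) => //; rewrite -E1.
  by have [_ /andP[+ _]] := Tr; rewrite -{1}E2 E => /irr.
rewrite !fsbig_image; [|exact: inj..].
by rewrite -!fsbig_split.
Qed.

(** Near the diagonal the two lateral regions coincide, so the coloring relation expresses the color
    beyond the under-sheet through itself, which is the degeneracy condition. *)
Lemma label_degenerate z : surf D z.1 -> surf D z.2 -> ~ crossings D z ->
  \forall q \near z, crossings D q -> degenerate br p k (label q).
Proof.
case: z => P Q /= FP FQ nc; have [PQ|PQ] := pselect (P = Q); last first.
  by have H := crossing_neq (z := (P, Q)) FP FQ nc PQ; apply: filterS H => q nq /nq.
rewrite -PQ; apply: filterS (diagonal_crossings FP) => q H /H[dq regE].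
have [kC _ _] := hC; have := kC q.1 q.2; rewrite -surjective_pairing => /(_ dq) /= E.
by rewrite -regE in E; apply: edge_path_degenerate.
Qed.

Lemma face_sum y : ~ degenerate br p k y ->
  \sum_(r \in triple_points D) triple_sign D A r *
    (face_coef A br y p (colored_path D p k C r) -
     face_coef A br y p.+1 (colored_path D p k C r) +
     face_coef A br y p.+2 (colored_path D p k C r)) = 0.
Proof.
move=> ny; pose f q : A := (label q == y)%:R.
have lim_f q a b : limits_at D label q a b -> limits_at D f q (a == y)%:R (b == y)%:R.
  by case=> la lb; split; [apply: filterS la|apply: filterS lb] => q' H Mq' /(H Mq') e;
    rewrite /f e.
have /choice[ab Hab] : forall q, exists ab : A * A, crossings D q ->
    limits_at D f q ab.1 ab.2 /\ (pairs q \/ ab.1 = ab.2).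
  move=> q; have [Mq|nM] := pselect (crossings D q); last by exists (0, 0).
  have [a [b [/lim_f H ab]]] := crossing_limits Mq.
  by exists ((a == y)%:R, (b == y)%:R) => _; split=> //; case: ab => [|->]; [left|right].
have [cF _] := surfP D.
have hT : hausdorff_space (R4 * R4)%type by exact: norm_hausdorff.
have J := @jump_sum R _ (crossings D) (side D) hT (@side_self _ D) (@crossing_arc _ D) A
  (surf D `*` surf D) (compact_setX cF cF) _ f (fun q => (ab q).1) (fun q => (ab q).2).
have {J} : \sum_(q \in crossings D) ((ab q).1 - (ab q).2) = 0.
  apply: J.
  - by move=> q [].
  - by move=> q Mq; have [] := Hab q Mq.
  move=> z [z1 z2] nz; apply: filterS (label_degenerate z1 z2 nz) => q H Mq.
  by rewrite /f; case: eqP => // E; case: ny; rewrite -E; exact: H.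
rewrite sum_pairs => [sum0|q Mq nq]; last first.
  by have [_ [|->]] := Hab q Mq; [|rewrite subrr].
rewrite -[RHS]sum0.
apply: eq_fsbigr => r; rewrite inE => Tr.
have Mr q : pairs q -> crossings D q by exact: pairs_crossings.
have M12 : crossings D (r.1.1, r.1.2) by apply: Mr; left; left; exists r.
have M13 : crossings D (r.1.1, r.2) by apply: Mr; left; right; exists r.
have M23 : crossings D (r.1.2, r.2) by apply: Mr; right; exists r.
have [/lim_f l12 /lim_f l13 /lim_f l23] := triple_limits Tr.
(* The values in [ab] were merely chosen; at a crossing one-sided values are unique, which
   identifies them with the faces. *)
have [-> ->] := limits_unique M12 (Hab _ M12).1 l12.
have [-> ->] := limits_unique M13 (Hab _ M13).1 l13.
have [-> ->] := limits_unique M23 (Hab _ M23).1 l23.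
rewrite triple_signE /face_coef; case: (positive r); ring.
Qed.

End Cycle.

Theorem theorem2p15 (R : realType) (D : diagram R)
    (X : choiceType) (br : X -> X -> X -> X) (hX : KTQ br)
    (A : comPzRingType) (p k : nat) (C : nat -> coloring R X)
    (hC : layered_coloring D br p k C) :
  @degenerate_chain A X br p k (p + k).+1
    (@boundary A X br p k (p + k).+2 (@layered_chain R D A X p k C)).
Proof.
apply: degenerate_chainP => [//|y ny].
rewrite /layered_chain fsbig_finite ?boundary_coef; last exact: finite_triple_points.
have := face_sum A hC ny; rewrite fsbig_finite => [->|]; first by rewrite mulr0.
exact: finite_triple_points.
Qed.
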